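(* Let $d$ and $\partial$ be uniformly locally finite metrics on $\mathbb{N}$, and let $E$ and $F$ be Banach spaces with $1$-unconditional bases $\mathcal{E}$ and $\mathcal{F}$ which are $d$-symmetric and $\partial$-symmetric, respectively. Suppose that $(\mathbb{N},\partial)$ has property A and that there is a Banach algebra isomorphism $\Phi:\mathrm{B}_u(d,\mathcal{E})\to\mathrm{B}_u(\partial,\mathcal{F})$ such that $$\Phi(\mathrm{B}_u[d,\mathcal{E}])\subset\mathrm{B}_u^r(\partial,\mathcal{F})\cup\big(\mathcal{L}(F)\setminus\mathcal{L}(F)_r\big)\quad\text{and}\quad\Phi^{-1}(\mathrm{B}_u[\partial,\mathcal{F}])\subset\mathrm{B}_u^r(d,\mathcal{E})\cup\big(\mathcal{L}(E)\setminus\mathcal{L}(E)_r\big).$$ Then $(\mathbb{N},d)$ and $(\mathbb{N},\partial)$ are coarsely equivalent.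
   Context: All Banach spaces are complex unless said otherwise, and ''basis'' means Schauder basis. For a basis $\mathcal{E}=(e_n)_n$ of $E$, $(e_n^* )_n$ denotes the biorthogonal functionals and $\mathcal{L}(E)$ the bounded operators on $E$. Given a metric $d$ on $\mathbb{N}$, $a\in\mathcal{L}(E)$ is a band operator (with respect to $\mathcal{E}$ and $d$) if there is $r>0$ such that $e_m^*(ae_n)=0$ whenever $d(n,m)>r$. $\mathrm{B}_u[d,\mathcal{E}]$ is the algebra of band operators, and the uniform Roe algebra $\mathrm{B}_u(d,\mathcal{E})$ is its operator-norm closure in $\mathcal{L}(E)$. A Banach algebra isomorphism is a bijective algebra homomorphism that is bounded with bounded inverse. $\mathcal{E}$ is $1$-unconditional if $\|\sum_{n\le k}\alpha_ne_n\|\le\|\sum_{n\le k}\beta_ne_n\|$ for all $k$ and all scalars with $|\alpha_n|\le|\beta_n|$. An unconditional basis $\mathcal{E}$ is $d$-symmetric if for all $r>0$ and all bijections $\sigma:A\to B$ between subsets $A,B\subset\mathbb{N}$ with $d(i,\sigma(i))\le r$ for all $i\in A$, there is $C>0$ such that $C^{-1}\|\sum\alpha_ne_n\|\le\|\sum\alpha_ne_{\sigma(n)}\|\le C\|\sum\alpha_ne_n\|$ for all finitely supported scalar families $(\alpha_n)_{n\in A}$. Regular operators: if $\mathcal{E}$ is $1$-unconditional, let $E_{\mathbb{R}}$ be the closed real span of $\mathcal{E}$, a Dedekind complete real Banach lattice under the coordinatewise order; $E$ is its lattice complexification. For $a\in\mathcal{L}(E)$ write $a(x)=a_r(x)+ia_c(x)$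 for $x\in E_{\mathbb{R}}$, with $a_r,a_c\in\mathcal{L}(E_{\mathbb{R}})$. The operator $a$ is regular if each of $a_r,a_c$ is a difference of two positive linear maps on $E_{\mathbb{R}}$ (a linear map is positive if it maps vectors with nonnegative coordinates to such vectors). $\mathcal{L}(E)_r$ is the set of regular operators. For $a\in\mathcal{L}(E)_r$ let $|a|=\sup_{t\in[0,2\pi]}|\cos(t)a_r+\sin(t)a_c|$ (supremum in the Dedekind complete lattice of regular operators on $E_{\mathbb{R}}$) and $\|a\|_r=\||a|\|$. If $d$ is uniformly locally finite and $\mathcal{E}$ is $1$-unconditional, every band operator is regular, and the regular uniform Roe algebra $\mathrm{B}_u^r(d,\mathcal{E})$ is the $\|\cdot\|_r$-closure of $\mathrm{B}_u[d,\mathcal{E}]$ in $\mathcal{L}(E)_r$. A metric $d$ on $\mathbb{N}$ is uniformly locally finite if $\sup_{x}|B_r(x)|<\infty$ for all $r>0$ ($B_r(x)$ the closed $r$-ball). A $d$-partition of unit is a sequence $(\varphi_n:\mathbb{N}\to[0,1])_{n\in\mathbb{N}}$ with $\sup_m|\{n:\varphi_n(m)\ne0\}|<\infty$, $\sup_n\mathrm{diam}(\mathrm{supp}(\varphi_n))<\infty$, and $\sum_n\varphi_n(m)^2=1$ for all $m$. It has $(r,\varepsilon)$-variation if $d(k,m)<r$ implies $\sum_n|\varphi_n(k)-\varphi_n(m)|^2<\varepsilon^2$. A uniformly locally finite $(\mathbb{N},d)$ has property A if for all $r,\varepsilon>0$ there is a $d$-partition of unit with $(r,\varepsilon)$-variation.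 A map $f:(X,d)\to(Y,\partial)$ is coarse if for all $r>0$ there is $s>0$ such that $d(x,y)<r$ implies $\partial(f(x),f(y))<s$; expanding if for all $s>0$ there is $r>0$ such that $d(x,y)>r$ implies $\partial(f(x),f(y))>s$; a coarse embedding if it is both coarse and expanding; a coarse equivalence if moreover $\sup_{y\in Y}\partial(y,f(X))<\infty$. Two spaces are coarsely equivalent if there is a coarse equivalence between them. *)

(* Defs.v *)
From HB Require Import structures.
From mathcomp Require Import all_boot all_order all_algebra.
From mathcomp Require Import all_classical all_reals all_analysis.
From mathcomp Require Import complex.

Set Implicit Arguments.
Unset Strict Implicit.
Unset Printing Implicit Defensive.

Import Order.TTheory GRing.Theory Num.Theory.
Import numFieldNormedType.Exports.

Local Open Scope classical_set_scope.
Local Open Scope card_scope.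
Local Open Scope ring_scope.
Local Open Scope complex_scope.

(* Several metrics on nat are in play, so a metric is a plain function rather
   than a metricType structure carried by nat. *)
Record is_metric (R : realType) (X : Type) (d : X -> X -> R) : Prop := IsMetric {
  metric_ge0 : forall x y, 0 <= d x y;
  metric_eq0 : forall x y, d x y = 0 <-> x = y;
  metricC : forall x y, d x y = d y x;
  metric_triangle : forall x y z, d x z <= d x y + d y z
}.

Section Coarse.
Variable R : realType.

Definition uniformly_locally_finite (d : nat -> nat -> R) : Prop :=
  forall r : R, 0 < r ->
    exists K : nat, forall x, [set y | d x y <= r] #<= `I_K.

Record partition_of_unit (d : nat -> nat -> R) (phi : nat -> nat -> R) : Prop :=
  PartitionOfUnit {
    pou_range : forall n m, 0 <= phi n m <= 1;
    pou_mult : exists K : nat, forall m, [set n | phi n m != 0] #<= `I_K;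
    pou_diam : exists D : R, forall n k l,
      phi n k != 0 -> phi n l != 0 -> d k l <= D;
    pou_sum : forall m, (\sum_(0 <= n <oo) (phi n m ^+ 2)%:E = 1)%E
  }.

Definition has_variation (d : nat -> nat -> R) (phi : nat -> nat -> R)
    (r eps : R) : Prop :=
  forall k m, d k m < r ->
    (\sum_(0 <= n <oo) (`|phi n k - phi n m| ^+ 2)%:E < (eps ^+ 2)%:E)%E.

Definition property_A (d : nat -> nat -> R) : Prop :=
  forall r eps : R, 0 < r -> 0 < eps ->
    exists2 phi, partition_of_unit d phi & has_variation d phi r eps.

Definition coarse (X Y : Type) (d : X -> X -> R) (del : Y -> Y -> R)
    (f : X -> Y) : Prop :=
  forall r : R, 0 < r -> exists2 s : R, 0 < s &
    forall x y, d x y < r -> del (f x) (f y) < s.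

Definition expanding (X Y : Type) (d : X -> X -> R) (del : Y -> Y -> R)
    (f : X -> Y) : Prop :=
  forall s : R, 0 < s -> exists2 r : R, 0 < r &
    forall x y, r < d x y -> s < del (f x) (f y).

Definition coarse_embedding (X Y : Type) (d : X -> X -> R) (del : Y -> Y -> R)
    (f : X -> Y) : Prop :=
  coarse d del f /\ expanding d del f.

Definition coarse_equivalence (X Y : Type) (d : X -> X -> R)
    (del : Y -> Y -> R) (f : X -> Y) : Prop :=
  coarse_embedding d del f /\
  exists D : R, forall y, inf [set del y (f x) | x in [set: X]] <= D.

Definition coarsely_equivalent (X Y : Type) (d : X -> X -> R)
    (del : Y -> Y -> R) : Prop :=
  exists f : X -> Y, coarse_equivalence d del f.

End Coarse.

Section Bases.
Variables (R : realType) (E : completeNormedModType R[i]).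
Implicit Types (d : nat -> nat -> R) (e : nat -> E) (a : E -> E).

Definition expansion e (x : E) : set (nat -> R[i]) :=
  [set c | series (fun n => c n *: e n) @ \oo --> x].

Definition schauder_basis e : Prop :=
  forall x, exists! c : nat -> R[i], expansion e x c.

(* [biorth e m] is the m-th biorthogonal functional of the Schauder basis e. *)
Definition biorth e (m : nat) (x : E) : R[i] :=
  xget (fun=> 0) (expansion e x) m.

Definition one_unconditional e : Prop :=
  forall (k : nat) (al be : nat -> R[i]),
    (forall n, (n <= k)%N -> `|al n| <= `|be n|) ->
    `|\sum_(0 <= n < k.+1) al n *: e n| <= `|\sum_(0 <= n < k.+1) be n *: e n|.

(* A finitely supported family on A is given by al and any N beyond its support. *)
Definition metric_symmetric d e : Prop :=
  forall (r : R) (A B : set nat) (sigma : nat -> nat), 0 < r ->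
    set_bij A B sigma -> (forall i, A i -> d i (sigma i) <= r) ->
    exists2 C : R, 0 < C & forall (al : nat -> R[i]) (N : nat),
      (C^-1)%:C * `|\sum_(0 <= n < N | n \in A) al n *: e n|
        <= `|\sum_(0 <= n < N | n \in A) al n *: e (sigma n)|
      /\ `|\sum_(0 <= n < N | n \in A) al n *: e (sigma n)|
        <= C%:C * `|\sum_(0 <= n < N | n \in A) al n *: e n|.

Definition bounded_op : set (E -> E) := [set a | linear a /\ continuous a].

(* The norm of E takes its values in R[i]; they are real and nonnegative. *)
Definition opnorm_on (D : set E) a : R :=
  sup [set complex.Re `|a x| | x in D `&` [set x | `|x| <= 1]].

Definition opnorm a : R := opnorm_on [set: E] a.

Definition band d e : set (E -> E) :=
  [set a | bounded_op a /\
    exists2 r : R, 0 < r &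
      forall n m, r < d n m -> biorth e m (a (e n)) = 0].

Definition roe d e : set (E -> E) :=
  [set a | bounded_op a /\
    forall eps : R, 0 < eps -> exists2 b, band d e b & opnorm (a - b) < eps].

(* The space E_R. An operator on E_R is represented by a function E -> E, of
   which only the restriction to E_R matters. *)
Definition real_span e : set E :=
  closure [set x | exists N (r : nat -> R),
    x = \sum_(0 <= n < N) (r n)%:C *: e n].

Definition real_part e (x : E) : E :=
  xget 0 [set y | real_span e y /\
    exists2 z, real_span e z & x = y + ('i%C : R[i]) *: z].

Definition imag_part e (x : E) : E :=
  xget 0 [set z | real_span e z /\
    exists2 y, real_span e y & x = y + ('i%C : R[i]) *: z].

Definition nonneg e (x : E) : Prop := forall n, 0 <= biorth e n x.

Record positive_op e (T : E -> E) : Prop := PositiveOp {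
  positive_op_real : forall x, real_span e x -> real_span e (T x);
  positive_op_linear : forall (r : R) x y, real_span e x -> real_span e y ->
    T (r%:C *: x + y) = r%:C *: T x + T y;
  positive_op_nonneg : forall x, real_span e x -> nonneg e x -> nonneg e (T x)
}.

Definition op_le e (S T : E -> E) : Prop := positive_op e (T - S).

Definition real_regular e : set (E -> E) :=
  [set T | exists P Q, [/\ positive_op e P, positive_op e Q &
    forall x, real_span e x -> T x = P x - Q x]].

Definition is_regular_sup e (A : set (E -> E)) (S : E -> E) : Prop :=
  [/\ real_regular e S,
      forall T, A T -> op_le e T S &
      forall U, real_regular e U -> (forall T, A T -> op_le e T U) ->
        op_le e S U].

(* The supremum in the lattice of regular operators on E_R; it is unique only
   as an operator on E_R. *)
Definition regular_sup e (A : set (E -> E)) : E -> E :=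
  xget 0 [set S | is_regular_sup e A S].

Definition real_abs e (T : E -> E) : E -> E :=
  regular_sup e [set S | S = T \/ S = - T].

(* The restrictions to E_R of [real_part e \o a] and [imag_part e \o a] are
   a_r and a_c. *)
Definition regular e : set (E -> E) :=
  [set a | [/\ bounded_op a, real_regular e (real_part e \o a) &
               real_regular e (imag_part e \o a)]].

Definition modulus e a : E -> E :=
  regular_sup e
    [set real_abs e (fun x => (cos t)%:C *: real_part e (a x)
                              + (sin t)%:C *: imag_part e (a x))
    | t in [set t : R | 0 <= t <= 2 * pi]].

Definition regular_norm e a : R := opnorm_on (real_span e) (modulus e a).

Definition regular_roe d e : set (E -> E) :=
  [set a | regular e a /\
    forall eps : R, 0 < eps ->
      exists2 b, band d e b & regular_norm e (a - b) < eps].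

End Bases.

Arguments bounded_op {R} E.

Record banach_algebra_iso (R : realType) (E F : completeNormedModType R[i])
    (A : set (E -> E)) (B : set (F -> F)) (Phi : (E -> E) -> (F -> F)) : Prop :=
  BanachAlgebraIso {
    iso_bij : set_bij A B Phi;
    iso_linear : forall (c : R[i]) a b, A a -> A b ->
      Phi (c *: a + b) = c *: Phi a + Phi b;
    iso_mul : forall a b, A a -> A b -> Phi (a \o b) = Phi a \o Phi b;
    iso_bounded : exists M : R, forall a, A a -> opnorm (Phi a) <= M * opnorm a;
    iso_inv_bounded : exists M : R, forall a, A a ->
      opnorm a <= M * opnorm (Phi a)
  }.

(* Main.v *)
Require Import Defs.
From HB Require Import structures.
From mathcomp Require Import all_boot all_order all_algebra.
From mathcomp Require Import all_classical all_reals all_analysis.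
From mathcomp Require Import complex lra ring zify.

Set Implicit Arguments.
Unset Strict Implicit.
Unset Printing Implicit Defensive.

Import Order.TTheory GRing.Theory Num.Theory.
Import numFieldNormedType.Exports.

Local Open Scope classical_set_scope.
Local Open Scope ring_scope.
Local Open Scope complex_scope.

(* Phi is spatially implemented on matrix units: there are vectors [x j] and
   functionals [y i] such that the entry (i, j) of [Phi a] is [y i (a (x j))].
   In particular the (i, j) entry of [Phi (e_n (x) e_m^* )] is a product
   [U i n * V m j].  Three facts make the coarse equivalence.
   - Every [Phi a] is almost supported near the diagonal, uniformly over the
     matrix units [e_n (x) e_m^*] with [d n m <= r]: otherwise a gliding hump
     along a partial translation produces an element of the Roe algebra with
     large entries far from the diagonal.
   - Rigidity: the projections [Phi (e_n (x) e_n^* )] have an entry bounded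
     away from 0.  Otherwise some of them, [p_l], are almost supported on
     consecutive disjoint blocks and have small entries.  Changing signs on the
     blocks shows that the sum [a] of the [p_l], the image of a coordinate
     projection, is regular; so [a] is close in regular norm to a band operator,
     hence to its own truncation to a band.  A band matrix with small entries
     has small norm, whereas each [p_l] has norm at least 1.
   - Since [Phi] is bounded, [U i n * V m j] is bounded, so that one can
     exchange factors among the large entries.
   Choosing [g n] to be the row of a large entry of [Phi (e_n (x) e_n^* )], and
   symmetrically for the inverse of [Phi], gives coarse maps that are
   inverse to each other up to bounded distance. *)

(** * Real-valued norms and bounded operators *)

Definition rnorm (R : realType) (V : normedZmodType R[i]) (x : V) : R :=
  complex.Re `|x|.

Section RealNorm.
Variable R : realType.

Lemma ReCD (x y : R[i]) : complex.Re (x + y) = complex.Re x + complex.Re y.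
Proof. by case: x y => [? ?] [? ?]. Qed.

Lemma realCM (x y : R) : x%:C * y%:C = (x * y)%:C.
Proof. by rewrite rmorphM. Qed.

Lemma rnormE (V : normedZmodType R[i]) (x : V) : `|x| = (rnorm x)%:C.
Proof. rewrite /rnorm RRe_real; last exact: normr_real. by []. Qed.

Lemma ler_normC (V W : normedZmodType R[i]) (x : V) (y : W) :
  (`|x| <= `|y|) = (rnorm x <= rnorm y).
Proof. by rewrite !rnormE lecR. Qed.

Lemma rnorm_ge0 (V : normedZmodType R[i]) (x : V) : 0 <= rnorm x.
Proof. by rewrite -lecR -rnormE; exact: normr_ge0. Qed.

Lemma rnorm0 (V : normedZmodType R[i]) : rnorm (0 : V) = 0.
Proof. by rewrite /rnorm normr0. Qed.

Lemma rnorm_eq0 (V : normedZmodType R[i]) (x : V) : (rnorm x == 0) = (x == 0).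
Proof. by rewrite -[RHS]normr_eq0 [in RHS]rnormE; apply/eqP/eqP => [->//|/complexI]. Qed.

Lemma rnorm_gt0 (V : normedZmodType R[i]) (x : V) : (0 < rnorm x) = (x != 0).
Proof. by rewrite lt0r rnorm_eq0 rnorm_ge0 andbT. Qed.

Lemma rnormN (V : normedZmodType R[i]) (x : V) : rnorm (- x) = rnorm x.
Proof. by rewrite /rnorm normrN. Qed.

Lemma rnormBC (V : normedZmodType R[i]) (x y : V) : rnorm (x - y) = rnorm (y - x).
Proof. by rewrite /rnorm distrC. Qed.

Lemma rnormD (V : normedZmodType R[i]) (x y : V) :
  rnorm (x + y) <= rnorm x + rnorm y.
Proof. by rewrite -lecR rmorphD /= -!rnormE ler_normD. Qed.

Lemma rnormB (V : normedZmodType R[i]) (x y : V) :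
  rnorm (x - y) <= rnorm x + rnorm y.
Proof. by rewrite -[rnorm y]rnormN rnormD. Qed.

Lemma rnorm_sum (V : normedZmodType R[i]) (I : Type) (s : seq I) (P : pred I)
    (F : I -> V) :
  rnorm (\sum_(i <- s | P i) F i) <= \sum_(i <- s | P i) rnorm (F i).
Proof.
elim/big_ind2: _ => //; first by rewrite rnorm0.
by move=> x1 x2 y1 y2 h1 h2; rewrite (le_trans (rnormD _ _))// lerD.
Qed.

Lemma rnormM (x y : R[i]) : rnorm (x * y) = rnorm x * rnorm y.
Proof. by apply: complexI; rewrite rmorphM /= -!rnormE normrM. Qed.

Lemma rnormZ (V : normedModType R[i]) (c : R[i]) (x : V) :
  rnorm (c *: x) = rnorm c * rnorm x.
Proof. by apply: complexI; rewrite rmorphM /= -!rnormE normrZ. Qed.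

Lemma rnorm1 : rnorm (1 : R[i]) = 1.
Proof. by rewrite /rnorm normr1. Qed.

Lemma rnormV (x : R[i]) : rnorm x^-1 = (rnorm x)^-1.
Proof. by apply: complexI; rewrite fmorphV /= -!rnormE normfV. Qed.

Lemma rnormR (x : R) : rnorm x%:C = `|x|.
Proof. by rewrite /rnorm normc_def /= expr0n addr0 sqrtr_sqr. Qed.

Lemma rnorm_norm (V : normedZmodType R[i]) (x : V) : rnorm (`|x|) = rnorm x.
Proof. by rewrite rnormE rnormR ger0_norm ?rnorm_ge0. Qed.

Lemma rnorm_Re (z : R[i]) : `|complex.Re z| <= rnorm z.
Proof. by rewrite -lecR -rnormE normc_ge_Re. Qed.

Lemma rnorm_Im (z : R[i]) : `|complex.Im z| <= rnorm z.
Proof.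
rewrite /rnorm normc_def /= -[leLHS]sqrtr_sqr ler_sqrt ?sqr_ge0//.
  by rewrite lerDr sqr_ge0.
by rewrite addr_ge0 ?sqr_ge0.
Qed.

Lemma rnorm_ReIm (z : R[i]) : rnorm z <= `|complex.Re z| + `|complex.Im z|.
Proof.
rewrite {1}(complexE z) (le_trans (rnormD _ _))// rnormM !rnormR.
have -> : rnorm ('i%C : R[i]) = 1.
  by rewrite /rnorm normc_def /= expr0n expr1n add0r sqrtr1.
by rewrite mul1r.
Qed.

Lemma cvg_rnormP (V : normedModType R[i]) (u : nat -> V) (l : V) :
  u @ \oo --> l <->
  forall eps : R, 0 < eps -> exists N, forall n, (N <= n)%N -> rnorm (u n - l) < eps.
Proof.
split.
  move=> /cvgrPdist_lt ul eps eps0.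
  have := ul eps%:C; rewrite ltcR => /(_ eps0) [N _ hN].
  by exists N => n /hN /=; rewrite rnormE ltcR rnormBC.
move=> h; apply/cvgrPdist_lt => /= -[a b]; rewrite ltcE /= => /andP[/eqP -> a0].
have [N hN] := h _ a0; exists N => // n /= /hN.
by rewrite rnormBC rnormE => ?; rewrite ltcE /= eqxx.
Qed.

Lemma cauchy_rnorm_cvg (V : completeNormedModType R[i]) (u : nat -> V) :
  (forall eps : R, 0 < eps -> exists N, forall n, (N <= n)%N -> rnorm (u n - u N) < eps) ->
  exists l : V, u @ \oo --> l.
Proof.
move=> h; suff /cauchy_cvgP/cvg_ex[l ul] : cauchy (u @ \oo) by exists l.
apply/cauchyP => /= -[a b]; rewrite ltcE /= => /andP[/eqP -> a0].
have [N hN] := h _ a0; exists (u N); exists N => // n /= /hN.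
rewrite -ball_normE /= rnormBC rnormE => ?.
by rewrite ltcE /= eqxx.
Qed.

Lemma cvg_rnorm_unique (V : normedModType R[i]) (u : nat -> V) (l l' : V) :
  u @ \oo --> l -> u @ \oo --> l' -> l = l'.
Proof. by move=> h1 h2; apply: (cvg_unique _ h1 h2); exact: norm_hausdorff. Qed.

Lemma rnorm_limit_le (V : normedModType R[i]) (u : nat -> V) (l : V) (C : R) N :
  u @ \oo --> l -> (forall n, (N <= n)%N -> rnorm (u n) <= C) -> rnorm l <= C.
Proof.
move=> /cvg_rnormP ul hC; rewrite leNgt; apply/negP => lC.
have [|N' h] := ul (rnorm l - C); first by rewrite subr_gt0.
have := h (maxn N N') (leq_maxr _ _); have := hC (maxn N N') (leq_maxl _ _).
have := rnormB l (u (maxn N N') - 0).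
have := rnormB (u (maxn N N')) (u (maxn N N') - l); rewrite opprB addrC subrK.
lra.
Qed.

Lemma sgnC (z : R[i]) : exists t : R[i], t * z = `|z| /\ rnorm t = 1.
Proof.
have [->|z0] := eqVneq z 0; first by exists 1; rewrite ?rnorm1 ?mulr0 ?normr0.
exists (`|z| / z); split; first by rewrite divfK.
by rewrite rnormM rnormV rnorm_norm divff// rnorm_eq0.
Qed.

Lemma rnorm_eq0P (V : normedZmodType R[i]) (x : V) :
  (forall eps : R, 0 < eps -> rnorm x <= eps) -> x = 0.
Proof.
move=> h; apply/eqP; rewrite -rnorm_eq0 eq_le rnorm_ge0 andbT leNgt.
by apply/negP => x0; have := h (rnorm x / 2); lra.
Qed.

End RealNorm.

Definition rbounded (R : realType) (V W : normedZmodType R[i]) (C : R)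
    (T : V -> W) := forall x, rnorm (T x) <= C * rnorm x.

Section BoundedOperators.
Variable R : realType.

Lemma bounded_op_rbounded (E : completeNormedModType R[i]) (a : E -> E) :
  bounded_op E a -> exists2 C : R, 0 <= C & rbounded C a.
Proof.
move=> [la /(_ 0)].
pose L := GRing.isLinear.Build _ _ _ _ a la.
pose aL : {linear E -> E} := HB.pack a L.
move=> ca; have /linear_boundedP := @continuous_linear_bounded _ _ _ 0 aL (ca : {for 0, continuous aL}).
case=> -[M b] /= [Mr hM].
have [M0|M0] := leP 0 (M + 1).
  exists (M + 1) => // x; have /= := hM ((M + 1)%:C); rewrite ltcE /=.
  move: Mr => /complex_realP [k []] _ -> /=.
  by rewrite eqxx ltrDl ltr01 => /(_ isT x); rewrite !rnormE realCM lecR.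
exists 0 => // x; have /= := hM 0; rewrite ltcE /=.
move: Mr => /complex_realP [k []] _ -> /=.
by rewrite eqxx => /(_ _ x); rewrite mul0r !rnormE mul0r lecR; apply; lra.
Qed.

Lemma rbounded_bounded_op (E : completeNormedModType R[i]) (a : E -> E) (C : R) :
  linear a -> rbounded C a -> bounded_op E a.
Proof.
move=> la ca; split => // x.
pose L := GRing.isLinear.Build _ _ _ _ a la.
pose aL : {linear E -> E} := HB.pack a L.
suff : {for x, continuous aL} by [].
apply: bounded_linear_continuous; apply/linear_boundedP.
exists C%:C; split; first by apply/complex_realP; exists C.
move=> [M b]; rewrite ltcE /= => /andP[/eqP -> CM] y /=.
rewrite !rnormE realCM lecR (le_trans (ca y))// ler_wpM2r ?rnorm_ge0//.
exact: ltW.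
Qed.

Lemma rbounded_cvg (V W : normedModType R[i]) (T : V -> W) (C : R) (u : nat -> V) l :
  linear T -> rbounded C T -> u @ \oo --> l -> T \o u @ \oo --> T l.
Proof.
move=> lT CT /cvg_rnormP ul; apply/cvg_rnormP => eps eps0.
have C1 : 0 < `|C| + 1 by rewrite ltr_wpDl.
have [|N hN] := ul (eps / (`|C| + 1)); first by rewrite divr_gt0.
exists N => n /hN; rewrite ltr_pdivlMr// => h.
have -> : (T \o u) n - T l = T (u n - l).
  by rewrite -scaleN1r addrC -lT scaleN1r addrC.
apply: le_lt_trans h; rewrite (le_trans (CT _))// mulrC ler_wpM2l ?rnorm_ge0//.
by rewrite (le_trans (ler_norm _))// lerDl.
Qed.

Lemma opnorm_ge (E : completeNormedModType R[i]) (D : set E) (a : E -> E) (C : R) :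
  0 <= C -> (forall x, D x -> rnorm (a x) <= C * rnorm x) ->
  (forall (r : R) x, D x -> D (r%:C *: x)) ->
  (forall (r : R) x, D x -> a (r%:C *: x) = r%:C *: a x) ->
  forall x, D x -> rnorm (a x) <= opnorm_on D a * rnorm x.
Proof.
move=> C0 aC DZ aZ x Dx; have [x0|x0] := eqVneq x 0.
  have -> : a x = 0 by apply/eqP; rewrite -rnorm_eq0 eq_le rnorm_ge0 andbT (le_trans (aC _ Dx))// x0 rnorm0 mulr0.
  by rewrite x0 !rnorm0 mulr0.
have nx : 0 < rnorm x by rewrite rnorm_gt0.
rewrite -ler_pdivrMr//.
have -> : rnorm (a x) / rnorm x = rnorm (a ((rnorm x)^-1%:C *: x)).
  by rewrite aZ// rnormZ rnormR ger0_norm ?invr_ge0 ?rnorm_ge0// mulrC.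
apply: ub_le_sup; last first.
  exists ((rnorm x)^-1%:C *: x) => //; split; first exact: DZ.
  rewrite /= rnormE rnormZ rnormR ger0_norm ?invr_ge0 ?rnorm_ge0// mulVf ?gt_eqF//.
exists C => _ [y [Dy /= y1] <-]; rewrite (le_trans (aC _ Dy))//.
by rewrite ler_piMr//; move: y1; rewrite rnormE -[1]/(1%:C) lecR.
Qed.

Lemma opnorm_on_le (E : completeNormedModType R[i]) (D : set E) (a : E -> E) (C : R) :
  0 <= C -> (forall x, D x -> rnorm (a x) <= C * rnorm x) -> opnorm_on D a <= C.
Proof.
move=> C0 aC; rewrite /opnorm_on; set A := (X in sup X).
have [->|/set0P A0] := eqVneq A set0; first by rewrite sup0.
apply: ge_sup => // _ [y [Dy /= y1] <-]; rewrite (le_trans (aC _ Dy))//.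
by rewrite ler_piMr//; move: y1; rewrite rnormE -[1]/(1%:C) lecR.
Qed.

Lemma rbounded_opnorm (E : completeNormedModType R[i]) (a : E -> E) :
  bounded_op E a -> rbounded (opnorm a) a.
Proof.
move=> ba; have [C C0 aC] := bounded_op_rbounded ba => x.
apply: (@opnorm_ge E [set: E] a C) => //.
move=> r y _; case: ba => la _.
have a0 : a 0 = 0.
  have := la (-1) 0 0; rewrite scaler0 addr0 scaleN1r addNr //.
by rewrite -[X in a X]addr0 la a0 addr0.
Qed.

Lemma opnorm_le (E : completeNormedModType R[i]) (a : E -> E) (C : R) :
  0 <= C -> rbounded C a -> opnorm a <= C.
Proof. by move=> C0 aC; apply: opnorm_on_le. Qed.

End BoundedOperators.

(** * Unconditional bases *)

Section Functionals.
Variables (R : realType) (E : completeNormedModType R[i]).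

Lemma functional_limit (y : E -> R[i]) (C : R) (u : nat -> E) l :
  scalar y -> rbounded C y -> u @ \oo --> l ->
  forall eps : R, 0 < eps ->
  exists N, forall n, (N <= n)%N -> rnorm (y (u n) - y l) < eps.
Proof.
move=> ly yC ul.
by have /cvg_rnormP := @rbounded_cvg R E (R[i]^o) y C u l ly yC ul.
Qed.

Lemma functional_limit_le (y : E -> R[i]) (C D : R) (u : nat -> E) l N :
  scalar y -> rbounded C y -> u @ \oo --> l ->
  (forall n, (N <= n)%N -> rnorm (y (u n)) <= D) -> rnorm (y l) <= D.
Proof.
move=> ly yC ul.
exact: (@rnorm_limit_le R (R[i]^o) _ _ _ _ (@rbounded_cvg R E (R[i]^o) y C u l ly yC ul)).
Qed.

End Functionals.

Section LinearFacts.
Variables (R : realType) (V W : lmodType R[i]).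

Lemma lin0 (T : V -> W) : linear T -> T 0 = 0.
Proof.
by move=> lT; have := lT (-1) 0 0; rewrite scaler0 addr0 scaleN1r addNr.
Qed.

Lemma linZ (T : V -> W) : linear T -> forall c x, T (c *: x) = c *: T x.
Proof. by move=> lT c x; rewrite -[X in T X]addr0 lT lin0// addr0. Qed.

Lemma linD (T : V -> W) : linear T -> forall x y, T (x + y) = T x + T y.
Proof. by move=> lT x y; rewrite -[x in LHS]scale1r lT scale1r. Qed.

Lemma linB (T : V -> W) : linear T -> forall x y, T (x - y) = T x - T y.
Proof. by move=> lT x y; rewrite addrC -scaleN1r lT scaleN1r addrC. Qed.

Lemma lin_sum (T : V -> W) : linear T -> forall I (s : seq I) (P : pred I) F,
  T (\sum_(i <- s | P i) F i) = \sum_(i <- s | P i) T (F i).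
Proof.
move=> lT I s P F.
by apply: (big_morph T (linD lT) (lin0 lT)).
Qed.

End LinearFacts.

Section ScalarFacts.
Variables (R : realType) (V : lmodType R[i]) (y : V -> R[i]).
Hypothesis ly : scalar y.

Lemma scal0 : y 0 = 0. Proof. exact: (@lin0 R V R[i]^o y ly). Qed.
Lemma scalZ c x : y (c *: x) = c * y x.
Proof. exact: (@linZ R V R[i]^o y ly). Qed.
Lemma scalD u v : y (u + v) = y u + y v.
Proof. exact: (@linD R V R[i]^o y ly). Qed.
Lemma scalB u v : y (u - v) = y u - y v.
Proof. exact: (@linB R V R[i]^o y ly). Qed.
Lemma scal_sum I (s : seq I) (P : pred I) F :
  y (\sum_(i <- s | P i) F i) = \sum_(i <- s | P i) y (F i).
Proof. exact: (@lin_sum R V R[i]^o y ly). Qed.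

End ScalarFacts.

Definition section (R : realType) (E : completeNormedModType R[i])
  (e : nat -> E) N (c : nat -> R[i]) : E := \sum_(0 <= n < N) c n *: e n.

Section Basis.
Variables (R : realType) (E : completeNormedModType R[i]) (e : nat -> E).
Hypotheses (sb : schauder_basis e) (u1 : one_unconditional e).

Local Notation co := (biorth e).
Local Notation sec := (section e).

Lemma section_cvg x : sec ^~ (co ^~ x) @ \oo --> x.
Proof.
have [c [cx _]] := sb x.
have : exists c, expansion e x c by exists c.
by move=> /xgetPex -/(_ (fun=> 0)).
Qed.

Arguments section_cvg : clear implicits.

Lemma biorth_unique x c : sec ^~ c @ \oo --> x -> co ^~ x = c.
Proof.
move=> cx; have [c' [_ c'u]] := sb x.
by rewrite -(c'u _ cx) -(c'u (co ^~ x))//; exact: section_cvg.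
Qed.

Lemma section_linear N (c : R[i]) a b :
  sec N (fun n => c * a n + b n) = c *: sec N a + sec N b.
Proof.
rewrite /section scaler_sumr -big_split /=.
by apply: eq_bigr => n _; rewrite scalerDl scalerA.
Qed.

Lemma sectionS N c : sec N.+1 c = sec N c + c N *: e N.
Proof. by rewrite /section big_nat_recr. Qed.

Lemma eq_section N a b : (forall n, (n < N)%N -> a n = b n) -> sec N a = sec N b.
Proof. by move=> h; apply: eq_big_nat => n /h ->. Qed.

Lemma section_trunc N M c : (N <= M)%N ->
  sec M (fun n => if (n < N)%N then c n else 0) = sec N c.
Proof.
move=> NM; rewrite /section (@big_cat_nat _ _ _ N)//= [X in _ + X]big1_seq ?addr0.
  by apply: eq_big_nat => n /= ->.
by move=> n; rewrite mem_index_iota /= => /andP[Nn _]; rewrite ltnNge Nn scale0r.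
Qed.

Lemma biorth_is_scalar n : scalar (co n).
Proof.
move=> c x y.
suff /(congr1 (fun g => g n)) -> : co ^~ (c *: x + y) = fun n => c * co n x + co n y by [].
apply: biorth_unique.
under eq_fun do rewrite section_linear.
by apply: cvgD; [apply: cvgZr|]; exact: section_cvg.
Qed.

Lemma biorth_section m N c : co m (sec N c) = if (m < N)%N then c m else 0.
Proof.
suff /(congr1 (fun g => g m)) -> : co ^~ (sec N c) = fun n => if (n < N)%N then c n else 0 by [].
apply: biorth_unique; apply/cvg_rnormP => eps eps0; exists N => M NM.
by rewrite section_trunc// subrr rnorm0.
Qed.

Lemma biorth_e m n : co m (e n) = (m == n)%:R.
Proof.
have -> : e n = sec n.+1 (fun k => (k == n)%:R).
  rewrite sectionS eqxx scale1r [X in X + _](_ : _ = 0) ?add0r//.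
  rewrite /section big_nat big1// => k /andP[_ kn].
  by rewrite (ltn_eqF kn) scale0r.
rewrite biorth_section ltnS; case: leqP => // nm; by rewrite gtn_eqF.
Qed.

Lemma e_neq0 n : e n != 0.
Proof.
apply/eqP => e0; have := biorth_e n n; rewrite e0 eqxx (scal0 (biorth_is_scalar n)).
by move/eqP; rewrite eq_sym oner_eq0.
Qed.

Lemma rnorm_e_gt0 n : 0 < rnorm (e n).
Proof. by rewrite rnorm_gt0 e_neq0. Qed.

Lemma section_mono N a b : (forall n, (n < N)%N -> rnorm (a n) <= rnorm (b n)) ->
  rnorm (sec N a) <= rnorm (sec N b).
Proof.
case: N => [|N] h; first by rewrite /section !big_nil.
by rewrite -ler_normC; apply: u1 => n nN; rewrite ler_normC h.
Qed.

Lemma section_widen N M c : (N <= M)%N -> rnorm (sec N c) <= rnorm (sec M c).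
Proof.
move=> NM; rewrite -(section_trunc c NM); apply: section_mono => n _.
by case: ifP => // _; rewrite rnorm0 rnorm_ge0.
Qed.

Lemma section_le N x : rnorm (sec N (co ^~ x)) <= rnorm x.
Proof.
rewrite leNgt; apply/negP => h.
have /cvg_rnormP /(_ (rnorm (sec N (co ^~ x)) - rnorm x)) := section_cvg x.
rewrite subr_gt0 => /(_ h) [M hM].
have := hM (maxn N M) (leq_maxr _ _).
have := section_widen (co ^~ x) (leq_maxl N M).
have := rnormD (sec (maxn N M) (co ^~ x) - x) x; rewrite subrK; lra.
Qed.

Lemma biorth_e_le n x : rnorm (co n x) * rnorm (e n) <= rnorm x.
Proof.
rewrite -rnormZ; apply: le_trans (section_le n.+1 x).
have -> : co n x *: e n = sec n.+1 (fun k => if k == n then co k x else 0).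
  rewrite sectionS eqxx [X in X + _](_ : _ = 0) ?add0r//.
  rewrite /section big_nat big1// => k /andP[_ kn].
  by rewrite (ltn_eqF kn) scale0r.
by apply: section_mono => k _; case: ifP; rewrite // rnorm0 rnorm_ge0.
Qed.

Lemma biorth_bounded n : rbounded (rnorm (e n))^-1 (co n).
Proof.
move=> x; rewrite mulrC ler_pdivlMr ?rnorm_e_gt0//; exact: biorth_e_le.
Qed.

Lemma biorth_inj x y : (forall n, co n x = co n y) -> x = y.
Proof.
move=> xy; have hy := section_cvg y.
have := section_cvg x; rewrite (_ : co ^~ x = co ^~ y); last exact/funext.
by move/cvg_rnorm_unique; apply.
Qed.

Lemma rnorm_section_cvg_le (c : nat -> R[i]) y (D : R) :
  sec ^~ c @ \oo --> y -> (forall N, rnorm (sec N c) <= D) -> rnorm y <= D.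
Proof. by move=> h hD; apply: (rnorm_limit_le (N:=0) h). Qed.

Lemma biorth_le_rnorm x y : (forall n, rnorm (co n x) <= rnorm (co n y)) ->
  rnorm x <= rnorm y.
Proof.
move=> xy; apply: (rnorm_section_cvg_le (section_cvg x)) => N.
by apply: le_trans (section_le N y); apply: section_mono.
Qed.

Lemma dominated_expansion (c : nat -> R[i]) x :
  (forall n, rnorm (c n) <= rnorm (co n x)) ->
  exists y, sec ^~ c @ \oo --> y /\ forall n, co n y = c n.
Proof.
move=> cx.
suff [y hy] : exists y : E, sec ^~ c @ \oo --> y.
  by exists y; split => // n; have /(congr1 (fun g => g n)) := biorth_unique hy.
apply: cauchy_rnorm_cvg => eps eps0.
have /cvg_rnormP /(_ (eps / 2)) [|N hN] := section_cvg x; first by rewrite divr_gt0.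
exists N => n Nn.
have secB a : sec n a - sec N a = sec n (fun k => if (k < N)%N then 0 else a k).
  rewrite -(section_trunc a Nn) -[- _]scaleN1r addrC -section_linear.
  by apply: eq_section => k _; case: ifP; rewrite ?mulr0 ?add0r// mulN1r addNr.
apply: (@le_lt_trans _ _ (rnorm (sec n (co ^~ x) - sec N (co ^~ x)))).
  by rewrite !secB; apply: section_mono => k _; case: ifP.
have := rnormB (sec n (co ^~ x) - x) (sec N (co ^~ x) - x); rewrite opprB addrA subrK.
have := hN n Nn; have := hN N (leqnn N); lra.
Qed.

Lemma section_tail x (eps : R) : 0 < eps ->
  exists N, forall M, (N <= M)%N -> rnorm (x - sec M (co ^~ x)) < eps.
Proof.
move=> eps0; have /cvg_rnormP /(_ _ eps0) [N hN] := section_cvg x.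
by exists N => M /hN; rewrite rnormBC.
Qed.

Lemma operator_of_columns (F : completeNormedModType R[i]) (z : nat -> F) (C : R) :
  0 <= C ->
  (forall N c, rnorm (\sum_(0 <= n < N) c n *: z n) <= C * rnorm (sec N c)) ->
  exists T : E -> F, [/\ linear T, rbounded C T, forall n, T (e n) = z n &
    forall x, (fun N => \sum_(0 <= n < N) co n x *: z n) @ \oo --> T x].
Proof.
move=> C0 zC.
have hT x : exists y : F, (fun N => \sum_(0 <= n < N) co n x *: z n) @ \oo --> y.
  apply: cauchy_rnorm_cvg => eps eps0.
  have C1 : 0 < C + 1 by lra.
  have [|N hN] := @section_tail x (eps / 2 / (C + 1)); first by rewrite !divr_gt0.
  exists N => n Nn.
  have secB (G : completeNormedModType R[i]) (w : nat -> G) a :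
      \sum_(0 <= k < n) a k *: w k - \sum_(0 <= k < N) a k *: w k =
      \sum_(0 <= k < n) (if (k < N)%N then 0 else a k) *: w k.
    rewrite (@big_cat_nat _ _ _ N)//= addrAC subrr add0r.
    rewrite [in RHS](@big_cat_nat _ _ _ N)//= [X in _ = X + _]big_nat.
    rewrite [X in _ = X + _]big1 ?add0r => [|k /andP[_ ->]]; last by rewrite scale0r.
    by apply: eq_big_nat => k /andP[Nk _]; rewrite ltnNge Nk.
  rewrite secB (le_lt_trans (zC _ _))// /section -secB.
  have := hN _ Nn; have := hN _ (leqnn N); rewrite !ltr_pdivlMr// => h1 h2.
  have := rnormB (x - sec N (co ^~ x)) (x - sec n (co ^~ x)).
  rewrite opprB addrC addrA subrK -/(sec n _) -/(sec N _) => h3.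
  have n0 := rnorm_ge0 (sec n (co ^~ x) - sec N (co ^~ x)).
  have := ler_wpM2l C0 h3; nra.
have [T TP] := choice hT; exists T; split => //.
- move=> c x y; apply: (cvg_rnorm_unique (TP _)).
  have -> : (fun N => \sum_(0 <= n < N) co n (c *: x + y) *: z n) =
    (fun N => c *: (\sum_(0 <= n < N) co n x *: z n) + \sum_(0 <= n < N) co n y *: z n).
    apply/funext => N; rewrite scaler_sumr -big_split /=; apply: eq_bigr => k _.
    by rewrite biorth_is_scalar scalerDl scalerA.
  by apply: cvgD => //; apply: cvgZr.
- move=> x; apply: (rnorm_limit_le (N:=0) (TP x)) => N _.
  by rewrite (le_trans (zC _ _))// ler_wpM2l// section_le.
- move=> n; apply: (cvg_rnorm_unique (TP _)); apply/cvg_rnormP => eps eps0.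
  exists n.+1 => N nN; rewrite (bigD1_seq n) ?mem_index_iota ?iota_uniq//=.
  rewrite biorth_e eqxx scale1r big1 ?addr0 ?subrr ?rnorm0// => k kn.
  by rewrite biorth_e (negbTE kn) scale0r.
Qed.

Lemma operator_section (F : completeNormedModType R[i]) (T : E -> F) N c :
  linear T -> T (sec N c) = \sum_(0 <= n < N) c n *: T (e n).
Proof. by move=> lT; rewrite lin_sum//; apply: eq_bigr => n _; rewrite linZ. Qed.

Lemma functional_section (y : E -> R[i]) N c :
  scalar y -> y (sec N c) = \sum_(0 <= n < N) c n * y (e n).
Proof. by move=> ly; rewrite scal_sum//; apply: eq_bigr => n _; rewrite scalZ. Qed.

End Basis.

Arguments section_cvg {R E e} sb x _.

(** * Uniform Roe algebras *)

Lemma opDE (R : realType) (E F : completeNormedModType R[i]) (a b : E -> F) x :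
  (a + b) x = a x + b x.
Proof. by []. Qed.

Lemma opBE (R : realType) (E F : completeNormedModType R[i]) (a b : E -> F) x :
  (a - b) x = a x - b x.
Proof. by []. Qed.

Lemma opZE (R : realType) (E F : completeNormedModType R[i]) (c : R[i])
    (a : E -> F) x :
  (c *: a) x = c *: a x.
Proof. by []. Qed.

Section RoeAlgebra.
Variables (R : realType) (E : completeNormedModType R[i]) (e : nat -> E).
Variable d : nat -> nat -> R.
Hypotheses (sb : schauder_basis e) (u1 : one_unconditional e) (md : is_metric d).

Local Notation co := (biorth e).
Local Notation sec := (section e).

Lemma metric_refl n : d n n = 0.
Proof. exact/(metric_eq0 md). Qed.

Lemma bounded_op_lin (c : R[i]) (a b : E -> E) :
  bounded_op E a -> bounded_op E b -> bounded_op E (c *: a + b).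
Proof.
move=> ba bb; have [A A0 hA] := bounded_op_rbounded ba.
have [B B0 hB] := bounded_op_rbounded bb.
have [[la _] [lb _]] := (ba, bb).
apply: (@rbounded_bounded_op _ _ _ (rnorm c * A + B)).
  move=> k x y; rewrite !(opDE, opZE) la lb !scalerDr !scalerA.
  by rewrite (mulrC k c) addrACA.
move=> x; rewrite !(opDE, opZE) (le_trans (rnormD _ _))//.
by rewrite mulrDl lerD// rnormZ -mulrA ler_wpM2l ?rnorm_ge0.
Qed.

Lemma bounded_op_comp (a b : E -> E) :
  bounded_op E a -> bounded_op E b -> bounded_op E (a \o b).
Proof.
move=> ba bb; have [A A0 hA] := bounded_op_rbounded ba.
have [B B0 hB] := bounded_op_rbounded bb.
have [[la _] [lb _]] := (ba, bb).
apply: (@rbounded_bounded_op _ _ _ (A * B)); first by move=> k x y /=; rewrite lb la.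
by move=> x /=; rewrite (le_trans (hA _))// -mulrA ler_wpM2l.
Qed.

Lemma band_lin (c : R[i]) (a b : E -> E) :
  band d e a -> band d e b -> band d e (c *: a + b).
Proof.
move=> [ba [r r0 hr]] [bb [s s0 hs]]; split; first exact: bounded_op_lin.
exists (r + s); first by rewrite addr_gt0.
move=> n m h; rewrite !(opDE, opZE).
by rewrite (biorth_is_scalar sb) hr ?hs ?mulr0 ?addr0//; lra.
Qed.

Lemma band_comp (a b : E -> E) :
  band d e a -> band d e b -> band d e (a \o b).
Proof.
move=> [ba [r r0 hr]] [bb [s s0 hs]]; split; first exact: bounded_op_comp.
exists (r + s); first by rewrite addr_gt0.
move=> n m h /=; apply: rnorm_eq0P => eps eps0.
have [A A0 hA] := bounded_op_rbounded ba; have [la _] := ba.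
have scal_coa : scalar (co m \o a).
  by move=> k x y /=; rewrite la (biorth_is_scalar sb).
apply: (@functional_limit_le _ _ (co m \o a) ((rnorm (e m))^-1 * A) _ _ _ 0 scal_coa _ (section_cvg sb (b (e n)))).
  move=> x /=; rewrite (le_trans (biorth_bounded sb u1 _ _))//.
  by rewrite -mulrA; apply: ler_wpM2l (hA x); rewrite invr_ge0 rnorm_ge0.
move=> N _; rewrite functional_section// big1 ?rnorm0 ?ltW// => k _ /=.
have [nk|nk] := ltP s (d n k); first by rewrite hs// mul0r.
rewrite hr ?mulr0//; have := Defs.metric_triangle md n k m; lra.
Qed.

Lemma roeP (a : E -> E) : roe d e a <-> bounded_op E a /\
  forall eps : R, 0 < eps -> exists2 b, band d e b & rbounded eps (a - b).
Proof.
split=> -[ba h]; split => // eps eps0.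
  have [b bb ab] := h eps eps0; exists b => // x.
  have bab : bounded_op E (a - b).
    by rewrite addrC -scaleN1r; apply: bounded_op_lin => //; case: bb.
  by rewrite (le_trans (rbounded_opnorm bab _))// ler_wpM2r ?rnorm_ge0// ltW.
have [|b bb ab] := h (eps / 2); first by rewrite divr_gt0.
exists b => //; apply: (@le_lt_trans _ _ (eps / 2)); last by lra.
by apply: opnorm_le => //; lra.
Qed.

Lemma band_roe (a : E -> E) : band d e a -> roe d e a.
Proof.
move=> ba; apply/roeP; split; first by case: ba.
by move=> eps eps0; exists a => // x; rewrite subrr rnorm0 mulr_ge0 ?rnorm_ge0// ltW.
Qed.

Lemma roe_lin (c : R[i]) (a b : E -> E) :
  roe d e a -> roe d e b -> roe d e (c *: a + b).
Proof.
move=> /roeP[ba ha] /roeP[bb hb]; apply/roeP; split; first exact: bounded_op_lin.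
move=> eps eps0; have c1 : 0 < rnorm c + 1 by rewrite ltr_wpDl ?rnorm_ge0.
have [|a' ba' ha'] := ha (eps / 2 / (rnorm c + 1)); first by rewrite !divr_gt0.
have [|b' bb' hb'] := hb (eps / 2); first by rewrite !divr_gt0.
exists (c *: a' + b'); first exact: band_lin.
move=> x; have -> : (c *: a + b - (c *: a' + b')) x = c *: (a - a') x + (b - b') x.
  rewrite !(opDE, opBE, opZE).
  by rewrite scalerBr opprD addrACA.
rewrite (le_trans (rnormD _ _))// rnormZ.
have := ha' x; rewrite mulrAC ler_pdivlMr// => h1; have := hb' x => h2.
have := rnorm_ge0 ((a - a') x) => h3; nra.
Qed.

Lemma roe_comp (a b : E -> E) : roe d e a -> roe d e b -> roe d e (a \o b).
Proof.
move=> /roeP[ba ha] /roeP[bb hb]; apply/roeP; split; first exact: bounded_op_comp.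
move=> eps eps0.
have [A A0 hA] := bounded_op_rbounded ba; have [B B0 hB] := bounded_op_rbounded bb.
have [|a' ba' ha'] := ha (eps / 2 / (B + 1)); first by rewrite !divr_gt0//; lra.
have [|b' bb' hb'] := hb (Num.min 1 (eps / 2 / (A + eps / 2 / (B + 1) + 1))).
  have B1 : 0 < eps / 2 / (B + 1) by rewrite !divr_gt0//; lra.
  by rewrite lt_min ltr01 !divr_gt0//; lra.
exists (a' \o b'); first exact: band_comp.
move=> x; have la' : linear a' by case: ba' => -[].
have -> : ((a \o b) - (a' \o b')) x = (a - a') (b x) + a' ((b - b') x).
  rewrite !(opDE, opBE) (linB la') addrA subrK //.
rewrite (le_trans (rnormD _ _))//.
set t := eps / 2 / (B + 1) in hb' ha' *.
have t0 : 0 < t by rewrite !divr_gt0//; lra.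
have h1 := ha' (b x); have h2 := hB x; have h3 := hb' x.
have tB : t * B <= eps / 2.
  by rewrite /t mulrAC ler_pdivrMr; [rewrite ler_wpM2l//; lra|lra].
have h4 : rnorm (a' ((b - b') x)) <= (A + t) * rnorm ((b - b') x).
  set z := (b - b') x; have := rnormB (a z) ((a - a') z).
  have -> : a z - (a - a') z = a' z by rewrite !(opDE, opBE) opprB addrC subrK.
  have := hA z; have := ha' z; lra.
have h5 : (A + t) * rnorm ((b - b') x) <= eps / 2 * rnorm x.
  have h6 : rnorm ((b - b') x) <= eps / 2 / (A + t + 1) * rnorm x.
    by rewrite (le_trans h3)// ler_wpM2r ?rnorm_ge0// ge_min lexx orbT.
  apply: (@le_trans _ _ ((A + t + 1) * rnorm ((b - b') x))).
    by rewrite ler_wpM2r ?rnorm_ge0//; lra.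
  have At : 0 < A + t + 1 by lra.
  by move: h6; rewrite mulrAC ler_pdivlMr// mulrC.
have h7 : t * rnorm (b x) <= eps / 2 * rnorm x.
  rewrite (le_trans (ler_wpM2l (ltW t0) h2))// mulrA ler_wpM2r ?rnorm_ge0//.
have -> : eps = eps / 2 + eps / 2 by lra.
rewrite mulrDl; lra.
Qed.

Lemma roe_bounded (a : E -> E) : roe d e a -> bounded_op E a.
Proof. by case. Qed.

Lemma roe_linear (a : E -> E) : roe d e a -> linear a.
Proof. by case=> -[]. Qed.

End RoeAlgebra.

Definition rank_one (R : realType) (E F : completeNormedModType R[i])
  (x : F) (y : E -> R[i]) : E -> F := fun z => y z *: x.

Section RankOne.
Variables (R : realType) (E : completeNormedModType R[i]).

Lemma rank_one_linear (F : completeNormedModType R[i]) (x : F) (y : E -> R[i]) :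
  scalar y -> linear (rank_one x y).
Proof. by move=> ly c u v; rewrite /rank_one ly scalerDl scalerA. Qed.

Lemma rank_one_bounded (F : completeNormedModType R[i]) (x : F) (y : E -> R[i]) (C : R) :
  rbounded C y -> rbounded (C * rnorm x) (rank_one x y).
Proof.
by move=> yC u; rewrite /rank_one rnormZ mulrAC ler_wpM2r ?rnorm_ge0.
Qed.

Lemma rank_one_bounded_op (x : E) (y : E -> R[i]) (C : R) :
  scalar y -> rbounded C y -> bounded_op E (rank_one x y).
Proof.
move=> ly yC; apply: (rbounded_bounded_op (rank_one_linear _ ly)).
exact: rank_one_bounded yC.
Qed.

End RankOne.

Section ElementaryBands.
Variables (R : realType) (E : completeNormedModType R[i]) (e : nat -> E).
Variable d : nat -> nat -> R.
Hypotheses (sb : schauder_basis e) (u1 : one_unconditional e) (md : is_metric d).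
Local Notation co := (biorth e).
Local Notation sec := (section e).

Definition munit (n m : nat) : E -> E := rank_one (e n) (co m).

Lemma munit_bounded n m : rbounded (rnorm (e n) / rnorm (e m)) (munit n m).
Proof. by rewrite mulrC; apply: rank_one_bounded; exact: biorth_bounded. Qed.

Lemma munit_band n m : band d e (munit n m).
Proof.
split.
  exact: rank_one_bounded_op (biorth_is_scalar sb m) (biorth_bounded sb u1 m).
exists (d m n + 1); first by have := metric_ge0 md m n; lra.
move=> k l; rewrite /munit /rank_one (scalZ (biorth_is_scalar sb l)) !(biorth_e sb).
have [->|_] := eqVneq m k; last by rewrite mul0r.
by have [->|_] := eqVneq l n; [move=> ?; exfalso; lra|rewrite mulr0].
Qed.

Lemma munit_comp n m p q :
  munit n m \o munit p q = (m == p)%:R *: munit n q.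
Proof.
apply/funext => x; rewrite opZE /munit /rank_one /= (scalZ (biorth_is_scalar sb m)).
by rewrite (biorth_e sb) scalerA mulrC.
Qed.

Lemma munit_e n m k : munit n m (e k) = (m == k)%:R *: e n.
Proof. by rewrite /munit /rank_one (biorth_e sb). Qed.

Lemma diagonal_op (c : nat -> R[i]) : (forall n, rnorm (c n) <= 1) ->
  exists T, [/\ band d e T, rbounded 1 T, forall n, T (e n) = c n *: e n,
    forall n x, co n (T x) = c n * co n x &
    forall x, (fun N => \sum_(0 <= n < N) co n x *: (c n *: e n)) @ \oo --> T x].
Proof.
move=> c1.
have [||T [lT bT Te Tl]] := @operator_of_columns _ _ e sb u1 E (fun n => c n *: e n) 1.
- exact: ler01.
- move=> N a; rewrite mul1r.
  under eq_bigr do rewrite scalerA.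
  apply: (section_mono u1) => n _.
  by rewrite rnormM ler_piMr ?rnorm_ge0.
exists T; split => //; last first.
  move=> n x; have /(congr1 (fun g => g n)) -> // : co ^~ (T x) = fun n => c n * co n x.
  apply: (biorth_unique sb); have := Tl x.
  by under eq_fun do under eq_bigr do rewrite scalerA mulrC.
split; first exact: rbounded_bounded_op bT.
exists 1 => // n m nm; rewrite Te (scalZ (biorth_is_scalar sb m)) (biorth_e sb).
have [mn|_] := eqVneq m n; last by rewrite mulr0.
by exfalso; move: nm; rewrite mn (metric_refl md); lra.
Qed.

Lemma metric_symmetric_rnorm : metric_symmetric d e ->
  forall (r : R) (A B : set nat) (sigma : nat -> nat), 0 < r ->
    set_bij A B sigma -> (forall i, A i -> d i (sigma i) <= r) ->
  exists2 C : R, 0 < C & forall (al : nat -> R[i]) (N : nat),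
    rnorm (\sum_(0 <= n < N | n \in A) al n *: e n)
      <= C * rnorm (\sum_(0 <= n < N | n \in A) al n *: e (sigma n)) /\
    rnorm (\sum_(0 <= n < N | n \in A) al n *: e (sigma n))
      <= C * rnorm (\sum_(0 <= n < N | n \in A) al n *: e n).
Proof.
move=> ms r A B s r0 bs ds; have [C C0 hC] := ms r A B s r0 bs ds.
exists C => // al N; have [] := hC al N; rewrite !rnormE !realCM !lecR.
by rewrite mulrC ler_pdivrMr// mulrC.
Qed.

Lemma partial_translation : metric_symmetric d e ->
  forall (r : R) (A B : set nat) (sigma : nat -> nat), 0 < r ->
    set_bij A B sigma -> (forall i, A i -> d i (sigma i) <= r) ->
  exists2 C : R, 0 < C & (forall n, A n -> rnorm (e n) <= C * rnorm (e (sigma n))) /\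
    forall A' : set nat, A' `<=` A ->
    exists T, [/\ band d e T, rbounded C T &
      forall n, T (e n) = if n \in A' then e (sigma n) else 0].
Proof.
move=> ms r A B s r0 bs ds; have [C C0 hC] := metric_symmetric_rnorm ms r0 bs ds.
exists C => //; split.
  move=> n An; have [+ _] := hC (fun k => (k == n)%:R) n.+1.
  have single (f : nat -> E) : \sum_(0 <= k < n.+1 | k \in A) (k == n)%:R *: f k = f n.
    rewrite big_mkcond (bigD1_seq n) ?mem_index_iota ?iota_uniq//= mem_set// eqxx scale1r.
    by rewrite big1 ?addr0// => k /negbTE ->; rewrite scale0r if_same.
  by rewrite single (single (e \o s)).
move=> A' A'A.
pose z n := if n \in A' then e (s n) else 0.
have zE N c : \sum_(0 <= n < N) c n *: z n = \sum_(0 <= n < N | n \in A') c n *: e (s n).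
  rewrite [RHS]big_mkcond /=; apply: eq_bigr => n _.
  by rewrite /z; case: ifP => //; rewrite scaler0.
have [|T [lT bT Te _]] := @operator_of_columns _ _ e sb u1 E z C (ltW C0).
- move=> N c; rewrite zE.
  pose c' n := if n \in A' then c n else 0.
  have -> : \sum_(0 <= n < N | n \in A') c n *: e (s n) =
            \sum_(0 <= n < N | n \in A) c' n *: e (s n).
    rewrite [LHS]big_mkcond [RHS]big_mkcond /=; apply: eq_bigr => n _.
    rewrite /c'; case: ifPn => nA'; last by rewrite scale0r if_same.
    by rewrite mem_set//; apply: A'A; exact: set_mem.
  have [_ h] := hC c' N; rewrite (le_trans h)// ler_wpM2l ?(ltW C0)//.
  rewrite big_mkcond /=.
  rewrite (eq_bigr (fun n => (if n \in A then c' n else 0) *: e n)); last first.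
    by move=> n _; case: ifP; rewrite ?scale0r.
  apply: (section_mono u1) => n _; rewrite /c'.
  by case: ifP; rewrite ?rnorm0 ?rnorm_ge0//; case: ifP; rewrite ?rnorm0 ?rnorm_ge0.
exists T; split => //.
split; first exact: rbounded_bounded_op bT.
exists r => // n m nm; rewrite Te /z; case: ifPn => nA'.
  rewrite (biorth_e sb); have [mn|//] := eqVneq m (s n).
  have := ds n (A'A _ (set_mem nA')); by rewrite -mn => ?; exfalso; lra.
by rewrite (scal0 (biorth_is_scalar sb m)).
Qed.

End ElementaryBands.

Section Cover.
Variables (R : realType) (d : nat -> nat -> R).
Hypotheses (md : is_metric d) (ulf : uniformly_locally_finite d).

Definition ball_rank (r : R) n m := count (fun k => d n k <= r) (iota 0 m).

Lemma ball_rank_lt r n m m' : d n m <= r -> (m < m')%N ->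
  (ball_rank r n m < ball_rank r n m')%N.
Proof.
move=> nm mm'; rewrite /ball_rank -(subnKC mm') iotaD count_cat.
have -> : iota 0 m.+1 = iota 0 m ++ [:: m] by rewrite -addn1 iotaD.
rewrite count_cat /=.
by rewrite nm addn1 leq_addr.
Qed.

Lemma ball_rank_inj r n m m' : d n m <= r -> d n m' <= r ->
  ball_rank r n m = ball_rank r n m' -> m = m'.
Proof.
move=> h h' E; case: (ltngtP m m') => // /ball_rank_lt.
  by move/(_ _ _ h); rewrite E ltnn.
by move/(_ _ _ h'); rewrite E ltnn.
Qed.

Lemma ball_seq_bounded (r : R) : 0 < r ->
  exists K, forall n (s : seq nat), uniq s -> all (fun k => d n k <= r) s -> (size s <= K)%N.
Proof.
move=> r0; have [K hK] := ulf r0; exists K => n s us /allP hs.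
have fin : finite_set [set y | d n y <= r] by apply/finite_set_leP; exists K.
apply: leq_trans (geq_card_fset_set (hK n)).
apply: uniq_leq_size => // k ks; rewrite in_fset_set// inE /=; exact: hs.
Qed.

(* The pair (rank of m in the ball of n, rank of n in the ball of m) is a
   colour for which each colour class is the graph of a partial bijection. *)
Lemma partial_bijection_cover (r : R) : 0 < r ->
  exists K (A : nat -> set nat) (sigma : nat -> nat -> nat),
    (forall c, set_bij (A c) (sigma c @` A c) (sigma c) /\
       forall n, A c n -> d n (sigma c n) <= r) /\
    forall n m, d n m <= r -> exists c, [/\ (c < K)%N, A c n & sigma c n = m].
Proof.
move=> r0; have [K0 hK0] := ball_seq_bounded r0.
have rkK n m : d n m <= r -> (ball_rank r n m < K0.+1)%N.
  move=> nm; rewrite ltnS /ball_rank -size_filter; apply: (hK0 n).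
    by rewrite filter_uniq ?iota_uniq.
  by apply/allP => k; rewrite mem_filter => /andP[].
pose G c n m := [/\ d n m <= r, ball_rank r n m = (c %/ K0.+1)%N &
  ball_rank r m n = (c %% K0.+1)%N].
pose A c := [set n | exists m, G c n m].
pose s c n := xget 0%N [set m | G c n m].
have sP c n : A c n -> G c n (s c n).
  by move=> /(xgetPex 0%N).
exists (K0.+1 * K0.+1)%N, A, s; split.
  move=> c; split; last by move=> n /sP[].
  apply: inj_bij.
  move=> n n' /set_mem/sP[h1 _ h3] /set_mem/sP[h1' _ h3'] E.
  rewrite -E in h1' h3'; apply: (@ball_rank_inj r (s c n)).
  - by rewrite (Defs.metricC md).
  - by rewrite (Defs.metricC md).
  - by rewrite h3 h3'.
move=> n m nm; have mn : d m n <= r by rewrite (Defs.metricC md).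
pose c := (ball_rank r n m * K0.+1 + ball_rank r m n)%N.
have Gc : G c n m.
  by split=> //; rewrite /c ?divnMDl// ?divn_small ?addn0 ?rkK// modnMDl modn_small ?rkK.
have Ac : A c n by exists m.
exists c; split => //.
- rewrite /c; have := rkK _ _ nm; have := rkK _ _ mn; nia.
- have [h1 h2 _] := Gc; have [h1' h2' _] := sP _ _ Ac.
  by apply: (@ball_rank_inj r n) => //; rewrite h2 h2'.
Qed.

End Cover.

(** * Nonnegative matrices *)

Lemma eventually_forall_lt (P : nat -> nat -> Prop) N :
  (forall i, (i < N)%N -> exists L0, forall L, (L0 <= L)%N -> P i L) ->
  exists L0, forall i L, (i < N)%N -> (L0 <= L)%N -> P i L.
Proof.
elim: N => [|N ih] h; first by exists 0%N.
have [i iN|L0 h0] := ih; first by apply: h; exact: ltnW.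
have [L1 h1] := h N (ltnSn N).
exists (maxn L0 L1) => i L; rewrite ltnS leq_eqVlt geq_max => /orP[/eqP->|iN] /andP[l0 l1].
  exact: h1.
exact: h0.
Qed.

Section NonnegativeMatrices.
Variables (R : realType) (E : completeNormedModType R[i]) (e : nat -> E).
Hypotheses (sb : schauder_basis e) (u1 : one_unconditional e).
Local Notation co := (biorth e).
Local Notation sec := (section e).

Definition rsec N (x : nat -> R) : R := rnorm (sec N (fun j => (x j)%:C)).

Definition matrix_bounded (C : R) (k : nat -> nat -> R) :=
  forall N x, (forall j, 0 <= x j) ->
    rsec N (fun i => \sum_(0 <= j < N) k i j * x j) <= C * rsec N x.

Lemma rsec_ge0 N x : 0 <= rsec N x.
Proof. exact: rnorm_ge0. Qed.

Lemma rsec_mono N a b : (forall n, (n < N)%N -> `|a n| <= `|b n|) -> rsec N a <= rsec N b.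
Proof. by move=> h; apply: (section_mono u1) => n nN; rewrite !rnormR h. Qed.

Lemma rsec_mono_nneg N a b : (forall n, (n < N)%N -> 0 <= a n <= b n) -> rsec N a <= rsec N b.
Proof.
move=> h; apply: rsec_mono => n /h/andP[a0 ab].
by rewrite !ger0_norm// (le_trans a0).
Qed.

Lemma rsec_norm N c : rnorm (sec N c) = rsec N (fun n => rnorm (c n)).
Proof.
apply/eqP; rewrite eq_le; apply/andP; split; apply: (section_mono u1) => n _;
  by rewrite rnormR ger0_norm ?rnorm_ge0.
Qed.

Lemma eq_rsec N a b : (forall n, (n < N)%N -> a n = b n) -> rsec N a = rsec N b.
Proof. by move=> h; congr rnorm; apply: eq_section => n /h ->. Qed.

Lemma rsecD N a b : rsec N (fun n => a n + b n) <= rsec N a + rsec N b.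
Proof.
apply: le_trans (rnormD _ _); rewrite -[sec N (fun j => (a j)%:C)]scale1r.
rewrite -section_linear; apply: (section_mono u1) => n _.
by rewrite mul1r rmorphD.
Qed.

Lemma rsecZ N r a : rsec N (fun n => r * a n) = `|r| * rsec N a.
Proof.
rewrite /rsec -rnormR -rnormZ; congr rnorm.
rewrite /section scaler_sumr; apply: eq_bigr => n _.
by rewrite scalerA -realCM.
Qed.

Lemma matrix_bounded_le C k k' : (forall i j, 0 <= k i j <= k' i j) ->
  matrix_bounded C k' -> matrix_bounded C k.
Proof.
move=> kk' h N x x0; apply: le_trans (h N x x0); apply: rsec_mono_nneg => i _.
rewrite sumr_ge0 => [|j _]; last by rewrite mulr_ge0//; case/andP: (kk' i j).
by rewrite ler_sum// => j _; rewrite ler_wpM2r//; case/andP: (kk' i j).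
Qed.

Lemma matrix_boundedD C C' k k' : matrix_bounded C k -> matrix_bounded C' k' ->
  matrix_bounded (C + C') (fun i j => k i j + k' i j).
Proof.
move=> h h' N x x0; rewrite mulrDl; apply: le_trans (lerD (h N x x0) (h' N x x0)).
apply: le_trans (rsecD _ _ _); rewrite le_eqVlt; apply/orP; left; apply/eqP.
by apply: eq_rsec => i _; rewrite -big_split /=; apply: eq_bigr => j _; rewrite mulrDl.
Qed.

Lemma matrix_bounded0 : matrix_bounded 0 (fun _ _ => 0).
Proof.
move=> N x x0; rewrite mul0r /rsec (_ : sec _ _ = 0) ?rnorm0//.
rewrite /section big1// => i _; rewrite big1 ?scale0r// => j _.
by rewrite mul0r.
Qed.

Lemma matrix_bounded_sum L (C : nat -> R) (k : nat -> nat -> nat -> R) :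
  (forall l, (l < L)%N -> matrix_bounded (C l) (k l)) ->
  matrix_bounded (\sum_(0 <= l < L) C l) (fun i j => \sum_(0 <= l < L) k l i j).
Proof.
elim: L => [|L ih] h.
  rewrite big_nil; have -> : (fun i j => \sum_(0 <= l < 0) k l i j) = fun _ _ => 0.
    by apply/funext => i; apply/funext => j; rewrite big_nil.
  exact: matrix_bounded0.
rewrite big_nat_recr//=.
have -> : (fun i j => \sum_(0 <= l < L.+1) k l i j) =
    fun i j => (\sum_(0 <= l < L) k l i j) + k L i j.
  by apply/funext => i; apply/funext => j; rewrite big_nat_recr.
apply: matrix_boundedD; last exact: h.
by apply: ih => l lL; apply: h; exact: ltnW.
Qed.

Lemma matrix_bounded_wpM C C' k : C <= C' -> matrix_bounded C k -> matrix_bounded C' k.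
Proof.
by move=> CC' h N x x0; rewrite (le_trans (h N x x0))// ler_wpM2r ?rsec_ge0.
Qed.

(* Finite sections only see finitely many entries, so domination up to an
   arbitrarily small entrywise error suffices. *)
Lemma matrix_bounded_approx C k : (forall i j, 0 <= k i j) ->
  (forall N (eps : R), 0 < eps -> exists k', matrix_bounded C k' /\
     forall i j, (i < N)%N -> (j < N)%N -> k i j <= k' i j + eps) ->
  matrix_bounded C k.
Proof.
move=> k0 h N x x0.
set D := rsec N (fun _ => \sum_(0 <= j < N) x j).
have D0 : 0 <= D by exact: rsec_ge0.
suff H (eps : R) : 0 < eps ->
  rsec N (fun i => \sum_(0 <= j < N) k i j * x j) <= C * rsec N x + eps * D.
  apply/ler_addgt0Pr => eta eta0; apply: (le_trans (H (eta / (D + 1)) _)).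
    by rewrite divr_gt0//; lra.
  by rewrite lerD2l mulrAC ler_pdivrMr; [rewrite ler_wpM2l//; lra|lra].
move=> eps0; have [k' [hk' kk']] := h N eps eps0.
apply: le_trans (lerD (hk' N x x0) (lexx _)).
rewrite -[eps]gtr0_norm// /D -rsecZ; apply: le_trans (rsecD _ _ _).
apply: rsec_mono_nneg => i iN; rewrite sumr_ge0 => [|j _]; last by rewrite mulr_ge0.
rewrite mulr_sumr -big_split /=; apply: ler_sum_nat => j /andP[_ jN].
by rewrite -mulrDl ler_wpM2r// kk'.
Qed.

Lemma matrix_bounded_rank_one C (al be : nat -> R) :
  (forall N x, (forall j, 0 <= x j) ->
     (\sum_(0 <= j < N) be j * x j) * rsec N al <= C * rsec N x) ->
  (forall j, 0 <= be j) -> matrix_bounded C (fun i j => al i * be j).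
Proof.
move=> h b0 N x x0; apply: le_trans (h N x x0).
rewrite -[X in X * _]ger0_norm; last by rewrite sumr_ge0// => j _; rewrite mulr_ge0.
rewrite -rsecZ le_eqVlt; apply/orP; left; apply/eqP; apply: eq_rsec => i _.
by rewrite mulr_suml; apply: eq_bigr => j _; rewrite [RHS]mulrC mulrA.
Qed.

Lemma functional_section_abs (w : E -> R[i]) (C s : R) N (x : nat -> R) :
  scalar w -> (forall y, rnorm (w y) * s <= C * rnorm y) -> 0 <= C ->
  (forall j, 0 <= x j) ->
  (\sum_(0 <= j < N) rnorm (w (e j)) * x j) * s <= C * rsec N x.
Proof.
move=> lw wC C0 x0.
have [t ht] := choice (fun j => sgnC (w (e j))).
have h := wC (sec N (fun j => t j * (x j)%:C)).
apply: le_trans (le_trans h _); last first.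
  rewrite ler_wpM2l//; apply: (section_mono u1) => n _.
  by rewrite rnormM; case: (ht n) => _ ->; rewrite mul1r.
rewrite le_eqVlt; apply/orP; left; apply/eqP; congr (_ * _).
rewrite functional_section//.
under [in RHS]eq_bigr => j _.
  rewrite mulrAC; have [-> _] := ht j; rewrite rnormE realCM; over.
rewrite -rmorph_sum /= rnormR ger0_norm// sumr_ge0// => j _.
by rewrite mulr_ge0 ?rnorm_ge0.
Qed.

Section BandMatrices.
Variable d : nat -> nat -> R.
Hypotheses (md : is_metric d) (ulf : uniformly_locally_finite d).
Hypothesis ms : metric_symmetric d e.

Lemma band_matrix_bounded (r : R) : 0 < r -> exists2 C : R, 0 < C &
  forall (dl : R) k, 0 <= dl -> (forall i j, 0 <= k i j) ->
    (forall i j, k i j * rnorm (e i) <= dl * rnorm (e j)) ->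
    (forall i j, r < d i j -> k i j = 0) ->
    matrix_bounded (C * dl) k.
Proof.
move=> r0; have [K [A [s [As sA]]]] := partial_bijection_cover md ulf r0.
have hC c : exists C : R, [/\ 0 < C,
    (forall n, A c n -> rnorm (e n) <= C * rnorm (e (s c n))) &
    (forall (al : nat -> R[i]) N,
      rnorm (\sum_(0 <= n < N | n \in A c) al n *: e (s c n)) <=
      C * rnorm (\sum_(0 <= n < N | n \in A c) al n *: e n))].
  have [bs ds] := As c.
  have [C C0 [h1 _]] := partial_translation sb u1 ms r0 bs ds.
  have [C' C0' h2] := metric_symmetric_rnorm ms r0 bs ds.
  exists (C + C'); split=> [|n An|al N]; first by lra.
    by rewrite (le_trans (h1 n An))// ler_wpM2r ?rnorm_ge0//; lra.
  have [_ h] := h2 al N; rewrite (le_trans h)// ler_wpM2r ?rnorm_ge0//; lra.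
have {hC} [C hC] := choice hC.
exists (1 + \sum_(0 <= c < K) C c * C c).
  rewrite ltr_wpDr// sumr_ge0// => c _; have [h _ _] := hC c; rewrite mulr_ge0//; lra.
move=> dl k dl0 k0 kdl kr.
pose kc c i j := if (j \in A c) && (s c j == i) then k i j else 0.
apply: (@matrix_bounded_wpM ((\sum_(0 <= c < K) C c * C c * dl))).
  by rewrite -mulr_suml ler_wpM2r//; lra.
apply: (@matrix_bounded_le _ _ (fun i j => \sum_(0 <= c < K) kc c i j)).
  move=> i j; rewrite k0 /=.
  have kc0 c : 0 <= kc c i j by rewrite /kc; case: ifP.
  have [ji|/kr ->] := leP (d i j) r; last by rewrite sumr_ge0.
  rewrite (Defs.metricC md) in ji.
  have [c [cK Ac sc]] := sA _ _ ji.
  rewrite (bigD1_seq c) ?mem_index_iota ?iota_uniq//=.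
  rewrite {1}/kc mem_set// sc eqxx /= lerDl sumr_ge0//.
apply: matrix_bounded_sum => c _ N x x0.
have [C0 h1 h2] := hC c.
pose al j := if (s c j < N)%N then (k (s c j) j * x j)%:C else 0.
have -> : rsec N (fun i => \sum_(0 <= j < N) kc c i j * x j) =
    rnorm (\sum_(0 <= j < N | j \in A c) al j *: e (s c j)).
  rewrite /rsec /section; congr rnorm.
  under eq_bigr do rewrite rmorph_sum /= scaler_suml.
  rewrite exchange_big_nat /= [RHS]big_mkcond; apply: eq_bigr => j _.
  rewrite /kc; case: ifPn => jA /=; last first.
    by rewrite big1// => i _; rewrite mul0r scale0r.
  rewrite /al; case: ltnP => sN.
    rewrite (bigD1_seq (s c j)) ?mem_index_iota ?iota_uniq//= eqxx big1 ?addr0//.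
    by move=> i; rewrite eq_sym => /negbTE ->; rewrite mul0r scale0r.
  rewrite scale0r big_nat big1// => i /andP[_ iN].
  by rewrite gtn_eqF ?(leq_trans iN)// mul0r scale0r.
rewrite (le_trans (h2 _ _))// -!mulrA ler_wpM2l ?(ltW C0)//.
rewrite mulrA.
rewrite big_mkcond /=.
rewrite (eq_bigr (fun n => (if n \in A c then al n else 0) *: e n)); last first.
  by move=> n _; case: ifP; rewrite ?scale0r.
rewrite -[C c * dl]ger0_norm ?mulr_ge0 ?(ltW C0)// -rsecZ rsec_norm.
apply: rsec_mono_nneg => j _; rewrite rnorm_ge0 /=.
have P0 : 0 <= C c * dl * x j by rewrite !mulr_ge0 ?(ltW C0).
case: ifPn => jA; last by rewrite rnorm0.
rewrite /al; case: ifP => _; last by rewrite rnorm0.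
rewrite rnormR ger0_norm ?mulr_ge0// ler_wpM2r//.
have es : 0 < rnorm (e (s c j)) by exact: rnorm_e_gt0.
rewrite -(ler_pM2r es) (le_trans (kdl _ _))// mulrAC [leLHS]mulrC ler_wpM2r//.
by apply: h1; exact: set_mem.
Qed.

End BandMatrices.

End NonnegativeMatrices.

(** * Regular operators *)

Section RegularOperators.
Variables (R : realType) (E : completeNormedModType R[i]) (e : nat -> E).
Hypotheses (sb : schauder_basis e) (u1 : one_unconditional e).
Local Notation co := (biorth e).
Local Notation sec := (section e).
Local Notation ReC z := (complex.Re z).
Local Notation ImC z := (complex.Im z).

Lemma ge0CE (z : R[i]) : (0 <= z) = (ImC z == 0) && (0 <= ReC z).
Proof. by rewrite lecE /=. Qed.

Lemma ReC_real (z : R[i]) : ImC z = 0 -> z = (ReC z)%:C.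
Proof. by case: z => a b /= ->. Qed.

Lemma ReC_realM (z w : R[i]) : ImC z = 0 -> ReC (z * w) = ReC z * ReC w.
Proof. by case: z w => a b [c f] /= ->; rewrite mul0r subr0. Qed.

Lemma ImC_realM (z w : R[i]) : ImC z = 0 -> ImC w = 0 -> ImC (z * w) = 0.
Proof. by case: z w => a b [c f] /= -> ->; rewrite mul0r mulr0 addr0. Qed.

Lemma ImCD (z w : R[i]) : ImC (z + w) = ImC z + ImC w.
Proof. by case: z w => a b [c f]. Qed.

Lemma ReCB (z w : R[i]) : ReC (z - w) = ReC z - ReC w.
Proof. by case: z w => a b [c f]. Qed.

Lemma ImCB (z w : R[i]) : ImC (z - w) = ImC z - ImC w.
Proof. by case: z w => a b [c f]. Qed.

Lemma ReC_sum I (s : seq I) (P : pred I) (F : I -> R[i]) :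
  ReC (\sum_(i <- s | P i) F i) = \sum_(i <- s | P i) ReC (F i).
Proof. by apply: (big_morph (fun z : R[i] => ReC z)) => // x y; rewrite ReCD. Qed.

Lemma ImC_sum I (s : seq I) (P : pred I) (F : I -> R[i]) :
  ImC (\sum_(i <- s | P i) F i) = \sum_(i <- s | P i) ImC (F i).
Proof. by apply: (big_morph (fun z : R[i] => ImC z)) => // x y; rewrite ImCD. Qed.

Lemma rnorm_realC (z : R[i]) : ImC z = 0 -> rnorm z = `|ReC z|.
Proof. by move=> /ReC_real {1}->; rewrite rnormR. Qed.

Lemma biorth_lin i (c : R[i]) x y : co i (c *: x + y) = c * co i x + co i y.
Proof. exact: biorth_is_scalar. Qed.
Lemma biorthD i x y : co i (x + y) = co i x + co i y.
Proof. exact: scalD (biorth_is_scalar sb i) _ _. Qed.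
Lemma biorthB i x y : co i (x - y) = co i x - co i y.
Proof. exact: scalB (biorth_is_scalar sb i) _ _. Qed.
Lemma biorthZ i c x : co i (c *: x) = c * co i x.
Proof. exact: scalZ (biorth_is_scalar sb i) _ _. Qed.

Lemma real_spanP x : real_span e x <-> forall n, ImC (co n x) = 0.
Proof.
split.
- move=> clx n; apply/eqP; rewrite -normr_eq0 eq_le normr_ge0 andbT.
  apply/ler_addgt0Pr => eps eps0; rewrite add0r.
  have en := rnorm_e_gt0 sb n.
  have eta0 : 0 < eps * rnorm (e n) by rewrite mulr_gt0.
  have /clx [y [[N [r ->]] xy]] : nbhs x (ball x (eps * rnorm (e n))%:C).
    by apply: nbhsx_ballx; rewrite ltcR.
  move: xy; rewrite -ball_normE /= rnormE ltcR => xy.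
  have -> : ImC (co n x) = ImC (co n (x - sec N (fun n => (r n)%:C))).
    by rewrite biorthB ImCB biorth_section//; case: ifP => _; rewrite subr0.
  rewrite (le_trans (rnorm_Im _))// (le_trans (biorth_bounded sb u1 _ _))//.
  by rewrite mulrC ler_pdivrMr// ltW.
- move=> xr B /(section_cvg sb x) [N _ hN].
  exists (sec N (co ^~ x)); split; last exact: (hN N (leqnn N)).
  exists N, (fun n => ReC (co n x)); apply: eq_section => n _.
  exact: ReC_real.
Qed.

Lemma real_span_e n : real_span e (e n).
Proof. by apply/real_spanP => m; rewrite biorth_e//; case: eqP. Qed.

Lemma real_span_lin (r : R) x y : real_span e x -> real_span e y -> real_span e (r%:C *: x + y).
Proof.
move=> /real_spanP hx /real_spanP hy; apply/real_spanP => n.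
by rewrite biorth_lin ImCD ImC_realM// hy addr0.
Qed.

Lemma real_spanD x y : real_span e x -> real_span e y -> real_span e (x + y).
Proof. by move=> hx hy; have := @real_span_lin 1 _ _ hx hy; rewrite rmorph1 scale1r. Qed.

Lemma real_spanB x y : real_span e x -> real_span e y -> real_span e (x - y).
Proof.
move=> /real_spanP hx /real_spanP hy; apply/real_spanP => n.
by rewrite biorthB ImCB hx hy subrr.
Qed.

Lemma real_spanZ (r : R) x : real_span e x -> real_span e (r%:C *: x).
Proof.
by move=> /real_spanP hx; apply/real_spanP => n; rewrite biorthZ ImC_realM.
Qed.

Lemma real_span_section N (x : nat -> R) : real_span e (sec N (fun j => (x j)%:C)).
Proof.
by apply/real_spanP => n; rewrite biorth_section//; case: ifP.
Qed.

Lemma abs_vector x : exists y, [/\ forall n, co n y = (rnorm (co n x))%:C,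
  real_span e y & rnorm y = rnorm x].
Proof.
have [n|y [_ hy]] := @dominated_expansion _ _ e sb u1 (fun n => (rnorm (co n x))%:C) x.
  by rewrite rnormR ger0_norm ?rnorm_ge0.
exists y; split => //; first by apply/real_spanP => n; rewrite hy.
by apply/eqP; rewrite eq_le; apply/andP; split; apply: (biorth_le_rnorm sb u1) => n;
  rewrite hy rnormR ger0_norm ?rnorm_ge0.
Qed.

Lemma real_imag_decomposition x : exists y z, [/\ real_span e y, real_span e z &
  x = y + ('i%C : R[i]) *: z].
Proof.
have [n|y [_ hy]] := @dominated_expansion _ _ e sb u1 (fun n => (ReC (co n x))%:C) x.
  by rewrite rnormR rnorm_Re.
have [n|z [_ hz]] := @dominated_expansion _ _ e sb u1 (fun n => (ImC (co n x))%:C) x.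
  by rewrite rnormR rnorm_Im.
exists y, z; split; [by apply/real_spanP => n; rewrite hy
                    |by apply/real_spanP => n; rewrite hz|].
by apply: (biorth_inj sb) => n; rewrite biorthD biorthZ hy hz -complexE.
Qed.

Lemma real_imag_biorth x y z : real_span e y -> real_span e z ->
  x = y + ('i%C : R[i]) *: z ->
  forall n, co n y = (ReC (co n x))%:C /\ co n z = (ImC (co n x))%:C.
Proof.
move=> /real_spanP hy /real_spanP hz -> n; rewrite biorthD biorthZ.
move: (hy n) (hz n); case: (co n y) => a b; case: (co n z) => a' b' /= -> ->.
by split; simpc.
Qed.

Lemma real_partP x : real_span e (real_part e x) /\
  forall n, co n (real_part e x) = (ReC (co n x))%:C.
Proof.
have [y [z [ry rz xyz]]] := real_imag_decomposition x.
have : exists y, real_span e y /\ exists2 z, real_span e z & x = y + ('i%C : R[i]) *: z.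
  by exists y; split => //; exists z.
move=> /(xgetPex 0) [r1 [z1 rz1 E1]]; split => // n.
by have [] := real_imag_biorth r1 rz1 E1 n.
Qed.

Lemma imag_partP x : real_span e (imag_part e x) /\
  forall n, co n (imag_part e x) = (ImC (co n x))%:C.
Proof.
have [y [z [ry rz xyz]]] := real_imag_decomposition x.
have : exists z, real_span e z /\ exists2 y, real_span e y & x = y + ('i%C : R[i]) *: z.
  by exists z; split => //; exists y.
move=> /(xgetPex 0) [r1 [z1 rz1 E1]]; split => // n.
by have [] := real_imag_biorth rz1 r1 E1 n.
Qed.

Record real_bounded (T : E -> E) : Prop := RealBounded {
  real_bounded_real : forall x, real_span e x -> real_span e (T x);
  real_bounded_linear : forall (r : R) x y, real_span e x -> real_span e y ->
    T (r%:C *: x + y) = r%:C *: T x + T y;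
  real_bounded_bound : exists2 C : R, 0 <= C &
    forall x, real_span e x -> rnorm (T x) <= C * rnorm x
}.

Definition entry (T : E -> E) i j : R := ReC (co i (T (e j))).

Lemma real_bounded_entry T i j : real_bounded T -> co i (T (e j)) = (entry T i j)%:C.
Proof.
by move=> /real_bounded_real/(_ _ (@real_span_e j))/real_spanP/(_ i)/ReC_real.
Qed.

Lemma real_linear0 (T : E -> E) : (forall (r : R) x y, real_span e x -> real_span e y ->
    T (r%:C *: x + y) = r%:C *: T x + T y) -> T 0 = 0.
Proof.
move=> lT; have r0 : real_span e 0 by apply/real_spanP => n; rewrite (scal0 (biorth_is_scalar sb n)).
by have := lT (-1) 0 0 r0 r0; rewrite scaler0 addr0 rmorphN1 scaleN1r addNr.
Qed.

Lemma real_linear_section (T : E -> E) N x : (forall (r : R) x y, real_span e x -> real_span e y ->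
    T (r%:C *: x + y) = r%:C *: T x + T y) ->
  T (sec N (fun j => (x j)%:C)) = \sum_(0 <= j < N) (x j)%:C *: T (e j).
Proof.
move=> lT; elim: N => [|N ih]; first by rewrite /section !big_nil real_linear0.
rewrite sectionS addrC lT ?ih; first by rewrite big_nat_recr//= addrC.
  exact: real_span_e.
exact: real_span_section.
Qed.

Lemma real_linear_section_entry T i N x : real_bounded T ->
  co i (T (sec N (fun j => (x j)%:C))) = (\sum_(0 <= j < N) entry T i j * x j)%:C.
Proof.
move=> rT; rewrite real_linear_section; last exact: real_bounded_linear.
rewrite (scal_sum (biorth_is_scalar sb i)) rmorph_sum /=; apply: eq_bigr => j _.
by rewrite biorthZ real_bounded_entry// realCM mulrC.
Qed.

Lemma real_boundedD S T : real_bounded S -> real_bounded T -> real_bounded (S + T).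
Proof.
move=> hS hT; split.
- move=> x rx; apply: real_spanD; exact: real_bounded_real.
- move=> r x y rx ry; rewrite !opDE !(real_bounded_linear hS)// !(real_bounded_linear hT)//.
  by rewrite scalerDr addrACA.
- have [C C0 hC] := real_bounded_bound hS; have [D D0 hD] := real_bounded_bound hT.
  exists (C + D); first exact: addr_ge0.
  by move=> x rx; rewrite (le_trans (rnormD _ _))// mulrDl lerD// ?hC// hD.
Qed.

Lemma real_boundedN T : real_bounded T -> real_bounded (- T).
Proof.
move=> hT; split.
- move=> x rx; rewrite [(- T) x](_ : _ = (-1)%:C *: T x); last by rewrite rmorphN1 scaleN1r.
  by apply: real_spanZ; exact: real_bounded_real.
- move=> r x y rx ry; rewrite [LHS](_ : _ = - T (r%:C *: x + y))// (real_bounded_linear hT)//.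
  by rewrite opprD -scalerN.
- have [D D0 hD] := real_bounded_bound hT; exists D => // x rx.
  by rewrite [(- T) x](_ : _ = - T x)// rnormN hD.
Qed.

Lemma real_boundedB S T : real_bounded S -> real_bounded T -> real_bounded (S - T).
Proof. by move=> hS hT; apply: real_boundedD => //; exact: real_boundedN. Qed.

Lemma entryD S T i j : entry (S + T) i j = entry S i j + entry T i j.
Proof. by rewrite /entry opDE biorthD ReCD. Qed.

Lemma entryB S T i j : entry (S - T) i j = entry S i j - entry T i j.
Proof. by rewrite /entry opBE biorthB ReCB. Qed.

Lemma entryN T i j : entry (- T) i j = - entry T i j.
Proof.
rewrite /entry [(- T) (e j)](_ : _ = (-1)%:C *: T (e j)); last by rewrite rmorphN1 scaleN1r.
by rewrite biorthZ ReC_realM //= mulN1r.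
Qed.

Lemma positive_of_entries T : real_bounded T -> (forall i j, 0 <= entry T i j) ->
  positive_op e T.
Proof.
move=> hT T0; split; [exact: real_bounded_real|exact: real_bounded_linear|].
move=> x rx x0 i; rewrite ge0CE.
have rTx := real_bounded_real hT rx.
have /real_spanP -> /= := rTx; rewrite eqxx /= leNgt; apply/negP => neg.
have [C C0 hC] := real_bounded_bound hT.
have ei := rnorm_e_gt0 sb i.
have xE : co ^~ x = fun j => (ReC (co j x))%:C.
  by apply/funext => j; apply: ReC_real; move/real_spanP: rx.
have [|N /(_ N (leqnn N))] := @section_tail _ _ e sb x (- ReC (co i (T x)) * rnorm (e i) / (C + 1)).
  by rewrite !divr_gt0 ?mulr_gt0 ?oppr_gt0//; lra.
rewrite xE; set s := sec N _; rewrite ltr_pdivlMr; last by lra.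
move=> h; have rs : real_span e s by exact: real_span_section.
have Ts : 0 <= ReC (co i (T s)).
  rewrite real_linear_section_entry//= sumr_ge0// => j _; rewrite mulr_ge0//.
  by have := x0 j; rewrite ge0CE => /andP[].
have : rnorm (co i (T (x - s))) * rnorm (e i) <= C * rnorm (x - s).
  by rewrite (le_trans (biorth_e_le sb u1 _ _))// hC//; exact: real_spanB.
have -> : T (x - s) = T x - T s.
  have := real_bounded_linear hT (-1) rs rx.
  by rewrite rmorphN1 !scaleN1r !(addrC (- _)).
have : - ReC (co i (T x)) <= rnorm (co i (T x - T s)).
  rewrite biorthB; apply: le_trans (rnorm_Re _); rewrite ReCB.
  by rewrite ler0_norm; lra.
have := rnorm_ge0 (x - s); nra.
Qed.

Lemma nonneg_biorth_rnorm x y : real_span e x -> nonneg e (y - x) -> nonneg e (y + x) ->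
  forall n, rnorm (co n x) <= rnorm (co n y).
Proof.
move=> /real_spanP rx h1 h2 n; rewrite rnorm_realC//; apply: le_trans (rnorm_Re _).
have := h1 n; have := h2 n; rewrite !ge0CE biorthB biorthD ReCB ReCD.
move=> /andP[_ a] /andP[_ b]; rewrite [leRHS]ger0_norm; last by lra.
by rewrite ler_norml; apply/andP; split; lra.
Qed.

Lemma positive_op_sub T x y : positive_op e T -> real_span e x -> real_span e y ->
  T (x - y) = T x - T y.
Proof.
move=> hT rx ry; have := positive_op_linear hT (-1) ry rx.
by rewrite rmorphN1 !scaleN1r !(addrC (- _)).
Qed.

Lemma positive_op_add T x y : positive_op e T -> real_span e x -> real_span e y ->
  T (x + y) = T x + T y.
Proof. by move=> hT rx ry; have := positive_op_linear hT 1 rx ry; rewrite rmorph1 !scale1r. Qed.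

Lemma positive_op_dominated T x y : positive_op e T -> real_span e x -> real_span e y ->
  nonneg e (y - x) -> nonneg e (y + x) -> rnorm (T x) <= rnorm (T y).
Proof.
move=> hT rx ry h1 h2; apply: (biorth_le_rnorm sb u1); apply: nonneg_biorth_rnorm.
- exact: positive_op_real.
- rewrite -positive_op_sub//; apply: positive_op_nonneg => //; exact: real_spanB.
- rewrite -positive_op_add//; apply: positive_op_nonneg => //; exact: real_spanD.
Qed.

(* If P were unbounded, there would be nonnegative b k of norm 2^-k with
   |P (b k)| > 2^k; their sum dominates every b k. *)
Lemma positive_real_bounded T : positive_op e T -> real_bounded T.
Proof.
move=> hT; split; [exact: positive_op_real|exact: positive_op_linear|].
apply: contrapT => H.
have hx (k : nat) : exists x, real_span e x /\ (4%:R ^+ k : R) * rnorm x < rnorm (T x).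
  apply: contrapT => Hk; apply: H; exists (4%:R ^+ k); first by rewrite exprn_ge0.
  move=> x rx; rewrite leNgt; apply/negP => h; apply: Hk.
  by exists x.
have hb (k : nat) : exists b, [/\ real_span e b, nonneg e b, rnorm b = (2%:R ^- k : R) &
    (2%:R ^+ k : R) < rnorm (T b)].
  have [x [rx Tx]] := hx k.
  have [a [ha ra na]] := abs_vector x.
  have x0 : 0 < rnorm x.
    rewrite lt0r rnorm_ge0 andbT rnorm_eq0; apply/eqP => x0; move: Tx.
    by rewrite x0 (real_linear0 (positive_op_linear hT)) !rnorm0 mulr0 ltxx.
  have Ta : rnorm (T x) <= rnorm (T a).
    move/real_spanP: (rx) => rx'.
    apply: positive_op_dominated => // n; rewrite ?biorthB ?biorthD ha (rnorm_realC (rx' n))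
      {2}(ReC_real (rx' n)) ge0CE /= ?subrr ?addr0 eqxx /= ?subr_ge0 ?ler_norm//.
    by rewrite -lerBlDr sub0r -normrN ler_norm.
  pose s : R := (2%:R ^+ k * rnorm x)^-1.
  have s0 : 0 < s by rewrite invr_gt0 mulr_gt0// exprn_gt0.
  exists (s%:C *: a); split.
  - exact: real_spanZ.
  - by move=> n; rewrite biorthZ ha realCM ge0CE /= eqxx mulr_ge0 ?rnorm_ge0 ?ltW.
  - by rewrite rnormZ rnormR gtr0_norm// na /s invfM mulfVK ?gt_eqF.
  - have -> : T (s%:C *: a) = s%:C *: T a.
      have r0 : real_span e 0 by apply/real_spanP => n; rewrite (scal0 (biorth_is_scalar sb n)).
      have := positive_op_linear hT s ra r0.
      by rewrite (real_linear0 (positive_op_linear hT)) !addr0.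
    rewrite rnormZ rnormR gtr0_norm// /s mulrC ltr_pdivlMr ?mulr_gt0 ?exprn_gt0//.
    rewrite mulrA -expr2 -exprM mulnC exprM (lt_le_trans _ Ta)//.
    by rewrite expr2 -natrM.
have [b bP] := choice hb.
pose S n := \sum_(0 <= k < n) b k.
have S_cauchy N n : (N <= n)%N -> rnorm (S n - S N) <= 2%:R * 2%:R ^- N.
  move=> Nn; rewrite /S (@big_cat_nat _ _ _ N)//= addrAC subrr add0r.
  rewrite (le_trans (rnorm_sum _ _ _))//.
  suff : \sum_(N <= k < n) rnorm (b k) <= 2%:R * 2%:R ^- N - 2%:R * 2%:R ^- n :> R.
    have : 0 <= (2%:R * 2%:R ^- n : R) by rewrite mulr_ge0// invr_ge0 exprn_ge0.
    lra.
  elim: n Nn => [|n ih]; first by rewrite leqn0 => /eqP->; rewrite big_geq// subrr.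
  rewrite leq_eqVlt => /orP[/eqP->|]; first by rewrite big_geq// subrr.
  rewrite ltnS => Nn; rewrite big_nat_recr//=.
  have [_ _ -> _] := bP n.
  have -> : 2%:R * 2%:R ^- n.+1 = 2%:R ^- n :> R.
    by rewrite exprS invfM mulrA divff// mul1r.
  have := ih Nn; lra.
have [z hz] : exists z : E, S @ \oo --> z.
  apply: cauchy_rnorm_cvg => eps eps0.
  have [N hN] : exists N, 2%:R / eps < 2%:R ^+ N.
    have := archi_boundP (ltW (divr_gt0 (ltr0Sn R 1) eps0)).
    set N := Num.bound _ => hN; exists N; rewrite (lt_trans hN)//.
    by rewrite -natrX ltr_nat ltn_expl.
  exists N => n Nn; rewrite (le_lt_trans (S_cauchy _ _ Nn))//.
  by rewrite ltr_pdivrMr ?exprn_gt0// mulrC -ltr_pdivrMr.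
have co_z i : forall eps : R, 0 < eps -> exists N, forall n, (N <= n)%N ->
    rnorm (co i (S n) - co i z) < eps.
  exact: functional_limit (biorth_is_scalar sb i) (biorth_bounded sb u1 i) hz.
have rz : real_span e z.
  apply/real_spanP => i; apply/eqP; rewrite -normr_eq0 eq_le normr_ge0 andbT.
  apply/ler_addgt0Pr => eps eps0; have [N /(_ N (leqnn N)) hN] := co_z i eps eps0.
  rewrite add0r; apply: le_trans (ltW hN); apply: le_trans (rnorm_Im _).
  rewrite ImCB (_ : ImC (co i (S N)) = 0) ?sub0r ?normrN//.
  rewrite (scal_sum (biorth_is_scalar sb i)) ImC_sum big1// => k _.
  by have [/real_spanP + _ _ _] := bP k; apply.
have zb k i : ReC (co i (b k)) <= ReC (co i z).
  apply/ler_addgt0Pr => eps eps0; have [N hN] := co_z i eps eps0.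
  have := hN (maxn N k.+1) (leq_maxl _ _); set n := maxn _ _ => h.
  have : ReC (co i (b k)) <= ReC (co i (S n)).
    rewrite (scal_sum (biorth_is_scalar sb i)) ReC_sum (bigD1_seq k) ?mem_index_iota ?leq_maxr ?iota_uniq//=.
    rewrite lerDl sumr_ge0// => l _; have [_ /(_ i) + _ _] := bP l.
    by rewrite ge0CE => /andP[].
  have := le_lt_trans (rnorm_Re _) h; rewrite ReCB ltr_norml => /andP[]; lra.
have Tz k : (2%:R ^+ k : R) < rnorm (T z).
  have [rb nb _ Tb] := bP k; apply: (lt_le_trans Tb).
  apply: positive_op_dominated => // i; rewrite ?biorthB ?biorthD ge0CE.
    have /real_spanP rb' := rb; have /real_spanP rz' := rz.
    by rewrite ImCB rb' rz' subrr eqxx ReCB subr_ge0 zb.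
  have /real_spanP rb' := rb; have /real_spanP rz' := rz.
  rewrite ImCD rb' rz' addr0 eqxx ReCD /=.
  have := nb i; rewrite ge0CE => /andP[_ h]; have := zb k i; lra.
have := archi_boundP (rnorm_ge0 (T z)); set N := Num.bound _ => hN.
have := Tz N; rewrite ltNge => /negP; apply; rewrite (le_trans (ltW hN))//.
by rewrite -natrX ler_nat ltnW// ltn_expl.
Qed.

End RegularOperators.

Section RegularSuprema.
Variables (R : realType) (E : completeNormedModType R[i]) (e : nat -> E).
Hypotheses (sb : schauder_basis e) (u1 : one_unconditional e).
Local Notation co := (biorth e).
Local Notation sec := (section e).
Local Notation ReC z := (complex.Re z).
Local Notation ImC z := (complex.Im z).
Local Notation ent := (entry e).

Lemma positive_entry_ge0 T i j : positive_op e T -> 0 <= ent T i j.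
Proof.
move=> hT; have ej : nonneg e (e j) by move=> k; rewrite biorth_e// ler0n.
have := positive_op_nonneg hT (real_span_e sb u1 (n := j)) ej i.
by rewrite ge0CE => /andP[].
Qed.

Lemma real_bounded_ext S T : (forall x, real_span e x -> S x = T x) ->
  real_bounded e T -> real_bounded e S.
Proof.
move=> ST hT; have rD r x y : real_span e x -> real_span e y -> real_span e (r%:C *: x + y).
  exact: real_span_lin.
split.
- by move=> x rx; rewrite ST//; exact: real_bounded_real.
- by move=> r x y rx ry; rewrite !ST ?(real_bounded_linear hT)//; exact: rD.
- by have [C C0 hC] := real_bounded_bound hT; exists C => // x rx; rewrite ST// hC.
Qed.

Lemma entry_ext S T i j : (forall x, real_span e x -> S x = T x) -> ent S i j = ent T i j.
Proof. by move=> ST; rewrite /entry ST//; exact: real_span_e. Qed.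

Lemma real_regularP T : real_regular e T <->
  real_bounded e T /\ exists G, positive_op e G /\ forall i j, `|ent T i j| <= ent G i j.
Proof.
split.
- move=> [P [Q [hP hQ TPQ]]].
  have rP := positive_real_bounded sb u1 hP; have rQ := positive_real_bounded sb u1 hQ.
  have TE : forall x, real_span e x -> T x = (P - Q) x by move=> x rx; rewrite TPQ.
  split; first by apply: (real_bounded_ext TE); exact: real_boundedB.
  exists (P + Q); split.
    apply: positive_of_entries => //; first exact: real_boundedD.
    by move=> i j; rewrite entryD// addr_ge0 ?positive_entry_ge0.
  move=> i j; rewrite (entry_ext _ _ TE) entryB// entryD//.
  have := positive_entry_ge0 i j hP; have := positive_entry_ge0 i j hQ.
  by rewrite ler_norml => ? ?; apply/andP; split; lra.
- move=> [rT [G [hG TG]]]; have rG := positive_real_bounded sb u1 hG.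
  exists (T + G), G; split => //.
    apply: positive_of_entries => //; first exact: real_boundedD.
    move=> i j; rewrite entryD//; have := TG i j; rewrite ler_norml => /andP[]; lra.
  by move=> x _; rewrite opDE addrK.
Qed.

Lemma op_leP S T : real_bounded e S -> real_bounded e T ->
  op_le e S T <-> forall i j, ent S i j <= ent T i j.
Proof.
move=> rS rT; split=> [h i j|h].
  by rewrite -subr_ge0 -entryB// positive_entry_ge0.
apply: positive_of_entries => //; first exact: real_boundedB.
by move=> i j; rewrite entryB// subr_ge0.
Qed.

Lemma real_linear_bounded T (C : R) : linear T -> rbounded C T ->
  (forall i j, ImC (co i (T (e j))) = 0) -> real_bounded e T.
Proof.
move=> lT bT Tr; split.
- move=> x /(real_spanP sb u1) rx; apply/(real_spanP sb u1) => i.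
  apply/eqP; rewrite -normr_eq0 eq_le normr_ge0 andbT.
  apply/ler_addgt0Pr => eps eps0; rewrite add0r.
  have lc : scalar (co i \o T) by move=> c u v /=; rewrite lT biorth_lin.
  have bc : rbounded ((rnorm (e i))^-1 * C) (co i \o T).
    move=> u /=; rewrite (le_trans (biorth_bounded sb u1 _ _))// -mulrA.
    by apply: ler_wpM2l (bT u); rewrite invr_ge0 rnorm_ge0.
  have [N /(_ N (leqnn N)) hN] := functional_limit lc bc (section_cvg sb x) eps0.
  apply: le_trans (ltW hN); apply: le_trans (rnorm_Im _).
  rewrite ImCB (_ : ImC ((co i \o T) (sec N (co ^~ x))) = 0) ?sub0r ?normrN//.
  rewrite functional_section// ImC_sum big1// => j _.
  by rewrite ImC_realM ?rx /=.
- by move=> r x y _ _; rewrite lT.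
- exists `|C| => // x _; rewrite (le_trans (bT x))// ler_wpM2r ?rnorm_ge0 ?ler_norm//.
Qed.

Lemma regular_sup_exists (A : set (E -> E)) G : A !=set0 -> positive_op e G ->
  (forall T, A T -> real_bounded e T /\ forall i j, `|ent T i j| <= ent G i j) ->
  is_regular_sup e A (regular_sup e A).
Proof.
move=> [T0 AT0] hG AG; apply: xgetPex.
have rG := positive_real_bounded sb u1 hG.
have [C C0 GC] := real_bounded_bound rG.
pose s i j := sup [set ent T i j | T in A].
have hs i j : has_sup [set ent T i j | T in A].
  split; first by exists (ent T0 i j); exists T0.
  exists (ent G i j) => _ [T AT <-]; have [_ h] := AG _ AT.
  exact: le_trans (ler_norm _) (h i j).
have sT T i j : A T -> ent T i j <= s i j.
  by move=> AT; apply: ub_le_sup; [exact: (hs i j).2|exists T].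
have sG i j : `|s i j| <= ent G i j.
  rewrite ler_norml; apply/andP; split.
    have := sT _ i j AT0; have [_ /(_ i j)] := AG _ AT0.
    rewrite ler_norml => /andP[]; lra.
  apply: ge_sup; first exact: (hs i j).1.
  by move=> _ [T AT <-]; have [_ h] := AG _ AT; exact: le_trans (ler_norm _) (h i j).
have hz j : exists z, forall i, co i z = (s i j)%:C.
  have [i|z [_ hz]] := @dominated_expansion _ _ e sb u1 (fun i => (s i j)%:C) (G (e j)).
    by rewrite (real_bounded_entry sb u1 _ _ rG) !rnormR (le_trans (sG i j))// ler_norm.
  by exists z.
have [z zP] := choice hz.
have [|S [lS bS Se _]] := @operator_of_columns _ _ e sb u1 E z C C0.
  move=> N c.
  apply: (@le_trans _ _ (rnorm (G (sec N (fun j => (rnorm (c j))%:C))))).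
    apply: (biorth_le_rnorm sb u1) => i.
    rewrite real_linear_section_entry// (scal_sum (biorth_is_scalar sb i)).
    rewrite rnormR (le_trans (rnorm_sum _ _ _))//.
    apply: le_trans (ler_norm _); apply: ler_sum => j _.
    rewrite biorthZ// zP rnormM rnormR mulrC ler_wpM2r ?rnorm_ge0//.
  rewrite (le_trans (GC _ _))//; first exact: real_span_section.
  by rewrite ler_wpM2l// [leRHS](rsec_norm u1).
have rS : real_bounded e S.
  by apply: real_linear_bounded bS _ => // i j; rewrite Se zP.
have entS i j : ent S i j = s i j by rewrite /entry Se zP.
exists S; split.
- by apply/real_regularP; split=> //; exists G; split=> // i j; rewrite entS.
- move=> T AT; have [rT _] := AG _ AT; apply/op_leP => // i j.
  by rewrite entS sT.
- move=> U /real_regularP[rU _] UA; apply/op_leP => // i j; rewrite entS.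
  apply: ge_sup; first exact: (hs i j).1.
  by move=> _ [T AT <-]; have [rT _] := AG _ AT; have := UA _ AT; move/op_leP; apply.
Qed.

Lemma real_absP T : real_regular e T -> is_regular_sup e [set S | S = T \/ S = - T] (real_abs e T).
Proof.
move=> /real_regularP [rT [G [hG TG]]]; apply: (regular_sup_exists _ hG).
  by exists T; left.
move=> S [->|->]; split => //; first exact: real_boundedN.
by move=> i j; rewrite entryN// normrN.
Qed.

Lemma real_part_bounded a : bounded_op E a ->
  real_bounded e (real_part e \o a) /\ real_bounded e (imag_part e \o a).
Proof.
move=> ba; have [la _] := ba; have [C C0 hC] := bounded_op_rbounded ba.
split; split.
- by move=> x _ /=; case: (real_partP sb u1 (a x)).
- move=> r x y _ _ /=; apply: (biorth_inj sb) => n; rewrite biorth_lin//.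
  have [_ ->] := real_partP sb u1 (a (r%:C *: x + y)).
  have [_ ->] := real_partP sb u1 (a x); have [_ ->] := real_partP sb u1 (a y).
  by rewrite la biorth_lin// ReCD ReC_realM//= rmorphD rmorphM.
- exists C => // x _ /=; apply: le_trans (hC x); apply: (biorth_le_rnorm sb u1) => n.
  by have [_ ->] := real_partP sb u1 (a x); rewrite rnormR rnorm_Re.
- by move=> x _ /=; case: (imag_partP sb u1 (a x)).
- move=> r x y _ _ /=; apply: (biorth_inj sb) => n; rewrite biorth_lin//.
  have [_ ->] := imag_partP sb u1 (a (r%:C *: x + y)).
  have [_ ->] := imag_partP sb u1 (a x); have [_ ->] := imag_partP sb u1 (a y).
  rewrite la biorth_lin// ImCD rmorphD; congr (_ + _); rewrite -rmorphM; congr (_%:C).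
  by case: (co n (a x)) => u v /=; rewrite mul0r addr0.
- exists C => // x _ /=; apply: le_trans (hC x); apply: (biorth_le_rnorm sb u1) => n.
  by have [_ ->] := imag_partP sb u1 (a x); rewrite rnormR rnorm_Im.
Qed.

Lemma entry_real_part a i j : ent (real_part e \o a) i j = ReC (co i (a (e j))).
Proof. by rewrite /entry /=; have [_ ->] := real_partP sb u1 (a (e j)). Qed.

Lemma entry_imag_part a i j : ent (imag_part e \o a) i j = ImC (co i (a (e j))).
Proof. by rewrite /entry /=; have [_ ->] := imag_partP sb u1 (a (e j)). Qed.

Lemma real_boundedZ (r : R) T : real_bounded e T -> real_bounded e (r%:C *: T).
Proof.
move=> hT; split.
- by move=> x rx; rewrite opZE; apply: real_spanZ => //; exact: real_bounded_real.
- move=> s x y rx ry; rewrite !opZE (real_bounded_linear hT)// scalerDr !scalerA.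
  by rewrite (mulrC r%:C).
- have [C C0 hC] := real_bounded_bound hT; exists (`|r| * C); first by rewrite mulr_ge0.
  by move=> x rx; rewrite opZE rnormZ rnormR -mulrA ler_wpM2l// hC.
Qed.

Lemma entryZ (r : R) T i j : ent (r%:C *: T) i j = r * ent T i j.
Proof. by rewrite /entry opZE biorthZ// ReC_realM. Qed.

(* The values [t = 0] and [t = pi / 2] of the supremum already dominate the
   real and the imaginary part. *)
Lemma modulus_dominates a : regular e a ->
  positive_op e (modulus e a) /\
  forall i j, rnorm (co i (a (e j))) <= 2 * ent (modulus e a) i j.
Proof.
move=> [ba rr rc].
set Ar := real_part e \o a in rr; set Ac := imag_part e \o a in rc.
pose c t := (cos t)%:C *: Ar + (sin t)%:C *: Ac.
have [_ [Gr [hGr ArG]]] := (real_regularP Ar).1 rr.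
have [_ [Gc [hGc AcG]]] := (real_regularP Ac).1 rc.
have [rAr rAc] := real_part_bounded ba.
have rGr := positive_real_bounded sb u1 hGr; have rGc := positive_real_bounded sb u1 hGc.
have hG : positive_op e (Gr + Gc).
  apply: positive_of_entries => //; first exact: real_boundedD.
  by move=> i j; rewrite entryD// addr_ge0// positive_entry_ge0.
have rc_t t : real_bounded e (c t) by apply: real_boundedD => //; exact: real_boundedZ.
have c_t t i j : `|ent (c t) i j| <= ent (Gr + Gc) i j.
  rewrite /c !entryD// !entryZ (le_trans (ler_normD _ _))// !normrM.
  apply: lerD; [apply: le_trans (ArG i j)|apply: le_trans (AcG i j)];
    by rewrite ler_piMl// ler_norml ?cos_geN1 ?cos_le1 ?sin_geN1 ?sin_le1.
have reg_c t : real_regular e (c t).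
  by apply/real_regularP; split=> //; exists (Gr + Gc).
have reg_G : real_regular e (Gr + Gc).
  apply/real_regularP; split; first exact: real_boundedD.
  by exists (Gr + Gc); split=> // i j; rewrite ger0_norm// positive_entry_ge0.
have rG : real_bounded e (Gr + Gc) by exact: real_boundedD.
have S_t t : real_bounded e (real_abs e (c t)) /\
    forall i j, `|ent (c t) i j| <= ent (real_abs e (c t)) i j <= ent (Gr + Gc) i j.
  have [/real_regularP[rS _] Sub Slub] := real_absP (reg_c t).
  have rN : real_bounded e (- c t) by exact: real_boundedN.
  split=> // i j; apply/andP; split.
    rewrite ler_norml lerNl -entryN//; apply/andP; split.
      by move: i j; apply/op_leP => //; apply: Sub; right.
    by move: i j; apply/op_leP => //; apply: Sub; left.
  move: i j; apply/op_leP => //; apply: Slub => // T [->|->]; apply/op_leP => // i j.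
    exact: le_trans (ler_norm _) (c_t t i j).
  by rewrite entryN//; apply: le_trans (c_t t i j); rewrite -normrN ler_norm.
have : is_regular_sup e [set real_abs e (c t) | t in [set t : R | 0 <= t <= 2 * pi]] (modulus e a).
  apply: (regular_sup_exists _ hG).
    by exists (real_abs e (c 0)); exists 0 => //=; rewrite lexx mulr_ge0// pi_ge0.
  move=> _ [t _ <-]; have [rS hS] := S_t t; split => // i j.
  have /andP[h1 h2] := hS i j; rewrite ger0_norm//; exact: le_trans (normr_ge0 _) h1.
move=> [/real_regularP[rM _] Mub _].
have Mt t i j : 0 <= t <= 2 * pi -> `|ent (c t) i j| <= ent (modulus e a) i j.
  move=> t0; have [rS hS] := S_t t; have /andP[h1 _] := hS i j; apply: (le_trans h1).
  by move: i j {h1}; apply/op_leP => //; apply: Mub; exists t.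
have M0 i j : `|ReC (co i (a (e j)))| <= ent (modulus e a) i j.
  have := Mt 0 i j; rewrite /c entryD// !entryZ cos0 sin0 mul1r mul0r addr0 entry_real_part.
  by apply; rewrite lexx mulr_ge0// pi_ge0.
have M1 i j : `|ImC (co i (a (e j)))| <= ent (modulus e a) i j.
  have := Mt (pi / 2) i j; rewrite /c entryD// !entryZ cos_pihalf sin_pihalf mul1r mul0r add0r.
  by rewrite entry_imag_part; apply; have := pi_ge0 R; lra.
split.
  apply: positive_of_entries => // i j; exact: le_trans (normr_ge0 _) (M0 i j).
move=> i j; apply: (le_trans (rnorm_ReIm _)); have := M0 i j; have := M1 i j; lra.
Qed.

Definition abs_matrix (a : E -> E) i j : R := rnorm (co i (a (e j))).

Lemma abs_matrix_ge0 a i j : 0 <= abs_matrix a i j.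
Proof. exact: rnorm_ge0. Qed.

Lemma regular_matrix_bounded a : regular e a ->
  matrix_bounded e (2 * regular_norm e a) (abs_matrix a).
Proof.
move=> ra; have [hM aM] := modulus_dominates ra => N x x0.
have rM := positive_real_bounded sb u1 hM.
have rs : real_span e (sec N (fun j => (x j)%:C)) by exact: real_span_section.
apply: (@le_trans _ _ (rnorm (2%:C *: modulus e a (sec N (fun j => (x j)%:C))))).
  apply: (biorth_le_rnorm sb u1) => i.
  rewrite biorthZ// real_linear_section_entry// biorth_section// realCM rnormR.
  have h : \sum_(0 <= j < N) abs_matrix a i j * x j <=
           2 * \sum_(0 <= j < N) ent (modulus e a) i j * x j.
    rewrite mulr_sumr; apply: ler_sum => j _; rewrite mulrA ler_wpM2r//; exact: aM.
  have h0 : 0 <= \sum_(0 <= j < N) abs_matrix a i j * x j.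
    by rewrite sumr_ge0// => j _; rewrite mulr_ge0// abs_matrix_ge0.
  rewrite [leRHS]ger0_norm ?(le_trans h0 h)//.
  by case: ifP => _; rewrite ?rnorm0 ?(le_trans h0 h)// rnormR ger0_norm.
rewrite rnormZ rnormR ger0_norm// -mulrA ler_wpM2l//.
have [C C0 hC] := real_bounded_bound rM.
apply: (@opnorm_ge _ _ (real_span e) _ C) => //.
- by move=> r y ry; exact: real_spanZ.
- move=> r y ry; have r0 : real_span e 0.
    by apply/(real_spanP sb u1) => n; rewrite (scal0 (biorth_is_scalar sb n)).
  have := real_bounded_linear rM r ry r0.
  by rewrite (real_linear0 sb u1 (real_bounded_linear rM)) !addr0.
Qed.

Lemma matrix_bounded_regular a C : 0 <= C -> bounded_op E a ->
  matrix_bounded e C (abs_matrix a) -> regular e a.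
Proof.
move=> C0 ba aC.
have hz j : exists z, forall i, co i z = (abs_matrix a i j)%:C.
  have [i|z [_ hz]] := @dominated_expansion _ _ e sb u1 (fun i => (abs_matrix a i j)%:C) (a (e j)).
    by rewrite rnormR ger0_norm ?abs_matrix_ge0.
  by exists z.
have [z zP] := choice hz.
have [|B [lB bB Be _]] := @operator_of_columns _ _ e sb u1 E z C C0.
  move=> N c; set v := \sum_(0 <= n < N) _.
  apply: (rnorm_section_cvg_le (section_cvg sb v)) => M.
  pose K := maxn M N; apply: (le_trans (section_widen u1 _ (leq_maxl M N))); rewrite -/K.
  pose x j := if (j < N)%N then rnorm (c j) else 0.
  have x0 j : 0 <= x j by rewrite /x; case: ifP => //; rewrite rnorm_ge0.
  have -> : rnorm (sec N c) = rsec e K x.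
    rewrite (rsec_norm u1) /rsec -(section_trunc e (fun j => (rnorm (c j))%:C) (leq_maxr M N)).
    by congr rnorm; apply: eq_section => n _; rewrite /x; case: ifP.
  apply: le_trans (aC K x x0); rewrite (rsec_norm u1).
  apply: (rsec_mono_nneg u1) => i _; rewrite rnorm_ge0 /=.
  rewrite /v (scal_sum (biorth_is_scalar sb i)) (le_trans (rnorm_sum _ _ _))//.
  rewrite [leRHS](@big_cat_nat _ _ _ N) ?leq_maxr//=.
  apply: ler_wpDr.
    by rewrite sumr_ge0// => j _; rewrite mulr_ge0// abs_matrix_ge0.
  apply: ler_sum_nat => j /andP[_ jN]; rewrite biorthZ// zP rnormM rnormR /x jN.
  by rewrite mulrC ger0_norm ?abs_matrix_ge0.
have rB : real_bounded e B by apply: real_linear_bounded bB _ => // i j; rewrite Be zP.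
have entB i j : ent B i j = abs_matrix a i j by rewrite /entry Be zP.
have hB : positive_op e B by apply: positive_of_entries => // i j; rewrite entB abs_matrix_ge0.
have [rr rc] := real_part_bounded ba.
split=> //; apply/real_regularP; split=> //; exists B; split=> // i j; rewrite entB.
  by rewrite entry_real_part rnorm_Re.
by rewrite entry_imag_part rnorm_Im.
Qed.

Lemma abs_matrix_entry_le a (C : R) i j : rbounded C a ->
  abs_matrix a i j * rnorm (e i) <= C * rnorm (e j).
Proof. by move=> aC; apply: le_trans (aC _); exact: biorth_e_le. Qed.

Section Metric.
Variable d : nat -> nat -> R.
Hypotheses (md : is_metric d) (ulf : uniformly_locally_finite d).
Hypothesis ms : metric_symmetric d e.

Lemma band_matrix_bounded_abs b : band d e b ->
  exists2 C, 0 <= C & matrix_bounded e C (abs_matrix b).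
Proof.
move=> [bb [r r0 hr]]; have [C C0 hC] := bounded_op_rbounded bb.
have [D D0 hD] := band_matrix_bounded sb u1 md ulf ms r0.
exists (D * C); first by rewrite mulr_ge0// ltW.
apply: hD => //; first by move=> i j; exact: abs_matrix_ge0.
- by move=> i j; exact: abs_matrix_entry_le.
- by move=> i j rij; rewrite /abs_matrix hr ?rnorm0// (Defs.metricC md).
Qed.

Lemma regular_roe_approx a : regular_roe d e a -> forall eps : R, 0 < eps ->
  exists2 b, band d e b &
    matrix_bounded e eps (fun i j => rnorm (co i (a (e j)) - co i (b (e j)))).
Proof.
move=> [ra happ] eps eps0; have [|b bb ab] := happ (eps / 2); first by rewrite divr_gt0.
exists b => //.
have bab : bounded_op E (a - b).
  case: (ra) => ba _ _; case: (bb) => bbb _.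
  by rewrite addrC -scaleN1r; exact: bounded_op_lin.
have [Cb Cb0 hb] := band_matrix_bounded_abs bb.
have ha := regular_matrix_bounded ra.
pose Ca := `|2 * regular_norm e a|.
have ha' : matrix_bounded e Ca (abs_matrix a) by apply: matrix_bounded_wpM ha; exact: ler_norm.
have reg : regular e (a - b).
  apply: (@matrix_bounded_regular _ (Ca + Cb)) => //; first by rewrite addr_ge0 ?normr_ge0.
  apply: (matrix_bounded_le u1 _ (matrix_boundedD u1 ha' hb)) => i j.
  by rewrite abs_matrix_ge0 /abs_matrix opBE biorthB// rnormB.
have := regular_matrix_bounded reg.
have -> : abs_matrix (a - b) = (fun i j => rnorm (co i (a (e j)) - co i (b (e j)))).
  by apply/funext => i; apply/funext => j; rewrite /abs_matrix opBE biorthB.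
by apply: matrix_bounded_wpM; lra.
Qed.

End Metric.

End RegularSuprema.

(** * Isomorphisms of uniform Roe algebras *)

Section AlgebraIsomorphisms.
Variables (R : realType) (E F : completeNormedModType R[i]).
Implicit Types (A : set (E -> E)) (B : set (F -> F)).

(* Unlike [banach_algebra_iso] this carries the inverse, hence is symmetric. *)
Record algebra_iso A B (Phi : (E -> E) -> F -> F) (Psi : (F -> F) -> E -> E) (M : R) :
    Prop := AlgebraIso {
  algebra_iso_in : forall a, A a -> B (Phi a);
  algebra_iso_inV : forall b, B b -> A (Psi b);
  algebra_isoK : forall a, A a -> Psi (Phi a) = a;
  algebra_isoKV : forall b, B b -> Phi (Psi b) = b;
  algebra_isoL : forall (c : R[i]) a b, A a -> A b -> Phi (c *: a + b) = c *: Phi a + Phi b;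
  algebra_isoLV : forall (c : R[i]) a b, B a -> B b -> Psi (c *: a + b) = c *: Psi a + Psi b;
  algebra_isoM : forall a b, A a -> A b -> Phi (a \o b) = Phi a \o Phi b;
  algebra_isoMV : forall a b, B a -> B b -> Psi (a \o b) = Psi a \o Psi b;
  algebra_iso_bd : forall a C, 0 <= C -> A a -> rbounded C a -> rbounded (M * C) (Phi a);
  algebra_iso_bdV : forall b C, 0 <= C -> B b -> rbounded C b -> rbounded (M * C) (Psi b)
}.

End AlgebraIsomorphisms.

Lemma algebra_iso_sym (R : realType) (E F : completeNormedModType R[i])
    (A : set (E -> E)) (B : set (F -> F)) Phi Psi M :
  algebra_iso A B Phi Psi M -> algebra_iso B A Psi Phi M.
Proof. by case. Qed.

Lemma opnorm_ge0 (R : realType) (E : completeNormedModType R[i]) (a : E -> E) :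
  bounded_op E a -> (exists x : E, x != 0) -> 0 <= opnorm a.
Proof.
move=> ba [x x0]; have := rbounded_opnorm ba x; have := rnorm_ge0 (a x).
by rewrite -rnorm_gt0 in x0 => h1 h2; rewrite -(pmulr_lge0 _ x0) (le_trans h1).
Qed.

Lemma banach_algebra_iso_inverse (R : realType) (E F : completeNormedModType R[i])
    (d del : nat -> nat -> R) (e : nat -> E) (f : nat -> F) Phi :
  is_metric d -> is_metric del -> schauder_basis e -> schauder_basis f ->
  one_unconditional e -> one_unconditional f ->
  banach_algebra_iso (roe d e) (roe del f) Phi ->
  exists Psi M, 0 <= M /\ algebra_iso (roe d e) (roe del f) Phi Psi M.
Proof.
move=> md mdel sbe sbf ue uf iso.
have [inB inj surj] := iso_bij iso.
have hPsi b : exists a, roe del f b -> roe d e a /\ Phi a = b.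
  have [/surj [a Aa ab]|nb] := pselect (roe del f b); first by exists a.
  by exists 0.
have [Psi PsiP] := choice hPsi.
have [M1 hM1] := iso_bounded iso; have [M2 hM2] := iso_inv_bounded iso.
have Phi_in a : roe d e a -> roe del f (Phi a) by exact: inB.
have injE a b : roe d e a -> roe d e b -> Phi a = Phi b -> a = b.
  by move=> ha hb; apply: inj; rewrite inE.
have ne : exists x : E, x != 0 by exists (e 0%N); exact: e_neq0.
have nf : exists x : F, x != 0 by exists (f 0%N); exact: e_neq0.
have bound (G H : completeNormedModType R[i]) (a : G -> G) (b : H -> H) (M C : R) :
    (exists x : G, x != 0) -> bounded_op G a -> bounded_op H b -> `|M| <= `|M1| + `|M2| ->
    opnorm b <= M * opnorm a -> 0 <= C -> rbounded C a -> rbounded ((`|M1| + `|M2|) * C) b.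
  move=> nG ba bb MM hM C0 aC x; rewrite (le_trans (rbounded_opnorm bb x))//.
  rewrite ler_wpM2r ?rnorm_ge0// (le_trans hM)//.
  have := opnorm_ge0 ba nG; have := opnorm_le C0 aC; have := ler_norm M.
  move=> h1 h2 h3; apply: (@le_trans _ _ (`|M| * opnorm a)); first exact: ler_wpM2r.
  by apply: ler_pM.
exists Psi, (`|M1| + `|M2|); split; first exact: addr_ge0.
split.
- exact: Phi_in.
- by move=> b /PsiP[].
- by move=> a ha; have [h1 h2] := PsiP _ (Phi_in _ ha); apply: injE.
- by move=> b /PsiP[].
- exact: iso_linear iso.
- move=> c a b ha hb; have [a1 a2] := PsiP _ ha; have [b1 b2] := PsiP _ hb.
  have [c1 c2] := PsiP _ (roe_lin sbf c ha hb).
  apply: injE => //; first exact: roe_lin.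
  by rewrite c2 (iso_linear iso)// a2 b2.
- exact: iso_mul iso.
- move=> a b ha hb; have [a1 a2] := PsiP _ ha; have [b1 b2] := PsiP _ hb.
  have [c1 c2] := PsiP _ (roe_comp sbf uf mdel ha hb).
  apply: injE => //; first exact: roe_comp.
  by rewrite c2 (iso_mul iso)// a2 b2.
- move=> a C C0 ha; have [ba _] := ha; have [bb _] := Phi_in _ ha.
  by apply: bound (hM1 a ha) C0 => //; rewrite lerDl.
- move=> b C C0 hb; have [ha ab] := PsiP _ hb; have [ba _] := ha; have [bb _] := hb.
  by apply: (@bound _ _ b _ M2) => //; [by rewrite lerDr|rewrite -{2}ab; exact: hM2].
Qed.


Section Spatial.
Variables (R : realType) (E F : completeNormedModType R[i]).
Variables (d del : nat -> nat -> R) (e : nat -> E) (f : nat -> F).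
Variables (Phi : (E -> E) -> F -> F) (Psi : (F -> F) -> E -> E) (M : R).
Hypotheses (md : is_metric d) (mdel : is_metric del).
Hypotheses (sbe : schauder_basis e) (sbf : schauder_basis f).
Hypotheses (ue : one_unconditional e) (uf : one_unconditional f).
Hypothesis iso : algebra_iso (roe d e) (roe del f) Phi Psi M.
Local Notation coe := (biorth e).
Local Notation cof := (biorth f).

Lemma algebra_isoZ c a : roe d e a -> Phi (c *: a) = c *: Phi a.
Proof.
move=> ha; have -> : c *: a = (c - 1) *: a + a by rewrite scalerBl scale1r subrK.
by rewrite (algebra_isoL iso)// scalerBl scale1r subrK.
Qed.

Lemma algebra_isoD a b : roe d e a -> roe d e b -> Phi (a + b) = Phi a + Phi b.
Proof. by move=> ha hb; rewrite -[a in LHS]scale1r (algebra_isoL iso)// scale1r. Qed.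

Lemma roe_munit n m : roe d e (munit e n m).
Proof. by apply: band_roe; exact: munit_band. Qed.

Lemma roe0 : roe d e 0.
Proof.
have := roe_lin sbe (-1) (roe_munit 0 0) (roe_munit 0 0).
by rewrite scaleN1r addNr.
Qed.

Lemma roeD a b : roe d e a -> roe d e b -> roe d e (a + b).
Proof. by move=> ha hb; rewrite -[a]scale1r; exact: roe_lin. Qed.

Lemma algebra_iso0 : Phi 0 = 0.
Proof. by have := algebra_isoZ 0 roe0; rewrite !scale0r. Qed.

Lemma operator_eq0 (T : E -> E) C : linear T -> rbounded C T ->
  (forall i j, coe i (T (e j)) = 0) -> T = 0.
Proof.
move=> lT bT T0; apply/funext => x; apply: (biorth_inj sbe) => i.
rewrite (scal0 (biorth_is_scalar sbe i)).
have lc : scalar (coe i \o T) by move=> c u v /=; rewrite lT biorth_lin.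
have bc : rbounded ((rnorm (e i))^-1 * C) (coe i \o T).
  move=> u /=; rewrite (le_trans (biorth_bounded sbe ue _ _))// -mulrA.
  by apply: ler_wpM2l (bT u); rewrite invr_ge0 rnorm_ge0.
apply: rnorm_eq0P => eps eps0.
apply: (functional_limit_le (N := 0) lc bc (section_cvg sbe x)) => N _.
rewrite functional_section// big1 ?rnorm0 ?ltW// => j _.
by rewrite /= T0 mulr0.
Qed.

End Spatial.

Section SpatialData.
Variables (R : realType) (E F : completeNormedModType R[i]).
Variables (d del : nat -> nat -> R) (e : nat -> E) (f : nat -> F).
Variables (Phi : (E -> E) -> F -> F) (Psi : (F -> F) -> E -> E) (M : R).
Hypotheses (md : is_metric d) (mdel : is_metric del).
Hypotheses (sbe : schauder_basis e) (sbf : schauder_basis f).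
Hypotheses (ue : one_unconditional e) (uf : one_unconditional f).
Hypothesis iso : algebra_iso (roe d e) (roe del f) Phi Psi M.
Local Notation coe := (biorth e).
Local Notation cof := (biorth f).

Let iso' := algebra_iso_sym iso.
Let rE := roe_munit md sbe ue.
Let rF := roe_munit mdel sbf uf.
Let rPsi i j := algebra_iso_inV iso (rF i j).

(* [q], the preimage of the rank one idempotent [munit f 0 0], satisfies
   [q o T o q = c *: q] for all [T], and is therefore itself of rank one. *)
Lemma preimage_rank_one : exists (x : E) (y : E -> R[i]),
  [/\ scalar y, exists2 C : R, 0 <= C & rbounded C y,
    y x = 1 & Psi (munit f 0 0) = rank_one x y].
Proof.
set q := Psi (munit f 0 0).
have rq : roe d e q by exact: rPsi.
have [lq cq] := roe_bounded rq.
have [C C0 qC] := bounded_op_rbounded (roe_bounded rq).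
have [m [n mn]] : exists m n, coe m (q (e n)) != 0.
  apply: contrapT => H; have q0 : q = 0.
    apply: (operator_eq0 sbe ue lq qC) => i j; apply/eqP; apply: contrapT => h.
    by apply: H; exists i, j; apply/negP.
  have := algebra_isoKV iso (rF 0 0); rewrite -/q q0 (algebra_iso0 md sbe ue iso).
  move=> /(congr1 (fun T => T (f 0%N))); rewrite munit_e// eqxx scale1r => /eqP.
  by rewrite eq_sym; exact/negP/(e_neq0 sbf).
have qq z : q (q z) = q z.
  have := algebra_isoMV iso (rF 0 0) (rF 0 0).
  by rewrite munit_comp// eqxx scale1r -/q => /(congr1 (fun T => T z)).
pose la := coe m (q (e n)).
pose y z := coe m (q z).
have key z : y z *: q (e n) = la *: q z.
  pose ka := cof 0 (Phi (munit e n m) (f 0%N)).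
  have E1 : q \o munit e n m \o q = ka *: q.
    have rP := algebra_iso_in iso (rE n m).
    rewrite -[munit e n m](algebra_isoK iso (rE n m)).
    rewrite -(algebra_isoMV iso)// -(algebra_isoMV iso)//; last first.
      exact: (roe_comp sbf uf mdel (rF 0 0) rP).
    rewrite -(algebra_isoZ iso' ka (rF 0 0)); congr (Psi _); apply/funext => w.
    rewrite opZE /munit /rank_one /= (linZ (roe_linear rP)) (scalZ (biorth_is_scalar sbf 0)).
    by rewrite scalerA mulrC.
  have E2 u : y u *: q (e n) = ka *: q u.
    have := congr1 (fun T => T u) E1; rewrite opZE /= => <-.
    by rewrite /munit /rank_one (linZ lq).
  rewrite E2; congr (_ *: _); have := E2 (e n); move/eqP.
  rewrite -subr_eq0 -scalerBl scaler_eq0 subr_eq0 => /orP[/eqP <-//|/eqP qn0].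
  by move: mn; rewrite qn0 (scal0 (biorth_is_scalar sbe m)) eqxx.
exists (la^-1 *: q (e n)), y; split.
- by move=> c u v; rewrite /y lq biorth_lin.
- exists ((rnorm (e m))^-1 * C); first by rewrite mulr_ge0// invr_ge0 rnorm_ge0.
  move=> u; rewrite (le_trans (biorth_bounded sbe ue _ _))// -mulrA.
  by apply: ler_wpM2l (qC u); rewrite invr_ge0 rnorm_ge0.
- by rewrite /y (linZ lq) qq (scalZ (biorth_is_scalar sbe m)) mulVf.
- apply/funext => z; rewrite /rank_one scalerA mulrC -scalerA key scalerA mulVf//.
  by rewrite scale1r.
Qed.

Lemma spatial_data : exists (x : nat -> E) (y : nat -> E -> R[i]),
  [/\ forall j, scalar (y j), forall j, exists2 C : R, 0 <= C & rbounded C (y j),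
    forall i, y i (x i) = 1,
    forall i j, roe d e (rank_one (x i) (y j)) /\ Psi (munit f i j) = rank_one (x i) (y j) &
    forall a, roe d e a -> forall i j, cof i (Phi a (f j)) = y i (a (x j))].
Proof.
have [x0 [y0 [ly0 [C0 C00 hC0] yx0 qE]]] := preimage_rank_one.
pose x i := Psi (munit f i 0) x0; pose y j z := y0 (Psi (munit f 0 j) z).
have lPsi i j : linear (Psi (munit f i j)) by exact: roe_linear (rPsi i j).
have ly j : scalar (y j) by move=> c u v; rewrite /y lPsi ly0.
have xyE i j : Psi (munit f i j) = rank_one (x i) (y j).
  have -> : munit f i j = munit f i 0 \o munit f 0 0 \o munit f 0 j.
    by rewrite munit_comp// eqxx scale1r munit_comp// eqxx scale1r.
  rewrite (algebra_isoMV iso) ?(algebra_isoMV iso)//; last first.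
    exact: (roe_comp sbf uf mdel (rF i 0) (rF 0 0)).
  rewrite qE; apply/funext => z; rewrite /rank_one /= (linZ (lPsi _ _))//.
have PhiE i j : Phi (rank_one (x i) (y j)) = munit f i j.
  by rewrite -xyE (algebra_isoKV iso).
have rxy i j : roe d e (rank_one (x i) (y j)) by rewrite -xyE; exact: rPsi.
have coef a i j : roe d e a -> cof i (Phi a (f j)) = y i (a (x j)).
  move=> ra; have rPa := algebra_iso_in iso ra.
  have : Phi (rank_one (x i) (y i) \o a \o rank_one (x j) (y j)) =
         Phi (y i (a (x j)) *: rank_one (x i) (y j)).
    congr (Phi _); apply/funext => z; rewrite opZE /rank_one /= (linZ (roe_linear ra)).
    by rewrite (scalZ (ly i)) scalerA mulrC.
  rewrite (algebra_isoM iso (roe_comp sbe ue md (rxy i i) ra) (rxy j j)).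
  rewrite (algebra_isoM iso (rxy i i) ra).
  rewrite (algebra_isoZ iso)// !PhiE => /(congr1 (fun T => T (f j))).
  rewrite opZE /= !munit_e// eqxx !scale1r /munit /rank_one => /eqP.
  rewrite -subr_eq0 -scalerBl scaler_eq0 (negbTE (e_neq0 sbf i)) orbF subr_eq0.
  by move/eqP.
exists x, y; split=> //.
- move=> j; have [C hC0' hC] := bounded_op_rbounded (roe_bounded (rPsi 0 j)).
  exists (C0 * C); first exact: mulr_ge0.
  by move=> u; rewrite /y (le_trans (hC0 _))// -mulrA ler_wpM2l.
- move=> i; have : Psi (munit f i i) \o Psi (munit f i i) = Psi (munit f i i).
    by rewrite -(algebra_isoMV iso)// munit_comp// eqxx scale1r.
  have xi0 : x i != 0.
    apply/eqP => xi0; have := PhiE i i.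
    have -> : rank_one (x i) (y i) = 0.
      by apply/funext => z; rewrite /rank_one xi0 scaler0.
    rewrite (algebra_iso0 md sbe ue iso) => /(congr1 (fun T => T (f i))).
    rewrite munit_e// eqxx scale1r => /eqP.
    by rewrite eq_sym; exact/negP/(e_neq0 sbf).
  have yi0 : exists z, y i z != 0.
    apply: contrapT => H; have := PhiE i i.
    have -> : rank_one (x i) (y i) = 0.
      apply/funext => z; rewrite /rank_one; have [->|h] := eqVneq (y i z) 0.
        by rewrite scale0r.
      by exfalso; apply: H; exists z.
    rewrite (algebra_iso0 md sbe ue iso) => /(congr1 (fun T => T (f i))).
    rewrite munit_e// eqxx scale1r => /eqP.
    by rewrite eq_sym; exact/negP/(e_neq0 sbf).
  have [z yz] := yi0; rewrite xyE => /(congr1 (fun T => T z)).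
  rewrite /rank_one /= (scalZ (ly i)) => /eqP.
  rewrite -subr_eq0 -scalerBl scaler_eq0 (negbTE xi0) orbF subr_eq0.
  by rewrite -[X in _ == X]mulr1 => /eqP/(mulfI yz).
- by move=> a ra i j; exact: coef.
Qed.

End SpatialData.

(** * Entries far from the diagonal *)

Lemma block_sum (V : nmodType) (N n : nat -> nat) (F : nat -> V) L :
  N 0%N = 0%N -> (forall l, (N l <= n l < N l.+1)%N) ->
  \sum_(0 <= k < N L | k \in range n) F k = \sum_(0 <= l < L) F (n l).
Proof.
move=> N0 Nn; have Nmono : {homo N : i j / (i <= j)%N}.
  apply: homo_leq => //; first exact: leq_trans.
  by move=> l; have /andP[h1 h2] := Nn l; exact: ltnW (leq_ltn_trans h1 h2).
elim: L => [|L ih]; first by rewrite N0 !big_nil.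
rewrite (@big_cat_nat _ _ _ (N L))//=; last exact: Nmono.
rewrite ih big_nat_recr//=; congr (_ + _).
have /andP[h1 h2] := Nn L.
rewrite big_mkcond (bigD1_seq (n L)) ?mem_index_iota ?h1 ?iota_uniq//=.
rewrite mem_set/=; last by exists L.
rewrite [X in _ + X]big1_seq ?addr0// => k /andP[kn]; rewrite mem_index_iota => /andP[k1 k2].
case: ifPn => // /set_mem [l _ nlk]; exfalso.
have /andP[h3 h4] := Nn l; rewrite nlk in h3 h4.
have [lL|Ll|lL] := ltngtP l L.
- by have := Nmono _ _ lL; rewrite leqNgt (leq_ltn_trans k1).
- by have := Nmono _ _ Ll; rewrite leqNgt (leq_ltn_trans h3).
- by move: kn; rewrite -nlk lL eqxx.
Qed.

(* Schur's theorem that weak null sequences of l^1 are norm null, in the form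
   needed here, by a gliding hump. *)
Lemma gliding_hump (R : realType) (c : nat -> nat -> R[i]) (S : set nat -> nat -> R[i]) :
  (forall k (eps : R), 0 < eps -> exists N, forall A M, (N <= M)%N ->
     rnorm (S A k - \sum_(0 <= n < M | n \in A) c k n) <= eps) ->
  (forall A (eps : R), 0 < eps -> exists K, forall k, (K <= k)%N -> rnorm (S A k) <= eps) ->
  forall eps : R, 0 < eps -> exists K, forall k n, (K <= k)%N -> rnorm (c k n) < eps.
Proof.
move=> tail small eps eps0; apply: contrapT => H.
have e4 : 0 < eps / 4 by rewrite divr_gt0.
have bad K : exists k n, (K <= k)%N /\ eps <= rnorm (c k n).
  apply: contrapT => H'; apply: H; exists K => k n Kk; rewrite ltNge.
  by apply/negP => h; apply: H'; exists k, n.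
have column n k : S [set n] k = c k n.
  apply/eqP; rewrite -subr_eq0 -rnorm_eq0 eq_le rnorm_ge0 andbT.
  apply/ler_addgt0Pr => eta eta0; rewrite add0r; have [N hN] := tail k eta eta0.
  have := hN [set n] (maxn N n.+1) (leq_maxl _ _).
  rewrite big_mkcond (bigD1_seq n) ?mem_index_iota ?leq_maxr ?iota_uniq//=.
  rewrite mem_set// big1 ?addr0// => m mn; case: ifPn => // /set_mem mn'.
  by move: mn; rewrite mn' eqxx.
have step N : exists p : nat * nat * nat, let: (k, n, N') := p in
    [/\ (N <= k)%N, (N <= n < N')%N, eps <= rnorm (c k n),
      \sum_(0 <= m < N) rnorm (c k m) <= eps / 4 &
      forall A, rnorm (S A k - \sum_(0 <= m < N' | m \in A) c k m) <= eps / 4].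
  have N1 : 0 < N%:R + 1 :> R by rewrite ltr_wpDl.
  pose eta := eps / 4 / (N%:R + 1).
  have eta0 : 0 < eta by rewrite divr_gt0.
  have etaN : eta * N%:R <= eps / 4.
    by rewrite /eta mulrAC ler_pdivrMr// ler_wpM2l ?(ltW e4)// lerDl.
  have eta_lt : eta < eps.
    rewrite /eta ltr_pdivrMr// mulrDr mulr1.
    have : 0 <= eps * N%:R by rewrite mulr_ge0// ltW.
    lra.
  have [L0 hL0] : exists L0, forall m k, (m < N)%N -> (L0 <= k)%N -> rnorm (c k m) <= eta.
    apply: eventually_forall_lt => m _; have [K hK] := small [set m] eta eta0.
    by exists K => k Kk; rewrite -column hK.
  have [k [n [kK kn]]] := bad (maxn N L0).
  move: kK; rewrite geq_max => /andP[Nk L0k].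
  have Nn : (N <= n)%N.
    rewrite leqNgt; apply/negP => nN; have := hL0 n k nN L0k; lra.
  have [N' hN'] := tail k _ e4.
  exists (k, n, maxn N' n.+1); split=> //.
  - by rewrite Nn leq_maxr.
  - rewrite (le_trans _ etaN)// mulr_natr -[X in _ *+ X]subn0 -sumr_const_nat.
    by apply: ler_sum_nat => m /andP[_ mN]; exact: hL0.
  - by move=> A; apply: hN'; exact: leq_maxl.
have [st stP] := choice step.
pose N l := iter l (fun N => (st N).2) 0%N.
pose k l := (st (N l)).1.1; pose n l := (st (N l)).1.2.
have P l : [/\ (N l <= k l)%N, (N l <= n l < N l.+1)%N, eps <= rnorm (c (k l) (n l)),
      \sum_(0 <= m < N l) rnorm (c (k l) m) <= eps / 4 &
      forall A, rnorm (S A (k l) - \sum_(0 <= m < N l.+1 | m \in A) c (k l) m) <= eps / 4].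
  by have := stP (N l); rewrite /k /n [N l.+1]/=; case: (st (N l)) => -[].
have Nl l : (l <= N l)%N.
  elim: l => // l ih; have [_ /andP[h1 h2] _ _ _] := P l.
  by rewrite (leq_ltn_trans ih)// (leq_ltn_trans h1).
have [L hL] := small (range n) _ e4.
have [Nk Nn ck before after] := P L.
have := hL (k L) (leq_trans (Nl L) Nk).
have := after (range n); rewrite (@block_sum _ N n)//; last by move=> l; case: (P l).
rewrite big_nat_recr//=.
have : rnorm (\sum_(0 <= l < L) c (k L) (n l)) <= eps / 4.
  rewrite -(@block_sum _ N n)//; last by move=> l; case: (P l).
  apply: le_trans before; rewrite (le_trans (rnorm_sum _ _ _))// big_mkcond.
  by apply: ler_sum => m _; case: ifP; rewrite ?rnorm_ge0.
set a := \sum_(_ <= _ < _) _; set b := c _ _ in ck *; set s := S _ _.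
move=> h1 h2 h3.
have := rnormB s (s - (a + b)); rewrite opprB addrC subrK => h4.
have := rnormB (a + b) a; rewrite addrAC subrr add0r => h5.
lra.
Qed.

Section OffDiagonal.
Variables (R : realType) (E F : completeNormedModType R[i]).
Variables (d del : nat -> nat -> R) (e : nat -> E) (f : nat -> F).
Variables (Phi : (E -> E) -> F -> F) (Psi : (F -> F) -> E -> E) (M : R).
Hypotheses (md : is_metric d) (mdel : is_metric del).
Hypotheses (sbe : schauder_basis e) (sbf : schauder_basis f).
Hypotheses (ue : one_unconditional e) (uf : one_unconditional f).
Hypotheses (ulf : uniformly_locally_finite d) (ms : metric_symmetric d e).
Hypothesis iso : algebra_iso (roe d e) (roe del f) Phi Psi M.
Variables (x : nat -> E) (y : nat -> E -> R[i]).
Hypothesis ly : forall j, scalar (y j).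
Hypothesis y_bounded : forall j, exists2 C : R, 0 <= C & rbounded C (y j).
Hypothesis coef : forall a, roe d e a -> forall i j, biorth f i (Phi a (f j)) = y i (a (x j)).
Local Notation coe := (biorth e).
Local Notation cof := (biorth f).

Lemma roe_off_diagonal a : roe del f a -> forall eps : R, 0 < eps ->
  exists2 r : R, 0 < r & forall i j, r < del i j ->
    rnorm (cof i (a (f j))) * (rnorm (f i) / rnorm (f j)) <= eps.
Proof.
move=> /roeP[ba ha] eps eps0; have [b [bb [r r0 br]] ab] := ha eps eps0.
exists r => // i j rij; have fj := rnorm_e_gt0 sbf j.
rewrite mulrA ler_pdivrMr//.
have := abs_matrix_entry_le sbf uf i j ab.
by rewrite /abs_matrix opBE biorthB// br ?subr0// (Defs.metricC mdel).
Qed.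

Lemma off_diagonal (r eps : R) : 0 < r -> 0 < eps -> exists s : R,
  forall n m, d n m <= r -> forall i j,
    eps <= (rnorm (y i (e n)) * rnorm (f i) / rnorm (e n)) *
           (rnorm (coe m (x j)) * rnorm (e m) / rnorm (f j)) ->
    del i j <= s.
Proof.
move=> r0 eps0.
have [K [A [sg [Asg sgA]]]] := partial_bijection_cover md ulf r0.
suff [L0 hL0] : exists L0, forall c k, (c < K)%N -> (L0 <= k)%N ->
    forall i j m, A c m -> k%:R <= del i j ->
    (rnorm (y i (e (sg c m))) * rnorm (f i) / rnorm (e (sg c m))) *
    (rnorm (coe m (x j)) * rnorm (e m) / rnorm (f j)) < eps.
  exists L0%:R => n m nm i j; rewrite leNgt => h; rewrite leNgt; apply/negP => sij.
  have [c [cK Ac smn]] : exists c, [/\ (c < K)%N, A c m & sg c m = n].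
    by apply: sgA; rewrite (Defs.metricC md).
  have := hL0 c L0 cK (leqnn _) i j m Ac (ltW sij).
  by rewrite smn (negbTE h).
apply: eventually_forall_lt => c _; apply: contrapT => H.
have [bs ds] := Asg c.
have [C C0 [eC trans]] := partial_translation sbe ue ms r0 bs ds.
have bad k : exists p : nat * nat * nat, let: (i, j, m) := p in
    [/\ A c m, k%:R <= del i j &
    eps <= (rnorm (y i (e (sg c m))) * rnorm (f i) / rnorm (e (sg c m))) *
    (rnorm (coe m (x j)) * rnorm (e m) / rnorm (f j))].
  apply: contrapT => H'; apply: H; exists k => l kl i j m Am lij; rewrite ltNge.
  apply/negP => h; apply: H'; exists (i, j, m); split => //.
  by apply: le_trans lij; rewrite ler_nat.
have [p pP] := choice bad.
pose i k := (p k).1.1; pose j k := (p k).1.2; pose m k := (p k).2.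
have {}pP k : [/\ A c (m k), k%:R <= del (i k) (j k) &
    eps <= (rnorm (y (i k) (e (sg c (m k)))) * rnorm (f (i k)) / rnorm (e (sg c (m k)))) *
    (rnorm (coe (m k) (x (j k))) * rnorm (e (m k)) / rnorm (f (j k)))].
  by have := pP k; rewrite /i /j /m; case: (p k) => -[].
pose rho k := rnorm (f (i k)) / rnorm (f (j k)).
have rho0 k : 0 < rho k by rewrite divr_gt0// rnorm_e_gt0.
have hT A' : exists T, [/\ band d e T, rbounded C T &
    forall n, T (e n) = if n \in A' `&` A c then e (sg c n) else 0].
  by apply: trans => n [].
have [T TP] := choice hT.
pose S A' k := (rho k)%:C * y (i k) (T A' (x (j k))).
pose co k n := if n \in A c then
  (rho k)%:C * (coe n (x (j k)) * y (i k) (e (sg c n))) else 0.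
have [|||L hL] := @gliding_hump R co S _ _ (eps / C).
- move=> k eta eta0; have [Cy Cy0 hCy] := y_bounded (i k).
  have Q0 : 0 < rho k * (Cy * C) + 1.
    by rewrite ltr_wpDl// mulr_ge0 ?(ltW (rho0 k))// mulr_ge0// ltW.
  have [|N hN] := @section_tail _ _ e sbe (x (j k)) (eta / (rho k * (Cy * C) + 1)).
    exact: divr_gt0.
  exists N => A' L NL; have [[[lT _] _] bT Te] := TP A'.
  have -> : S A' k - \sum_(0 <= n < L | n \in A') co k n =
      (rho k)%:C * y (i k) (T A' (x (j k) - section e L (coe ^~ (x (j k))))).
    rewrite (linB lT) (scalB (ly (i k))) mulrBr; congr (_ - _).
    rewrite operator_section// (scal_sum (ly (i k))) mulr_sumr big_mkcond.
    apply: eq_bigr => n _; rewrite Te (scalZ (ly (i k))) in_setI /co.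
    by case: ifP => /= _; [case: ifP => // _|];
      rewrite (scal0 (ly (i k))) !mulr0.
  rewrite rnormM rnormR gtr0_norm//.
  apply: (@le_trans _ _ (rho k * (Cy * C * rnorm (x (j k) - section e L (coe ^~ (x (j k))))))).
    rewrite ler_wpM2l ?(ltW (rho0 k))// (le_trans (hCy _))// -mulrA ler_wpM2l//.
  have := hN L NL; rewrite ltr_pdivlMr// => h.
  rewrite mulrA; apply: le_trans (ltW h); rewrite mulrC ler_wpM2l ?rnorm_ge0// lerDl//.
- move=> A' eta eta0; have [bT _ _] := TP A'.
  have rT := band_roe bT.
  have [s s0 hs] := roe_off_diagonal (algebra_iso_in iso rT) eta0.
  exists (Num.bound s).+1 => k sk; rewrite /S -coef// rnormM rnormR gtr0_norm// mulrC.
  apply: hs; have [_ + _] := pP k; apply: lt_le_trans.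
  apply: (lt_le_trans (archi_boundP (ltW s0))); rewrite ler_nat; exact: ltnW.
- exact: divr_gt0.
have := hL L (m L) (leqnn L); have [Am _] := pP L; rewrite /co mem_set//.
rewrite !rnormM rnormR (gtr0_norm (rho0 L)) ltr_pdivlMr// => h1 h2.
have := eC _ Am; set es := rnorm (e (sg c (m L))) in h2 *; set em := rnorm (e (m L)) in h2 *.
have es0 : 0 < es by exact: rnorm_e_gt0.
move: h1 h2; rewrite /rho; set P := rnorm (y _ _); set Q := rnorm (coe _ _).
set fi := rnorm (f _); set fj := rnorm (f _) => h1 h2 h3.
have fj0 : 0 < fj by exact: rnorm_e_gt0.
suff : P * fi / es * (Q * em / fj) <= fi / fj * (Q * P) * C by lra.
have -> : P * fi / es * (Q * em / fj) = (fi / fj * (Q * P)) * (em / es).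
  by field; apply/andP; split; rewrite gt_eqF.
rewrite ler_wpM2l ?ler_pdivrMr// !mulr_ge0 ?invr_ge0 ?rnorm_ge0//.
Qed.

End OffDiagonal.

(** * Rigidity *)

Section Rigidity.
Variables (R : realType) (E : completeNormedModType R[i]) (e : nat -> E).
Variables (d : nat -> nat -> R) (v : nat -> E) (w : nat -> E -> R[i]) (M : R).
Hypotheses (sb : schauder_basis e) (u1 : one_unconditional e).
Hypotheses (md : is_metric d) (ulf : uniformly_locally_finite d).
Hypothesis ms : metric_symmetric d e.
Local Notation co := (biorth e).
Local Notation sec := (section e).
Local Notation proj N x := (section e N (biorth e ^~ x)).

Hypothesis lw : forall n, scalar (w n).
Hypothesis wv : forall n, w n (v n) = 1.
Hypothesis M0 : 0 <= M.
Hypothesis sumM : forall (A : set nat) N,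
  rbounded M (fun z => \sum_(0 <= n < N | n \in A) w n z *: v n).
Hypothesis tail_small : forall n (eps : R), 0 < eps ->
  exists K, forall N y, (K <= N)%N ->
    rnorm (v n - proj N (v n)) * rnorm (w n y) <= eps * rnorm y /\
    rnorm (v n) * rnorm (w n (y - proj N y)) <= eps * rnorm y.
Hypothesis head_small : forall N (eps : R), 0 < eps ->
  exists n0, forall n y, (n0 <= n)%N ->
    rnorm (proj N (v n)) * rnorm (w n y) <= eps * rnorm y /\
    rnorm (v n) * rnorm (w n (proj N y)) <= eps * rnorm y.
Hypothesis subseries : forall A : set nat, exists a : E -> E,
  [/\ bounded_op E a,
    forall i j (eps : R), 0 < eps -> exists L0, forall L, (L0 <= L)%N ->
      rnorm (co i (a (e j)) - \sum_(0 <= n < L | n \in A) co i (v n) * w n (e j)) <= eps &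
    regular e a -> regular_roe d e a].

Lemma v_gt0 n : 0 < rnorm (v n).
Proof.
rewrite rnorm_gt0; apply/eqP => v0; have := wv n.
by rewrite v0 (scal0 (lw n)) => /eqP; rewrite eq_sym oner_eq0.
Qed.

Lemma w_bounded n y : rnorm (w n y) * rnorm (v n) <= M * rnorm y.
Proof.
have := @sumM [set n] n.+1 y; rewrite big_mkcond (bigD1_seq n) ?mem_index_iota ?leqnn ?iota_uniq//=.
rewrite mem_set// big1 ?addr0 ?rnormZ// => m mn; case: ifPn => // /set_mem mn'.
by move: mn; rewrite mn' eqxx.
Qed.

Definition normalized_entry n i j : R :=
  rnorm (co i (v n)) * rnorm (w n (e j)) * (rnorm (e i) / rnorm (e j)).

Lemma normalized_entry_neq0 n : exists i j, 0 < normalized_entry n i j.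
Proof.
have [i vi] : exists i, co i (v n) != 0.
  apply: contrapT => H; have := v_gt0 n; rewrite rnorm_gt0 => /eqP; apply.
  apply: (biorth_inj sb) => i; rewrite (scal0 (biorth_is_scalar sb i)).
  by apply/eqP; apply: contrapT => h; apply: H; exists i; apply/negP.
have wC : rbounded (M / rnorm (v n)) (w n).
  by move=> y; rewrite mulrAC ler_pdivlMr ?v_gt0// w_bounded.
have [j wj] : exists j, w n (e j) != 0.
  apply: contrapT => H; have := wv n => /eqP; rewrite (_ : w n (v n) = 0) ?(eq_sym 0) ?oner_eq0//.
  apply: rnorm_eq0P => eps eps0.
  apply: (functional_limit_le (N := 0) (lw n) wC (section_cvg sb (v n))) => N _.
  rewrite functional_section// big1 ?rnorm0 ?ltW// => j _.
  have -> : w n (e j) = 0; last by rewrite mulr0.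
  by apply/eqP; apply: contrapT => h; apply: H; exists j; apply/negP.
exists i, j; rewrite /normalized_entry !mulr_gt0 ?rnorm_gt0 ?invr_gt0 ?rnorm_gt0//;
  exact: e_neq0.
Qed.

Lemma rank_one_error (v0 : E) (w0 : E -> R[i]) (C : R) : 0 <= C -> scalar w0 ->
  (forall y, rnorm v0 * rnorm (w0 y) <= C * rnorm y) ->
  matrix_bounded e C (fun i j => rnorm (co i v0) * rnorm (w0 (e j))).
Proof.
move=> C0 lw0 h; apply: matrix_bounded_rank_one => [N x x0|j]; last exact: rnorm_ge0.
have := functional_section_abs u1 N lw0 (s := rnorm v0) (C := C) _ C0 x0.
move=> /(_ _)-H; apply: le_trans (H _); last by move=> y; rewrite mulrC.
rewrite ler_wpM2l ?sumr_ge0//; first by move=> j _; rewrite mulr_ge0 ?rnorm_ge0.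
by rewrite -(rsec_norm u1) section_le.
Qed.

Section Blocks.
Variables (N n : nat -> nat) (eta : R).
Hypotheses (eta0 : 0 < eta) (N0 : N 0%N = 0%N) (Nn : forall l, (N l <= n l < N l.+1)%N).
Let al l i := rnorm (co i (v (n l))).
Let be l j := rnorm (w (n l) (e j)).
Let inI l i := (N l <= i < N l.+1)%N.
Let Q l y := proj (N l.+1) y - proj (N l) y.
Let ep l : R := eta / 4 * 2%:R ^- l.+1.
Hypothesis Qv : forall l y,
  rnorm (v (n l) - Q l (v (n l))) * rnorm (w (n l) y) <= 2 * ep l * rnorm y.
Hypothesis Qw : forall l y,
  rnorm (v (n l)) * rnorm (w (n l) (y - Q l y)) <= 2 * ep l * rnorm y.

Let Nmono : {homo N : i j / (i <= j)%N}.
Proof.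
apply: homo_leq => //; first exact: leq_trans.
by move=> l; have /andP[h1 h2] := Nn l; exact: ltnW (leq_ltn_trans h1 h2).
Qed.

Let Nl l : (l <= N l)%N.
Proof.
elim: l => // l ih; have /andP[h1 h2] := Nn l.
by rewrite (leq_ltn_trans ih)// (leq_ltn_trans h1).
Qed.

Let inI_inj l l' i : inI l i -> inI l' i -> l = l'.
Proof.
move=> /andP[h1 h2] /andP[h3 h4]; have [lL|Ll|//] := ltngtP l l'.
- by have := Nmono lL; rewrite leqNgt (leq_ltn_trans h3).
- by have := Nmono Ll; rewrite leqNgt (leq_ltn_trans h1).
Qed.

Let inI_ex i : exists l, inI l i.
Proof.
elim: i => [|i [l /andP[h1 h2]]].
  by exists 0%N; rewrite /inI N0 (leq_ltn_trans _ (andP (Nn 0)).2).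
have [h|h] := ltnP i.+1 (N l.+1); first by exists l; rewrite /inI h (leq_trans h1).
exists l.+1; rewrite /inI h /=; have /andP[h3 h4] := Nn l.+1.
by rewrite (leq_ltn_trans _ (leq_ltn_trans h3 h4)).
Qed.

Let ep0 l : 0 < ep l.
Proof. by rewrite /ep mulr_gt0 ?divr_gt0// invr_gt0 exprn_gt0. Qed.

Lemma biorth_block l y i : co i (Q l y) = if inI l i then co i y else 0.
Proof.
rewrite /Q biorthB// !biorth_section// /inI; have := Nmono (leqnSn l).
case: (leqP (N l) i) => [h _|h1 h2]; first by rewrite subr0.
by rewrite (leq_trans h1 h2) subrr.
Qed.

Let err l i j := (if inI l i then 0 else al l i) * be l j +
                 al l i * (if inI l j then 0 else be l j).

Let err_ge0 l i j : 0 <= err l i j.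
Proof.
by rewrite /err addr_ge0// mulr_ge0 ?rnorm_ge0//; case: ifP => //; rewrite rnorm_ge0.
Qed.

Let err_ge l i j : ~~ (inI l i && inI l j) -> al l i * be l j <= err l i j.
Proof.
rewrite negb_and /err => /orP[/negbTE ->|/negbTE ->].
  by rewrite lerDl mulr_ge0 ?rnorm_ge0//; case: ifP => //; rewrite rnorm_ge0.
by rewrite lerDr mulr_ge0 ?rnorm_ge0//; case: ifP => //; rewrite rnorm_ge0.
Qed.

Let err_bounded l : matrix_bounded e (4 * ep l) (err l).
Proof.
have -> : 4 * ep l = 2 * ep l + 2 * ep l by lra.
have e2 : 0 <= 2 * ep l by rewrite mulr_ge0// ltW.
have := matrix_boundedD u1 (rank_one_error e2 (lw (n l)) (Qv l)) _.
move/(_ (2 * ep l) (fun i j => al l i * (if inI l j then 0 else be l j))).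
have -> : (fun i j => rnorm (co i (v (n l) - Q l (v (n l)))) * rnorm (w (n l) (e j)) +
    al l i * (if inI l j then 0 else be l j)) = err l.
  apply/funext => i; apply/funext => j; rewrite /err biorthB// biorth_block.
  by case: ifP => _; rewrite ?subrr ?rnorm0// subr0.
apply; have lw' : scalar (fun y => w (n l) (y - Q l y)).
  move=> c x y; rewrite -(lw (n l)); congr (w _ _); apply: (biorth_inj sb) => i.
  rewrite [LHS]biorthB// biorth_block !biorth_lin//.
  rewrite [co i (x - _)]biorthB// [co i (y - _)]biorthB// !biorth_block.
  by case: ifP => _; ring.
have := rank_one_error e2 lw' (Qw l); congr matrix_bounded.
apply/funext => i; apply/funext => j; congr (_ * _).
suff -> : e j - Q l (e j) = if inI l j then 0 else e j.
  by case: ifP => //; rewrite (scal0 (lw (n l))) rnorm0.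
apply: (biorth_inj sb) => k; rewrite biorthB// biorth_block biorth_e//.
have [->|kj] := eqVneq k j.
  by case: ifP => _; rewrite ?subrr ?subr0 ?(scal0 (biorth_is_scalar sb j))// biorth_e// eqxx.
have -> : co k (if inI l j then 0 else e j) = 0.
  by case: ifP => _; rewrite ?(scal0 (biorth_is_scalar sb k))// biorth_e// (negbTE kj).
by rewrite if_same subrr.
Qed.

Let errs L i j := \sum_(0 <= l < L) err l i j.

Let errs_ge0 L i j : 0 <= errs L i j.
Proof. by rewrite sumr_ge0// => l _; exact: err_ge0. Qed.

Let errs_bounded L : matrix_bounded e eta (errs L).
Proof.
have := @matrix_bounded_sum _ _ _ u1 L (fun l => 4 * ep l) err (fun l _ => err_bounded l).
apply: matrix_bounded_wpM.
suff -> : \sum_(0 <= l < L) 4 * ep l = eta - eta * 2%:R ^- L.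
  by rewrite lerBlDr lerDl mulr_ge0 ?(ltW eta0)// invr_ge0 exprn_ge0.
elim: L => [|L ih]; first by rewrite big_nil expr0 invr1 mulr1 subrr.
rewrite big_nat_recr//= ih /ep.
have -> : 2%:R ^- L = 2 * 2%:R ^- L.+1 :> R by rewrite exprS invfM mulrA divff// mul1r.
by field; rewrite expf_neq0.
Qed.

Let c l i j := co i (v (n l)) * w (n l) (e j).

Let cE l i j : rnorm (c l i j) = al l i * be l j.
Proof. by rewrite rnormM. Qed.

Let diag_blocks L i j := \sum_(0 <= l < L) if inI l i && inI l j then al l i * be l j else 0.

Let sum_diag_le L i j (F : nat -> R[i]) :
  (forall l, (l < L)%N -> rnorm (F l) <= err l i j) ->
  rnorm (\sum_(0 <= l < L) F l) <= errs L i j.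
Proof.
move=> h; rewrite (le_trans (rnorm_sum _ _ _))//.
by apply: ler_sum_nat => l /andP[_ lL]; exact: h.
Qed.

(* Unimodular multipliers on the blocks turn the partial sum, up to the
   off-block error, into its entrywise absolute value. *)
Let diag_blocks_bounded L : matrix_bounded e (M + eta) (diag_blocks L).
Proof.
have [blk blkP] := choice inI_ex.
have [D1 D1P] := choice (fun i => sgnC (co i (v (n (blk i))))).
have [D2 D2P] := choice (fun j => sgnC (w (n (blk j)) (e j))).
move=> K x x0.
pose z j := D2 j * (x j)%:C.
have zx : rnorm (sec K z) = rsec e K x.
  rewrite (rsec_norm u1); apply: eq_rsec => j _.
  by rewrite /z rnormM; have [_ ->] := D2P j; rewrite mul1r rnormR ger0_norm.
pose g i := \sum_(0 <= j < K) (\sum_(0 <= l < L) c l i j) * z j.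
pose h i := \sum_(0 <= j < K) (\sum_(0 <= l < L)
  if inI l i && inI l j then 0 else c l i j) * z j.
have gE i : g i = co i (\sum_(0 <= k < N L | k \in range n) w k (sec K z) *: v k).
  rewrite (block_sum (fun k => w k (sec K z) *: v k) L N0 Nn).
  rewrite (scal_sum (biorth_is_scalar sb i)) /g.
  under eq_bigr do rewrite mulr_suml.
  rewrite exchange_big /=; apply: eq_bigr => l _.
  rewrite biorthZ// functional_section// mulr_suml; apply: eq_bigr => j _.
  by rewrite /c; ring.
have g_le : rnorm (sec K g) <= M * rsec e K x.
  rewrite -zx; apply: le_trans (sumM (range n) (N L) (sec K z)).
  have -> : g = co ^~ (\sum_(0 <= k < N L | k \in range n) w k (sec K z) *: v k).
    by apply/funext => i; rewrite gE.
  exact: section_le.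
have h_le : rnorm (sec K h) <= eta * rsec e K x.
  apply: le_trans (@errs_bounded L K x x0); rewrite (rsec_norm u1).
  apply: (rsec_mono_nneg u1) => i _; rewrite rnorm_ge0 /=.
  rewrite (le_trans (rnorm_sum _ _ _))//; apply: ler_sum => j _.
  rewrite rnormM /z rnormM; have [_ ->] := D2P j.
  rewrite mul1r rnormR (ger0_norm (x0 j)) ler_wpM2r//.
  apply: sum_diag_le => l _; case: ifPn => hl; first by rewrite rnorm0.
  by rewrite cE err_ge.
rewrite mulrDl; apply: le_trans (lerD g_le h_le); apply: le_trans (rnormB _ _).
apply: (@le_trans _ _ (rnorm (sec K (fun i => D1 i * (g i - h i))))); last first.
  rewrite -[sec K g - _]addrC -scaleN1r -section_linear; apply: (section_mono u1) => i _.
  by rewrite rnormM; have [_ ->] := D1P i; rewrite mul1r mulN1r addrC.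
rewrite le_eqVlt; apply/orP; left; apply/eqP; congr rnorm; apply: eq_section => i _.
rewrite rmorph_sum /g /h -sumrB mulr_sumr; apply: eq_bigr => j _.
rewrite -mulrBl -sumrB /= -realCM /diag_blocks rmorph_sum /= !mulr_suml mulr_sumr.
apply: eq_bigr => l _; case: ifPn => hl; last by rewrite subrr !mul0r mulr0.
rewrite subr0 /z /c; case/andP: hl => hi hj.
have li : blk i = l by exact: inI_inj (blkP i) hi.
have lj : blk j = l by exact: inI_inj (blkP j) hj.
have [Di _] := D1P i; have [Dj _] := D2P j; rewrite li in Di; rewrite lj in Dj.
rewrite -realCM /al /be -!rnormE -Di -Dj; ring.
Qed.

Let partial_sum_bounded L :
  matrix_bounded e (M + 2 * eta) (fun i j => rnorm (\sum_(0 <= l < L) c l i j)).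
Proof.
have -> : M + 2 * eta = M + eta + eta by lra.
apply: (matrix_bounded_le u1 _ (matrix_boundedD u1 (@diag_blocks_bounded L) (@errs_bounded L))).
move=> i j; rewrite rnorm_ge0 /= (le_trans (rnorm_sum _ _ _))//.
rewrite -big_split /=; apply: ler_sum => l _; rewrite cE.
by case: ifPn => hl; [rewrite lerDl err_ge0|rewrite add0r err_ge].
Qed.

Lemma block_rigidity : eta = (16 * (M + 1))^-1 ->
  (forall l i j, normalized_entry (n l) i j < l.+1%:R^-1) -> False.
Proof.
move=> etaE small; have [M_ge0 eta_gt0] := (M0, eta0).
have etaM : M * (2 * eta) <= 1 / 8.
  rewrite etaE invfM; have M1 : 0 < M + 1 by rewrite ltr_wpDl.
  have -> : M * (2 * (16^-1 * (M + 1)^-1)) = M / 8 / (M + 1) by field; rewrite gt_eqF.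
  by rewrite ler_pdivrMr//; lra.
have eta1 : eta <= 1.
  have h16 : 0 < 16 * (M + 1) by lra.
  by rewrite etaE invf_le1//; lra.
have [a [ba aL areg]] := subseries (range n).
have aL' i j (eps : R) : 0 < eps -> exists L0, forall L, (L0 <= L)%N ->
    rnorm (co i (a (e j)) - \sum_(0 <= l < L) c l i j) <= eps.
  move=> eps0; have [L0 hL0] := aL i j eps eps0; exists L0 => L LL.
  have := hL0 (N L) (leq_trans LL (Nl L)).
  by rewrite (block_sum (fun k => co i (v k) * w k (e j)) L N0 Nn).
have aLu K (eps : R) : 0 < eps -> exists L0, forall i j L, (i < K)%N -> (j < K)%N -> (L0 <= L)%N ->
    rnorm (co i (a (e j)) - \sum_(0 <= l < L) c l i j) <= eps.
  move=> eps0.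
  have [|L0 hL0] := @eventually_forall_lt (fun i L => forall j, (j < K)%N ->
    rnorm (co i (a (e j)) - \sum_(0 <= l < L) c l i j) <= eps) K.
    move=> i _; have [|L0 hL0] := @eventually_forall_lt (fun j L =>
      rnorm (co i (a (e j)) - \sum_(0 <= l < L) c l i j) <= eps) K.
      by move=> j _; exact: aL'.
    by exists L0 => L LL j jK; exact: hL0.
  by exists L0 => i j L iK jK LL; exact: hL0.
have /areg ra : regular e a.
  apply: (matrix_bounded_regular sb u1 (C := M + 2 * eta)) => //; first by lra.
  apply: (matrix_bounded_approx u1) => [i j|K eps eps0]; first exact: rnorm_ge0.
  have [L0 hL0] := aLu K eps eps0; exists (fun i j => rnorm (\sum_(0 <= l < L0) c l i j)).
  split; first exact: partial_sum_bounded.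
  move=> i j iK jK; have := hL0 i j L0 iK jK (leqnn _); rewrite /abs_matrix.
  have := rnormD (co i (a (e j)) - \sum_(0 <= l < L0) c l i j) (\sum_(0 <= l < L0) c l i j).
  by rewrite subrK; lra.
have [b [bb [r r0 hr]] ab] := regular_roe_approx sb u1 md ulf ms ra eta0.
have [C C0 hC] := band_matrix_bounded sb u1 md ulf ms r0.
pose l := Num.bound (8 * (M * C)).
have lC : M * (C * l.+1%:R^-1) < 1 / 8.
  rewrite mulrA ltr_pdivrMr ?ltr0Sn//.
  have MC0 : 0 <= 8 * (M * C) by rewrite !mulr_ge0// ltW.
  have := archi_boundP MC0; rewrite -/l -[l.+1]addn1 natrD; lra.
pose kin i j := if d i j <= r then al l i * be l j else 0.
pose koff i j := if [&& inI l i, inI l j & r < d i j] then al l i * be l j else 0.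
have kin_bounded : matrix_bounded e (C * l.+1%:R^-1) kin.
  apply: hC => //.
  - by move=> i j; rewrite /kin; case: ifP => // _; rewrite mulr_ge0 ?rnorm_ge0.
  - move=> i j; rewrite /kin; case: ifP => _; last first.
      by rewrite mul0r mulr_ge0 ?invr_ge0 ?rnorm_ge0.
    have := ltW (small l i j); rewrite /normalized_entry mulrA ler_pdivrMr//.
    exact: rnorm_e_gt0.
  - by move=> i j rij; rewrite /kin leNgt rij.
have koff_bounded : matrix_bounded e (eta + eta) koff.
  apply: (matrix_bounded_approx u1) => [i j|K eps eps0].
    by rewrite /koff; case: ifP => // _; rewrite mulr_ge0 ?rnorm_ge0.
  have [L0 hL0] := aLu K eps eps0; pose L := maxn L0 l.+1.
  have lL : (l < L)%N by rewrite leq_maxr.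
  exists (fun i j => rnorm (co i (a (e j)) - co i (b (e j))) + errs L i j).
  split; first exact: matrix_boundedD.
  move=> i j iK jK; rewrite /koff; case: ifPn => [/and3P[Ii Ij rij]|_]; last first.
    by rewrite !addr_ge0 ?rnorm_ge0 ?errs_ge0// ltW.
  have -> : co i (b (e j)) = 0 by apply: hr; rewrite (Defs.metricC md).
  rewrite subr0.
  have := hL0 i j L iK jK (leq_maxl _ _).
  have -> : \sum_(0 <= k < L) c k i j =
      c l i j + \sum_(0 <= k < L) (if k == l then 0 else c k i j).
    rewrite (bigD1_seq l) ?mem_index_iota ?iota_uniq//=; congr (_ + _).
    rewrite [in RHS](bigD1_seq l) ?mem_index_iota ?iota_uniq//= eqxx add0r.
    by apply: eq_bigr => k /negbTE ->.
  set s := \sum_(_ <= _ < _) _ => h1.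
  have h2 : rnorm s <= errs L i j.
    apply: sum_diag_le => k _; case: eqVneq => [_|kl]; first by rewrite rnorm0.
    rewrite cE err_ge//; apply/negP => /andP[Ik _].
    by move: kl; rewrite (inI_inj Ik Ii) eqxx.
  rewrite -cE; set A := co i _ in h1 *.
  have := rnormB (A - s) (A - (c l i j + s)).
  have -> : A - s - (A - (c l i j + s)) = c l i j by ring.
  have := rnormB A s; lra.
pose K := N l.+1; pose v' := v (n l); pose w' := w (n l).
pose s := \sum_(0 <= i < K) if inI l i then be l i * al l i else 0.
have s_ge : 1 / 2 <= s.
  have h1 : rnorm (w' (v' - Q l v')) <= 2 * ep l.
    by have := Qw l v'; rewrite mulrC ler_pM2r// v_gt0.
  have ep_le : 2 * ep l <= 1 / 2.
    have : 2%:R ^- l.+1 <= 1 :> R by rewrite invf_le1 ?exprn_gt0// exprn_ege1// ler1n.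
    have := exprn_gt0 l.+1 (ltr0Sn R 1); rewrite -invr_gt0 /ep; nra.
  have w1 : w' v' = 1 by exact: wv.
  rewrite (scalB (lw (n l) : scalar w')) w1 in h1.
  have h2 : rnorm (w' (Q l v')) <= s.
    have -> : Q l v' = sec K (fun i => if inI l i then co i v' else 0).
      apply: (biorth_inj sb) => i; rewrite biorth_block biorth_section//.
      by case: ifPn => //; [rewrite /inI => /andP[_ ->]|rewrite if_same].
    rewrite (@functional_section _ _ e w' _ _ (lw (n l))).
    rewrite (le_trans (rnorm_sum _ _ _))//.
    apply: ler_sum => i _; case: ifP => _; last by rewrite mul0r rnorm0.
    by rewrite rnormM mulrC.
  have := rnormD (1 - w' (Q l v')) (w' (Q l v')); rewrite subrK rnorm1; lra.
pose g i := \sum_(0 <= j < K) (kin i j + koff i j) * al l j.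
have al0 j : 0 <= al l j by exact: rnorm_ge0.
have be0 j : 0 <= be l j by exact: rnorm_ge0.
have k0 i j : 0 <= kin i j + koff i j.
  by rewrite addr_ge0// /kin /koff; case: ifP => // _; rewrite mulr_ge0.
have g0 i : 0 <= g i by rewrite sumr_ge0// => j _; rewrite mulr_ge0.
have ss : s * s <= \sum_(0 <= i < K) be l i * g i.
  rewrite {1}/s mulr_suml; apply: ler_sum => i _.
  case: ifPn => Ii; last by rewrite mul0r mulr_ge0.
  rewrite -mulrA ler_wpM2l// /s /g mulr_sumr; apply: ler_sum => j _.
  case: ifPn => Ij; last by rewrite mulr0 mulr_ge0.
  rewrite mulrA ler_wpM2r//= /kin /koff Ii Ij /=.
  by case: (leP (d i j) r) => _; rewrite ?addr0 ?add0r.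
have wC y : rnorm (w' y) * rnorm v' <= M * rnorm y by exact: w_bounded.
have h1 := functional_section_abs u1 K (lw (n l)) wC M0 g0.
have h2 := @matrix_boundedD _ _ _ u1 _ _ _ _ kin_bounded koff_bounded K (al l) al0.
have h3 : rsec e K (al l) <= rnorm v' by rewrite -(rsec_norm u1) section_le.
have v0 : 0 < rnorm v' by exact: v_gt0.
set D := C * _ + _ in h2.
have D0 : 0 <= D.
  by rewrite /D addr_ge0 ?mulr_ge0 ?invr_ge0 ?(ltW C0)//; lra.
have : (\sum_(0 <= i < K) be l i * g i) * rnorm v' <= (M * D) * rnorm v'.
  apply: (le_trans h1); rewrite -mulrA ler_wpM2l//.
  by apply: (le_trans h2); rewrite ler_wpM2l.
rewrite ler_pM2r// /D mulrDr => h4.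
have s4 : 1 / 4 <= s * s by rewrite (_ : 1 / 4 = 1 / 2 * (1 / 2)) ?ler_pM//; lra.
have := le_trans s4 (le_trans ss h4).
rewrite (_ : eta + eta = 2 * eta); last by lra.
move: lC etaM; set p := M * (C * _); set q := M * (2 * eta); lra.
Qed.

End Blocks.

Lemma rigidity : exists2 dl : R, 0 < dl & forall n, exists i j, dl <= normalized_entry n i j.
Proof.
apply: contrapT => H.
have bad0 (dl : R) : 0 < dl -> exists n, forall i j, normalized_entry n i j < dl.
  move=> dl0; apply: contrapT => H'; apply: H; exists dl => // n.
  apply: contrapT => H''; apply: H'; exists n => i j; rewrite ltNge; apply/negP => h.
  by apply: H''; exists i, j.
have bad (dl : R) N : 0 < dl -> exists2 n, (N <= n)%N & forall i j, normalized_entry n i j < dl.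
  move=> dl0.
  have [|L0 hL0] := @eventually_forall_lt (fun n L => exists i j,
    L.+1%:R^-1 <= normalized_entry n i j) N.
    move=> n _; have [i [j ij]] := normalized_entry_neq0 n.
    exists (Num.bound (normalized_entry n i j)^-1) => L LL; exists i, j.
    rewrite -[leRHS]invrK lef_pV2 ?posrE ?invr_gt0//.
    rewrite -invr_gt0 in ij; rewrite (le_trans (ltW (archi_boundP (ltW ij))))// ler_nat.
    exact: leqW.
  have [|n hn] := bad0 (Num.min dl L0.+1%:R^-1); first by rewrite lt_min dl0 invr_gt0 ltr0Sn.
  exists n; last by move=> i j; have := hn i j; rewrite lt_min => /andP[].
  rewrite leqNgt; apply/negP => nN; have [i [j]] := hL0 n L0 nN (leqnn _).
  by have := hn i j; rewrite lt_min => /andP[_ h]; rewrite leNgt h.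
pose eta : R := (16 * (M + 1))^-1.
have eta0 : 0 < eta by rewrite invr_gt0 mulr_gt0// ltr_wpDl.
pose ep l : R := eta / 4 * 2%:R ^- l.+1.
have ep0 l : 0 < ep l by rewrite /ep mulr_gt0 ?divr_gt0// invr_gt0 exprn_gt0.
pose Qp (N N' : nat) y := proj N' y - proj N y.
have step (lN : nat * nat) : exists p : nat * nat, let: (n, N') := p in
  [/\ (lN.2 <= n < N')%N, forall i j, normalized_entry n i j < lN.1.+1%:R^-1,
    forall y, rnorm (v n - Qp lN.2 N' (v n)) * rnorm (w n y) <= 2 * ep lN.1 * rnorm y &
    forall y, rnorm (v n) * rnorm (w n (y - Qp lN.2 N' y)) <= 2 * ep lN.1 * rnorm y].
  case: lN => l N /=; have [n0 hn0] := head_small N (ep0 l).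
  have [|n nN hn] := bad (l.+1%:R^-1) (maxn N n0); first by rewrite invr_gt0 ltr0Sn.
  move: nN; rewrite geq_max => /andP[Nn n0n].
  have [K hK] := tail_small n (ep0 l).
  exists (n, maxn K n.+1); split => //; first by rewrite Nn leq_maxr.
  - move=> y; have [h1 _] := hn0 n y n0n.
    have [h2 _] := hK (maxn K n.+1) y (leq_maxl _ _).
    rewrite /Qp opprB addrCA -mulrA mulrDl mul1r.
    apply: le_trans (lerD h1 h2); rewrite -mulrDl ler_wpM2r ?rnorm_ge0//.
    exact: rnormD.
  - move=> y; have [_ h1] := hn0 n y n0n.
    have [_ h2] := hK (maxn K n.+1) y (leq_maxl _ _).
    rewrite /Qp opprB addrCA (scalD (lw n)) -mulrA mulrDl mul1r.
    apply: le_trans (lerD h1 h2); rewrite -mulrDr ler_wpM2l ?rnorm_ge0//.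
    exact: rnormD.
have [st stP] := choice step.
pose NN := fix NN l := if l is l'.+1 then (st (l', NN l')).2 else 0%N.
pose n l := (st (l, NN l)).1.
have P l : [/\ (NN l <= n l < NN l.+1)%N, forall i j, normalized_entry (n l) i j < l.+1%:R^-1,
    forall y, rnorm (v (n l) - Qp (NN l) (NN l.+1) (v (n l))) * rnorm (w (n l) y) <= 2 * ep l * rnorm y &
    forall y, rnorm (v (n l)) * rnorm (w (n l) (y - Qp (NN l) (NN l.+1) y)) <= 2 * ep l * rnorm y].
  by have := stP (l, NN l); rewrite /n /=; case: (st (l, NN l)).
apply: (@block_rigidity NN n eta eta0) => //; by [move=> l; case: (P l)|move=> l i j; case: (P l)].
Qed.

End Rigidity.

(** * From matrices to coarse maps *)

Section CoarseEquivalence.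
Variables (R : realType) (d del : nat -> nat -> R) (U V : nat -> nat -> R) (M : R).

Lemma coarse_of_matrices (dl : R) (g h : nat -> nat) :
  is_metric d -> is_metric del -> 0 < dl -> 0 < M ->
  (forall i n, 0 <= U i n) -> (forall n i, 0 <= V n i) ->
  (forall i n m j, U i n * V m j <= M) ->
  (forall n, dl <= U (g n) n * V n (h n)) ->
  (forall r eps : R, 0 < r -> 0 < eps -> exists s, forall n m, d n m <= r ->
     forall i j, eps <= U i n * V m j -> del i j <= s) ->
  coarse d del g.
Proof.
move=> md mdel dl0 M0 U0 V0 UV gh od r r0.
have e1 : 0 < dl * dl / M by rewrite divr_gt0// mulr_gt0.
have [s hs] := od r _ r0 e1; have [s0 hs0] := od 1 dl ltr01 dl0.
exists (`|s| + `|s0| + 1); first by rewrite ltr_wpDl// addr_ge0.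
move=> n m nm.
have h1 : del (g n) (h m) <= s.
  apply: (hs n m (ltW nm)); rewrite ler_pdivrMr//.
  apply: (@le_trans _ _ ((U (g n) n * V m (h m)) * (U (g m) m * V n (h n)))).
    rewrite (_ : _ * _ * _ = (U (g n) n * V n (h n)) * (U (g m) m * V m (h m))); last by ring.
    by apply: ler_pM => //; exact: ltW.
  by rewrite ler_wpM2l// mulr_ge0.
have h2 : del (g m) (h m) <= s0.
  by apply: (hs0 m m) => //; rewrite (metric_refl md).
have h3 := Defs.metric_triangle mdel (g n) (h m) (g m).
have h4 := Defs.metricC mdel (h m) (g m).
have := ler_norm s; have := ler_norm s0; lra.
Qed.

Lemma close_of_matrices (dl dl' : R) (g h g' h' : nat -> nat) :
  is_metric del -> 0 < dl -> 0 < dl' -> 0 < M ->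
  (forall i n, 0 <= U i n) -> (forall n i, 0 <= V n i) ->
  (forall i n m j, U i n * V m j <= M) ->
  (forall n, dl <= U (g n) n * V n (h n)) ->
  (forall i, dl' <= V (g' i) i * U i (h' i)) ->
  (forall r eps : R, 0 < r -> 0 < eps -> exists s, forall i j, del i j <= r ->
     forall n m, eps <= V n i * U j m -> d n m <= s) ->
  exists s, forall n, d (g' (g n)) n <= s.
Proof.
move=> mdel dl0 dl0' M0 U0 V0 UV gh gh' od.
have e1 : 0 < dl * dl' / M by rewrite divr_gt0// mulr_gt0.
have [s hs] := od 1 _ ltr01 e1; exists s => n; set i := g n.
apply: (hs i i); first by rewrite (metric_refl mdel).
rewrite ler_pdivrMr//.
apply: (@le_trans _ _ ((V (g' i) i * U i n) * (U i (h' i) * V n (h n)))).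
  rewrite (_ : _ * _ * _ = (U i n * V n (h n)) * (V (g' i) i * U i (h' i))); last by ring.
  by apply: ler_pM; [exact: ltW|exact: ltW|exact: gh|exact: gh'].
by rewrite ler_wpM2l// mulr_ge0.
Qed.

End CoarseEquivalence.

Lemma coarsely_equivalent_of_quasi_inverse (R : realType) (d del : nat -> nat -> R)
    (g g' : nat -> nat) (s1 s2 : R) :
  is_metric d -> is_metric del -> coarse d del g -> coarse del d g' ->
  (forall n, d (g' (g n)) n <= s1) -> (forall i, del (g (g' i)) i <= s2) ->
  coarsely_equivalent d del.
Proof.
move=> md mdel cg cg' h1 h2; exists g; split; [split=> //|].
- move=> s s0; have [|t t0 ht] := cg' (s + 1); first by lra.
  exists (2 * `|s1| + t); first by rewrite ltr_wpDl// mulr_ge0.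
  move=> n m nm; rewrite ltNge; apply/negP => gnm.
  have := ht (g n) (g m) _; rewrite (le_lt_trans gnm) ?ltrDl// => /(_ isT) h.
  have a1 := h1 n; have a2 := h1 m; have := ler_norm s1.
  have a3 := Defs.metric_triangle md n (g' (g n)) m.
  have a4 := Defs.metric_triangle md (g' (g n)) (g' (g m)) m.
  have a5 := Defs.metricC md n (g' (g n)); lra.
- exists s2 => i; apply: (@le_trans _ _ (del i (g (g' i)))).
    apply: ge_inf; last by exists (g' i).
    by exists 0 => _ [n _ <-]; exact: metric_ge0.
  by rewrite (Defs.metricC mdel).
Qed.

Section RowTail.
Variables (R : realType) (E : completeNormedModType R[i]) (e : nat -> E).
Variable d : nat -> nat -> R.
Hypotheses (sb : schauder_basis e) (u1 : one_unconditional e).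
Hypotheses (md : is_metric d) (ulf : uniformly_locally_finite d).
Local Notation co := (biorth e).

Lemma ball_bounded (r : R) m : 0 < r -> exists K, forall j, d m j <= r -> (j < K)%N.
Proof.
move=> r0; have [K hK] := ulf r0.
have fin : finite_set [set y | d m y <= r] by apply/finite_set_leP; exists K.
exists (\max_(k <- finmap.enum_fset (fset_set [set y | d m y <= r])) k).+1 => j mj; rewrite ltnS.
by apply: leq_bigmax_seq; rewrite // in_fset_set// inE.
Qed.

Lemma functional_eq0 (y : E -> R[i]) (C : R) z : scalar y -> rbounded C y ->
  (forall j, co j z * y (e j) = 0) -> y z = 0.
Proof.
move=> ly bY h; apply: rnorm_eq0P => eps eps0.
apply: (functional_limit_le (N := 0) ly bY (section_cvg sb z)) => N _.
by rewrite functional_section// big1 ?rnorm0 ?ltW.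
Qed.

Lemma row_tail (p : E -> E) m (eps : R) : roe d e p -> 0 < eps ->
  exists K, forall N y, (K <= N)%N ->
    rnorm (co m (p (y - section e N (co ^~ y)))) <= eps * rnorm y.
Proof.
move=> /roeP[bp hp] eps0; have em := rnorm_e_gt0 sb m.
have [|b [bb [r r0 hr]] pb] := hp (eps * rnorm (e m)); first by rewrite mulr_gt0.
have [K hK] := ball_bounded m r0; exists K => N y KN.
set z := y - _.
have coz j : co j z = if (j < N)%N then 0 else co j y.
  by rewrite /z biorthB// biorth_section//; case: ifP; rewrite ?subrr ?subr0.
have zy : rnorm z <= rnorm y.
  by apply: (biorth_le_rnorm sb u1) => j; rewrite coz; case: ifP; rewrite // rnorm0 rnorm_ge0.
have [C C0 bC] := bounded_op_rbounded bb; have [lb _] := bb.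
have -> : p z = (p - b) z + b z by rewrite opBE subrK.
rewrite biorthD// (_ : co m (b z) = 0) ?addr0.
  rewrite (le_trans (biorth_bounded sb u1 m _))// mulrC ler_pdivrMr//.
  by rewrite (le_trans (pb z))// mulrAC ler_wpM2r ?(ltW em)// ler_wpM2l// ltW.
have lc : scalar (co m \o b) by move=> c u v /=; rewrite lb biorth_lin.
have bc : rbounded ((rnorm (e m))^-1 * C) (co m \o b).
  move=> u /=; rewrite (le_trans (biorth_bounded sb u1 _ _))// -mulrA.
  by apply: ler_wpM2l (bC u); rewrite invr_ge0 rnorm_ge0.
apply: (@functional_eq0 (co m \o b) _ z lc bc) => j /=; rewrite coz.
case: ltnP => jN; first by rewrite mul0r.
rewrite hr ?mulr0// ltNge; apply/negP => dj.
by have := hK j; rewrite (Defs.metricC md) => /(_ dj); rewrite ltnNge (leq_trans KN).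
Qed.

Lemma rank_one_row_tail (x : E) (y : E -> R[i]) (eps : R) :
  scalar y -> roe d e (rank_one x y) -> x != 0 -> 0 < eps ->
  exists K, forall N z, (K <= N)%N ->
    rnorm (y (z - section e N (co ^~ z))) <= eps * rnorm z.
Proof.
move=> ly rp x0 eps0.
have [m xm] : exists m, co m x != 0.
  apply: contrapT => H; move/eqP: x0; apply.
  apply: (biorth_inj sb) => i; rewrite (scal0 (biorth_is_scalar sb i)).
  by apply/eqP; apply: contrapT => h; apply: H; exists i; apply/negP.
have cx : 0 < rnorm (co m x) by rewrite rnorm_gt0.
have [|K hK] := @row_tail _ m (eps * rnorm (co m x)) rp; first by rewrite mulr_gt0.
exists K => N z KN; have := hK N z KN; rewrite /rank_one biorthZ// rnormM.
by rewrite mulrAC ler_pM2r.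
Qed.

End RowTail.

Section IsoRigidity.
Variables (R : realType) (E F : completeNormedModType R[i]).
Variables (d del : nat -> nat -> R) (e : nat -> E) (f : nat -> F).
Variables (Phi : (E -> E) -> F -> F) (Psi : (F -> F) -> E -> E) (M : R).
Hypotheses (md : is_metric d) (mdel : is_metric del).
Hypotheses (sbe : schauder_basis e) (sbf : schauder_basis f).
Hypotheses (ue : one_unconditional e) (uf : one_unconditional f).
Hypotheses (ulf : uniformly_locally_finite d) (ulf' : uniformly_locally_finite del).
Hypothesis ms : metric_symmetric del f.
Hypothesis iso : algebra_iso (roe d e) (roe del f) Phi Psi M.
Hypothesis M0 : 0 <= M.
Variables (x : nat -> E) (y : nat -> E -> R[i]) (v : nat -> F) (w : nat -> F -> R[i]).
Local Notation coe := (biorth e).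
Local Notation cof := (biorth f).
Hypothesis ly : forall j, scalar (y j).
Hypothesis y_bounded : forall j, exists2 C : R, 0 <= C & rbounded C (y j).
Hypothesis yx : forall i, y i (x i) = 1.
Hypothesis xyE : forall i j, roe d e (rank_one (x i) (y j)) /\
  Psi (munit f i j) = rank_one (x i) (y j).
Hypothesis coef : forall a, roe d e a -> forall i j, cof i (Phi a (f j)) = y i (a (x j)).
Hypothesis lw : forall j, scalar (w j).
Hypothesis bw : forall j, exists2 C : R, 0 <= C & rbounded C (w j).
Hypothesis wv : forall i, w i (v i) = 1.
Hypothesis vwE : forall i j, roe del f (rank_one (v i) (w j)) /\
  Phi (munit e i j) = rank_one (v i) (w j).
Hypothesis regularity : Phi @` band d e `<=`
    regular_roe del f `|` (bounded_op F `\` regular f).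

Lemma entry_product n m i j :
  cof i (v n) * w m (f j) = y i (e n) * coe m (x j).
Proof.
have := coef (roe_munit md sbe ue n m) i j; have [_ ->] := vwE n m.
by rewrite /rank_one /munit biorthZ// /rank_one (scalZ (ly i)) mulrC => ->; rewrite mulrC.
Qed.

Let rE := roe_munit md sbe ue.
Let rF := roe_munit mdel sbf uf.

Let PhiE i j : Phi (rank_one (x i) (y j)) = munit f i j.
Proof. by have [_ <-] := xyE i j; rewrite (algebra_isoKV iso). Qed.

Let x_neq0 i : x i != 0.
Proof.
by apply/eqP => x0; have /eqP := yx i; rewrite x0 (scal0 (ly i)) eq_sym oner_eq0.
Qed.

Let v_neq0 i : v i != 0.
Proof.
by apply/eqP => v0; have /eqP := wv i; rewrite v0 (scal0 (lw i)) eq_sym oner_eq0.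
Qed.

Lemma iso_sum_munit (A : set nat) N :
  roe d e (\sum_(0 <= n < N | n \in A) munit e n n) /\
  Phi (\sum_(0 <= n < N | n \in A) munit e n n) =
    fun z => \sum_(0 <= n < N | n \in A) w n z *: v n.
Proof.
elim: N => [|N [ih1 ih2]].
  rewrite big_nil; split; first exact: roe0.
  by rewrite (algebra_iso0 md sbe ue iso); apply/funext => z; rewrite big_nil.
rewrite big_mkcond big_nat_recr//= -big_mkcond.
have -> : (fun z => \sum_(0 <= n < N.+1 | n \in A) w n z *: v n) =
    (fun z => (\sum_(0 <= n < N | n \in A) w n z *: v n) + if N \in A then w N z *: v N else 0).
  by apply/funext => z; rewrite big_mkcond big_nat_recr//= -big_mkcond.
case: ifPn => NA; last first.
  by rewrite addr0; split => //; rewrite ih2; apply/funext => z; rewrite addr0.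
split; first exact: roeD.
by rewrite (algebra_isoD iso)// ih2; have [_ ->] := vwE N N.
Qed.

Lemma sums_bounded (A : set nat) N :
  rbounded M (fun z => \sum_(0 <= n < N | n \in A) w n z *: v n).
Proof.
have [h1 <-] := iso_sum_munit A N; rewrite -[M]mulr1; apply: (algebra_iso_bd iso) => // z.
rewrite mul1r; apply: (le_trans _ (section_le sbe ue N z)).
rewrite fct_sumE big_mkcond /=.
rewrite (eq_bigr (fun n => (if n \in A then coe n z else 0) *: e n)); last first.
  by move=> n _; rewrite /munit /rank_one; case: ifP; rewrite ?scale0r.
by apply: (section_mono ue) => n _; case: ifP; rewrite // rnorm0 rnorm_ge0.
Qed.

Lemma iso_tail_small n (eps : R) : 0 < eps ->
  exists K, forall N z, (K <= N)%N ->
    rnorm (v n - section f N (cof ^~ (v n))) * rnorm (w n z) <= eps * rnorm z /\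
    rnorm (v n) * rnorm (w n (z - section f N (cof ^~ z))) <= eps * rnorm z.
Proof.
move=> eps0; have [C C0 wC] := bw n; have C1 : 0 < C + 1 by rewrite ltr_wpDl.
have [|K1 hK1] := @section_tail _ _ f sbf (v n) (eps / (C + 1)); first by rewrite divr_gt0.
have vn : 0 < rnorm (v n) by rewrite rnorm_gt0.
have [rp _] := vwE n n.
have [|K2 hK2] := @rank_one_row_tail _ _ f del sbf uf mdel ulf' _ _ (eps / rnorm (v n)) (lw n) rp (v_neq0 n).
  by rewrite divr_gt0.
exists (maxn K1 K2) => N z; rewrite geq_max => /andP[k1 k2]; split.
  have := hK1 N k1; rewrite ltr_pdivlMr// => h1.
  have := wC z; have := rnorm_ge0 z; have := rnorm_ge0 (v n - section f N (cof ^~ (v n))).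
  set a := rnorm _ in h1 *; set b := rnorm z; set c := rnorm _ => a0 b0 cb.
  apply: (@le_trans _ _ (a * (C * b))); first exact: ler_wpM2l.
  by rewrite mulrA ler_wpM2r//; apply: le_trans (ltW h1); rewrite ler_wpM2l// lerDl.
by have := hK2 N z k2; rewrite mulrAC ler_pdivlMr// => h; rewrite mulrC.
Qed.

Let columns_small i (eps : R) : 0 < eps -> exists n0, forall n, (n0 <= n)%N ->
  rnorm (y i (e n)) <= eps * rnorm (e n).
Proof.
move=> eps0; have [rp _] := xyE i i.
have [K hK] := @rank_one_row_tail _ _ e d sbe ue md ulf _ _ eps (ly i) rp (x_neq0 i) eps0.
exists K => n Kn; have := hK n (e n) Kn.
suff -> : section e n (coe ^~ (e n)) = 0 by rewrite subr0.
rewrite /section big_nat big1// => k /andP[_ kn].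
by rewrite biorth_e// (ltn_eqF kn) scale0r.
Qed.

Let rows_small j (eps : R) : 0 < eps -> exists n0, forall n, (n0 <= n)%N ->
  rnorm (coe n (x j)) * rnorm (e n) <= eps.
Proof.
move=> eps0; have [|K hK] := @section_tail _ _ e sbe (x j) (eps / 2); first by rewrite divr_gt0.
exists K => n Kn; have h1 := hK n Kn; have h2 := hK n.+1 (leqW Kn).
rewrite -rnormZ (_ : _ *: _ = (x j - section e n (coe ^~ (x j))) -
  (x j - section e n.+1 (coe ^~ (x j)))).
  by rewrite (le_trans (rnormB _ _))//; lra.
by rewrite sectionS opprB addrC addrA subrK addrAC subrr add0r.
Qed.

Lemma iso_head_small N (eps : R) : 0 < eps ->
  exists n0, forall n z, (n0 <= n)%N ->
    rnorm (section f N (cof ^~ (v n))) * rnorm (w n z) <= eps * rnorm z /\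
    rnorm (v n) * rnorm (w n (section f N (cof ^~ z))) <= eps * rnorm z.
Proof.
move=> eps0; have N1 : 0 < N%:R + 1 :> R by rewrite ltr_wpDl.
pose eta := eps / (N%:R + 1); have eta0 : 0 < eta by rewrite divr_gt0.
have sum_eta (z : F) : \sum_(0 <= i < N) eta * rnorm z <= eps * rnorm z :> R.
  rewrite sumr_const_nat subn0 -mulr_natr mulrAC ler_wpM2r ?rnorm_ge0//.
  by rewrite /eta mulrAC ler_pdivrMr// ler_wpM2l ?(ltW eps0)// lerDl.
have [|n1 hn1] := @eventually_forall_lt (fun i n => forall z : F,
    rnorm (cof i (v n)) * rnorm (f i) * rnorm (w n z) <= eta * rnorm z) N.
  move=> i _; have Q0 : 0 < M * rnorm (x i) + 1 by rewrite ltr_wpDl// mulr_ge0// rnorm_ge0.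
  have [|n0 hn0] := @columns_small i (eta / (M * rnorm (x i) + 1)); first by rewrite divr_gt0.
  exists n0 => n nn z; have [rp _] := xyE i i.
  pose k := rnorm (y i (e n)) / rnorm (e n).
  have k0 : 0 <= k by rewrite divr_ge0 ?rnorm_ge0.
  have kle : k <= eta / (M * rnorm (x i) + 1).
    by rewrite /k ler_pdivrMr ?hn0//; exact: rnorm_e_gt0.
  have bd : rbounded (k * rnorm (x i)) (rank_one (x i) (y i) \o munit e n n).
    move=> u; rewrite /rank_one /munit /= /rank_one rnormZ (scalZ (ly i)) rnormM.
    rewrite [leRHS](_ : _ = rnorm (y i (e n)) * rnorm (x i) * ((rnorm (e n))^-1 * rnorm u));
      last by rewrite /k; ring.
    rewrite [leLHS](_ : _ = rnorm (y i (e n)) * rnorm (x i) * rnorm (coe n u)); last by ring.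
    by rewrite ler_wpM2l ?mulr_ge0 ?rnorm_ge0//; exact: biorth_bounded.
  have kx0 : 0 <= k * rnorm (x i) by rewrite mulr_ge0// rnorm_ge0.
  have := algebra_iso_bd iso kx0 (roe_comp sbe ue md rp (rE n n)) bd z.
  rewrite (algebra_isoM iso rp (rE n n)) PhiE; have [_ ->] := vwE n n.
  rewrite /munit /= /rank_one biorthZ// rnormZ rnormM => h.
  rewrite [leLHS](_ : _ = rnorm (w n z) * rnorm (cof i (v n)) * rnorm (f i)); last by ring.
  apply: (le_trans h); rewrite ler_wpM2r ?rnorm_ge0//.
  move: kle; rewrite ler_pdivlMr// => kle; apply: le_trans kle.
  rewrite mulrDr mulr1; have -> : M * (k * rnorm (x i)) = k * (M * rnorm (x i)) by ring.
  by rewrite lerDl.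
have [|n2 hn2] := @eventually_forall_lt (fun j n =>
    rnorm (v n) * rnorm (w n (f j)) <= eta * rnorm (f j)) N.
  move=> j _; have [C C0 yC] := y_bounded j; have Q0 : 0 < M * C + 1 by rewrite ltr_wpDl// mulr_ge0.
  have [|n0 hn0] := @rows_small j (eta / (M * C + 1)); first by rewrite divr_gt0.
  exists n0 => n nn; have [rp _] := xyE j j.
  pose k := rnorm (coe n (x j)) * rnorm (e n).
  have k0 : 0 <= k by rewrite mulr_ge0 ?rnorm_ge0.
  have kle := hn0 n nn.
  have bd : rbounded (C * k) (munit e n n \o rank_one (x j) (y j)).
    move=> u; rewrite /rank_one /munit /= /rank_one rnormZ biorthZ// rnormM.
    rewrite [leRHS](_ : _ = C * rnorm u * k); last by ring.
    by rewrite -mulrA ler_wpM2r.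
  have kC0 : 0 <= C * k by rewrite mulr_ge0.
  have := algebra_iso_bd iso kC0 (roe_comp sbe ue md (rE n n) rp) bd (f j).
  rewrite (algebra_isoM iso (rE n n) rp) PhiE; have [_ ->] := vwE n n.
  rewrite /munit /= /rank_one biorth_e// eqxx scale1r rnormZ => h.
  rewrite mulrC (le_trans h)// ler_wpM2r ?rnorm_ge0//.
  move: kle; rewrite ler_pdivlMr// -/k => kle; apply: le_trans kle.
  rewrite mulrDr mulr1; have -> : M * (C * k) = k * (M * C) by ring.
  by rewrite lerDl.
exists (maxn n1 n2) => n z; rewrite geq_max => /andP[l1 l2]; split.
  apply: le_trans (sum_eta z).
  apply: (@le_trans _ _ ((\sum_(0 <= i < N) rnorm (cof i (v n)) * rnorm (f i)) * rnorm (w n z))).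
    rewrite ler_wpM2r ?rnorm_ge0// (le_trans (rnorm_sum _ _ _))//.
    by apply: ler_sum => i _; rewrite rnormZ.
  by rewrite mulr_suml; apply: ler_sum_nat => i /andP[_ iN]; exact: hn1.
apply: le_trans (sum_eta z).
rewrite functional_section//.
apply: (@le_trans _ _ (rnorm (v n) * \sum_(0 <= j < N) rnorm (cof j z) * rnorm (w n (f j)))).
  rewrite ler_wpM2l ?rnorm_ge0// (le_trans (rnorm_sum _ _ _))//.
  by apply: ler_sum => j _; rewrite rnormM.
rewrite mulr_sumr; apply: ler_sum_nat => j /andP[_ jN]; rewrite mulrCA.
apply: (@le_trans _ _ (rnorm (cof j z) * (eta * rnorm (f j)))).
  by rewrite ler_wpM2l ?rnorm_ge0// hn2.
rewrite mulrCA ler_wpM2l ?(ltW eta0)//; exact: biorth_e_le.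
Qed.

Lemma iso_subseries (A : set nat) : exists a : F -> F,
  [/\ bounded_op F a,
    forall i j (eps : R), 0 < eps -> exists L0, forall L, (L0 <= L)%N ->
      rnorm (cof i (a (f j)) - \sum_(0 <= n < L | n \in A) cof i (v n) * w n (f j)) <= eps &
    regular f a -> regular_roe del f a].
Proof.
pose c n : R[i] := if n \in A then 1 else 0.
have [|T [bT _ _ _ Tl]] := @diagonal_op _ _ e d sbe ue md c.
  by move=> n; rewrite /c; case: ifP; rewrite ?rnorm1 ?rnorm0.
have rT := band_roe bT; have rPT := algebra_iso_in iso rT.
exists (Phi T); split.
- exact: roe_bounded rPT.
- move=> i j eps eps0; have [C C0 yC] := y_bounded i.
  have [L0 hL0] := functional_limit (ly i) yC (Tl (x j)) eps0.
  exists L0 => L LL; rewrite coef// rnormBC; apply: ltW; apply: le_lt_trans (hL0 L LL).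
  rewrite le_eqVlt; apply/orP; left; apply/eqP; congr (rnorm (_ - _)).
  rewrite (scal_sum (ly i)) big_mkcond; apply: eq_bigr => n _.
  rewrite !(scalZ (ly i)) /c; case: ifP => _; last by rewrite mul0r mulr0.
  by rewrite mul1r entry_product mulrC.
- move=> rg; have : (Phi @` band d e) (Phi T) by exists T.
  by move=> /regularity [//|[_ nr]].
Qed.

Lemma iso_rigidity : exists2 dl : R, 0 < dl & forall n, exists i j,
  dl <= (rnorm (y i (e n)) * rnorm (f i) / rnorm (e n)) *
        (rnorm (coe n (x j)) * rnorm (e n) / rnorm (f j)).
Proof.
have [dl dl0 h] := rigidity sbf uf mdel ulf' ms lw wv M0 sums_bounded
  iso_tail_small iso_head_small iso_subseries.
exists dl => // n; have [i [j ij]] := h n; exists i, j; apply: (le_trans ij).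
rewrite /normalized_entry -rnormM entry_product rnormM.
have en := rnorm_e_gt0 sbe n; have fj := rnorm_e_gt0 sbf j.
rewrite le_eqVlt; apply/orP; left; apply/eqP; field.
by rewrite !gt_eqF.
Qed.

Lemma iso_entries_bounded i n m j :
  (rnorm (y i (e n)) * rnorm (f i) / rnorm (e n)) *
  (rnorm (coe m (x j)) * rnorm (e m) / rnorm (f j)) <= M.
Proof.
have en := rnorm_e_gt0 sbe n; have em := rnorm_e_gt0 sbe m; have fj := rnorm_e_gt0 sbf j.
have := algebra_iso_bd iso _ (rE n m) (munit_bounded sbe ue n m).
move=> /(_ (divr_ge0 (ltW en) (ltW em))) /(abs_matrix_entry_le sbf uf i j).
rewrite /abs_matrix coef// /munit /rank_one (scalZ (ly i)) rnormM => h.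
rewrite [leLHS](_ : _ = (rnorm (coe m (x j)) * rnorm (y i (e n)) * rnorm (f i)) *
  (rnorm (e m) / rnorm (e n) / rnorm (f j))); last by field; rewrite !gt_eqF.
have k0 : 0 <= rnorm (e m) / rnorm (e n) / rnorm (f j) by rewrite !divr_ge0 ?ltW.
apply: (le_trans (ler_wpM2r k0 h)); rewrite le_eqVlt; apply/orP; left; apply/eqP.
by field; rewrite !gt_eqF.
Qed.

End IsoRigidity.

Theorem theorem7p20 (R : realType) (d del : nat -> nat -> R)
    (E F : completeNormedModType R[i]) (e : nat -> E) (f : nat -> F)
    (Phi : (E -> E) -> (F -> F)) :
  is_metric d -> is_metric del ->
  uniformly_locally_finite d -> uniformly_locally_finite del ->
  schauder_basis e -> schauder_basis f ->
  one_unconditional e -> one_unconditional f ->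
  metric_symmetric d e -> metric_symmetric del f ->
  property_A del ->
  banach_algebra_iso (roe d e) (roe del f) Phi ->
  Phi @` band d e `<=`
    regular_roe del f `|` (bounded_op F `\` regular f) ->
  roe d e `&` Phi @^-1` band del f `<=`
    regular_roe d e `|` (bounded_op E `\` regular e) ->
  coarsely_equivalent d del.
Proof.
move=> md mdel ulf ulf' sbe sbf ue uf ms ms' _ biso regF regE.
have [Psi [M [M0 iso]]] := banach_algebra_iso_inverse md mdel sbe sbf ue uf biso.
have iso' := algebra_iso_sym iso.
have [x [y [ly yC yx xyE coef]]] := spatial_data md mdel sbe sbf ue uf iso.
have [v [w [lw wC wv vwE coef']]] := spatial_data mdel md sbf sbe uf ue iso'.
have regE' : Psi @` band del f `<=` regular_roe d e `|` (bounded_op E `\` regular e).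
  move=> _ [b bb <-]; apply: regE; split; first exact: (algebra_iso_inV iso (band_roe bb)).
  by rewrite /preimage /= (algebra_isoKV iso)//; exact: band_roe.
pose U i n := rnorm (y i (e n)) * rnorm (f i) / rnorm (e n).
pose V m j := rnorm (biorth e m (x j)) * rnorm (e m) / rnorm (f j).
have U0 i n : 0 <= U i n by rewrite /U divr_ge0 ?mulr_ge0 ?rnorm_ge0.
have V0 m j : 0 <= V m j by rewrite /V divr_ge0 ?mulr_ge0 ?rnorm_ge0.
have swap n i j m :
  (rnorm (w n (f i)) * rnorm (e n) / rnorm (f i)) *
  (rnorm (biorth f j (v m)) * rnorm (f j) / rnorm (e m)) = V n i * U j m.
  have := congr1 (@rnorm R R[i]) (entry_product md sbe sbf ue ly coef vwE m n j i).
  rewrite !rnormM => h; rewrite /V /U.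
  set a := rnorm (w _ _) in h *; set b := rnorm (biorth _ _ (v _)) in h *.
  set a' := rnorm (y _ _) in h *; set b' := rnorm (biorth _ _ (x _)) in h *.
  rewrite (_ : _ * _ = b * a * (rnorm (e n) / rnorm (f i) * (rnorm (f j) / rnorm (e m)))); last by ring.
  by rewrite h; ring.
have UV i n m j : U i n * V m j <= M + 1.
  have := iso_entries_bounded md sbe sbf ue uf iso ly coef i n m j.
  by move=> h; rewrite (le_trans h)// lerDl.
have M1 : 0 < M + 1 by rewrite ltr_wpDl.
have VU n i j m : V n i * U j m <= M + 1 by rewrite mulrC.
have [dl dl0 rig] := iso_rigidity md mdel sbe sbf ue uf ulf ulf' ms' iso M0
  ly yC yx xyE coef lw wC wv vwE regF.
have [dl' dl0' rig'] := iso_rigidity mdel md sbf sbe uf ue ulf' ulf ms iso' M0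
  lw wC wv vwE coef' ly yC yx xyE regE'.
have [g gP] := choice rig; have [h hP] := choice gP.
have [g' gP'] := choice rig'; have [h' hP'] := choice gP'.
have {}hP n : dl <= U (g n) n * V n (h n) by exact: hP.
have {}hP' i : dl' <= V (g' i) i * U i (h' i) by rewrite -swap; exact: hP'.
have od (r eps : R) : 0 < r -> 0 < eps -> exists s, forall n m, d n m <= r ->
    forall i j, eps <= U i n * V m j -> del i j <= s.
  exact: (off_diagonal md mdel sbe sbf ue uf ulf ms iso ly yC coef).
have od' (r eps : R) : 0 < r -> 0 < eps -> exists s, forall i j, del i j <= r ->
    forall n m, eps <= V n i * U j m -> d n m <= s.
  move=> r0 eps0.
  have [s hs] := off_diagonal mdel md sbf sbe uf ue ulf' ms' iso' lw wC coef' r0 eps0.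
  by exists s => i j ij n m; rewrite -swap; exact: hs.
have cg := coarse_of_matrices md mdel dl0 M1 U0 V0 UV hP od.
have cg' := coarse_of_matrices mdel md dl0' M1 V0 U0 VU hP' od'.
have [s1 hs1] := close_of_matrices mdel dl0 dl0' M1 U0 V0 UV hP hP' od'.
have [s2 hs2] := close_of_matrices md dl0' dl0 M1 V0 U0 VU hP' hP od.
exact: (coarsely_equivalent_of_quasi_inverse md mdel cg cg' hs1 hs2).
Qed.
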